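(* Assume the standing setting below, and let $\psi$ be a positive function, defined for all sufficiently large $q$, which is nonincreasing, bounded, and slowly varying (for each $K>0$, $\psi(Kq)\asymp\psi(q)$ with constants depending on $K$). (i) If $\sum_{q}\frac{\log(q)\,\psi(q)^\delta}{q}<\infty$, then $\mu$-almost every $x\in J$ is badly symbolically approximable with respect to $\psi$. (ii) If $\psi(q)<1$ for all sufficiently large $q$ and $\sum_{q}\frac{\log(q)\,\psi(q)^\delta}{q\,|\log\psi(q)|}=\infty$ (sum over sufficiently large $q$), then $\mu$-almost every $x\in J$ is symbolically well approximable with respect to $\psi$. In particular, for every $\varepsilon>0$, case (i) applies to $\psi(q)=(\log q)^{-(2/\delta+\varepsilon)}$, and case (ii) applies to $\psi(q)=(\log q)^{-2/\delta}$.
   Context: Standing setting: $(u_a)_{a\in E}$ is a rational IFS on $\mathbb{R}$, $u_a(x)=\frac{p_a}{q_a}x+\frac{r_a}{q_a}$ with $p_a\in\{\pm1\}$, $r_a\in\mathbb{Z}$, $q_a\in\mathbb{N}$, $q_a\ge2$, $\#E\ge2$, satisfying the strong separation condition (a closed interval $I$ with the $u_a(I)$ pairwise disjoint subsets of $I$); $\pi(\omega)=\lim_n u_{\omega_1}\circ\cdots\circ u_{\omega_n}(0)$ is the coding map, $J$ the limit set, $\delta$ its Hausdorff dimension, $\mu=\mathcal{H}^\delta|_J/\mathcal{H}^\delta(J)$. Every rational in $J$ has a unique, eventually periodic coding $\omega$. Intrinsic denominator: with $n\ge0$ minimal such that $(\omega_i)_{i>n}$ is periodic and $m\ge1$ its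 minimal period, $q_{\mathrm{int}}:=\big(\prod_{i=1}^n q_{\omega_i}\big)\big(\prod_{i=1}^m q_{\omega_{n+i}}-\prod_{i=1}^m p_{\omega_{n+i}}\big)$. A point $x\in J$ is badly symbolically approximable w.r.t. $\psi$ if there is $\varepsilon>0$ with $|x-p/q|\ge\varepsilon\psi(q_{\mathrm{int}})/q_{\mathrm{int}}$ for all $p/q\in\mathbb{Q}\cap J$; otherwise it is symbolically well approximable w.r.t. $\psi$. *)

(* Defs.v *)
From Stdlib Require Import Reals ZArith Lra Lia.
Open Scope R_scope.

(* The alphabet E is {0,...,N-1}; the map u_a(x) = (p_a x + r_a)/q_a. *)
Record IFS := mkIFS {
  ifsN : nat;
  ifsp : nat -> Z;
  ifsr : nat -> Z;
  ifsq : nat -> nat }.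

Definition u (F : IFS) (a : nat) (x : R) : R :=
  (IZR (ifsp F a) * x + IZR (ifsr F a)) / INR (ifsq F a).

Definition in_I (lo hi x : R) : Prop := lo <= x <= hi.

Definition rational_IFS (F : IFS) : Prop :=
  (2 <= ifsN F)%nat /\
  (forall a, (a < ifsN F)%nat -> ifsp F a = 1%Z \/ ifsp F a = (-1)%Z) /\
  (forall a, (a < ifsN F)%nat -> (2 <= ifsq F a)%nat) /\
  (exists lo hi, lo <= hi /\
     (forall a x, (a < ifsN F)%nat -> in_I lo hi x -> in_I lo hi (u F a x)) /\
     (forall a b x y, (a < ifsN F)%nat -> (b < ifsN F)%nat -> a <> b ->
        in_I lo hi x -> in_I lo hi y -> u F a x <> u F b y)).

(* A word w : nat -> nat is 0-indexed: w 0 is omega_1 of the paper. *)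
Definition valid_word (F : IFS) (w : nat -> nat) : Prop :=
  forall i, (w i < ifsN F)%nat.

Fixpoint comp (F : IFS) (w : nat -> nat) (n : nat) (x : R) : R :=
  match n with
  | O => x
  | S k => comp F w k (u F (w k) x)
  end.

Definition coding (F : IFS) (w : nat -> nat) (x : R) : Prop :=
  Un_cv (fun n => comp F w n 0) x.

Definition limit_set (F : IFS) (x : R) : Prop :=
  exists w, valid_word F w /\ coding F w x.

(* d^s, with the convention 0^s = 0 (diameter of the empty set / points). *)
Definition rpow (d s : R) : R :=
  if Req_EM_T d 0 then 0 else Rpower d s.

(* H^s(A) = 0: for every eta > 0 the eta-approximate s-dimensional
   Hausdorff outer measure H^s_eta(A) vanishes, i.e. for every eps > 0
   there is a countable cover (U i) of A by sets of diameter <= d i <= eta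
   with sum_i (d i)^s <= eps. *)
Definition H_null (s : R) (A : R -> Prop) : Prop :=
  forall eta eps, 0 < eta -> 0 < eps ->
    exists (U : nat -> R -> Prop) (d : nat -> R),
      (forall x, A x -> exists i, U i x) /\
      (forall i, 0 <= d i <= eta /\
         (forall x y, U i x -> U i y -> Rabs (x - y) <= d i)) /\
      (forall n, sum_f_R0 (fun i => rpow (d i) s) n <= eps).

Definition is_glb (S : R -> Prop) (m : R) : Prop :=
  (forall s, S s -> m <= s) /\ (forall b, (forall s, S s -> b <= s) -> b <= m).

Definition hausdorff_dim (A : R -> Prop) (delta : R) : Prop :=
  is_glb (fun s => 0 <= s /\ H_null s A) delta.

(* mu-almost every x in J satisfies P, where mu = H^delta|_J / H^delta(J):
   the set of points of J failing P is H^delta-null. *)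
Definition mu_ae (F : IFS) (delta : R) (P : R -> Prop) : Prop :=
  H_null delta (fun x => limit_set F x /\ ~ P x).

Fixpoint prodZ (f : nat -> Z) (n : nat) : Z :=
  match n with
  | O => 1%Z
  | S k => (prodZ f k * f k)%Z
  end.

(* the tail (w_i)_{i > n} (paper indexing) is periodic with period m *)
Definition periodic_from (w : nat -> nat) (n m : nat) : Prop :=
  forall i, (n <= i)%nat -> w (i + m)%nat = w i.

Definition min_pre_period (w : nat -> nat) (n m : nat) : Prop :=
  (1 <= m)%nat /\ periodic_from w n m /\
  (forall n' m', (1 <= m')%nat -> periodic_from w n' m' -> (n <= n')%nat) /\
  (forall m', (1 <= m')%nat -> periodic_from w n m' -> (m <= m')%nat).

Definition q_int (F : IFS) (w : nat -> nat) (n m : nat) : Z :=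
  (prodZ (fun i => Z.of_nat (ifsq F (w i))) n *
   (prodZ (fun i => Z.of_nat (ifsq F (w (n + i)%nat))) m
    - prodZ (fun i => ifsp F (w (n + i)%nat)) m))%Z.

Definition is_rational (y : R) : Prop :=
  exists a b : Z, b <> 0%Z /\ y = IZR a / IZR b.

Definition badly_symb_approx (F : IFS) (psi : R -> R) (x : R) : Prop :=
  exists eps, 0 < eps /\
    forall y w n m,
      is_rational y -> limit_set F y ->
      valid_word F w -> coding F w y -> min_pre_period w n m ->
      Rabs (x - y) >= eps * psi (IZR (q_int F w n m)) / IZR (q_int F w n m).

Definition symb_well_approx (F : IFS) (psi : R -> R) (x : R) : Prop :=
  ~ badly_symb_approx F psi x.

Definition admissible (psi : R -> R) (q0 : R) : Prop :=
  (forall q, q0 <= q -> 0 < psi q) /\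
  (forall x y, q0 <= x -> x <= y -> psi y <= psi x) /\
  (exists M, forall q, q0 <= q -> psi q <= M) /\
  (forall K, 0 < K -> exists c C Q, 0 < c /\ 0 < C /\
     forall q, Q <= q -> c * psi q <= psi (K * q) /\ psi (K * q) <= C * psi q).

Definition series_converges (a : nat -> R) : Prop :=
  exists (Q : nat) (l : R), infinite_sum (fun n => a (n + Q)%nat) l.

Definition term1 (delta : R) (psi : R -> R) (k : nat) : R :=
  ln (INR k) * Rpower (psi (INR k)) delta / INR k.

Definition term2 (delta : R) (psi : R -> R) (k : nat) : R :=
  ln (INR k) * Rpower (psi (INR k)) delta / (INR k * Rabs (ln (psi (INR k)))).

Definition psi_log (t : R) (q : R) : R := Rpower (ln q) (- t).

(* Main.v *)
(** The Moran equation [sum_a q_a^(-delta) = 1] turns [H^delta] on the limit set into a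
    Bernoulli measure on words, and a rational with preperiod [n] and period [m] has an
    intrinsic denominator comparable to the product of the first [n + m] denominators of its
    coding.  A null set for this Bernoulli measure is [H^delta]-null, so both parts
    reduce to weighted counts of finite words.

    Convergence: there are [k] choices of [n < k = n + m], so the balls of radius
    [psi(q)/q] have total [delta]-mass at most a constant times
    [sum_k k psi(2^k)^delta], which is the hypothesis condensed.

    Divergence: if a block of letters read at position [n] reappears at position [n + m],
    then the point is close to the rational with preperiod [n] and period [m].  In stage
    [j] one reads about [2^j] letters and then about [2^j / |log psi|] disjoint blocks, each
    cut as soon as its denominator exceeds [t ~ 1/psi], and counts the occurrences of
    these blocks among the letters read first.  Conditionally on those letters the blocks
    are independent, and a single word overlaps itself only with geometrically decaying
    probability, so the second moment method gives a hit with probability at least a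
    constant times [mu / (mu + 1)], [mu = 4^j psi^delta / |log psi|].  Stages use disjoint
    letters, hence are independent, and [sum mu] diverges. *)
From Stdlib Require Import Reals ZArith Lra Lia List Arith Cantor FinFun.
From Stdlib Require Import Classical ClassicalEpsilon FunctionalExtensionality.
Require Import Defs.
Import ListNotations.
Open Scope R_scope.

(** * Hausdorff-null sets *)

(** No measure is constructed. [mu_ae] only asks for covers, so a probability is a finite weighted
    sum over the words of one length ([Ex]), independence is the splitting of such a sum at a
    position, and null sets are given by explicit covers.

    The Moran equation is not proved as an equality. The dimension, an infimum, yields
    [moran F delta <= 1]; when this is strict, the whole limit set is null for the exponent [delta]
    and the divergence part has nothing left to show.

    Two obstacles shape the divergence part. The constant in bad approximability is unknown, so the
    proximity asked for is scaled by [A r] and a union over integers [r] is taken. And psi is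
    evaluated at a denominator that depends on the random word, so stage [j] works with psi at
    [2 ^ 2 ^ (j + c)], a bound for all denominators met by then: as psi is nonincreasing this is the
    more demanding value, and condensing the series along these points costs only constants.
    Rationals whose denominator is too small for psi to be controlled have short codings, hence are
    finitely many; a point that is not eventually periodic keeps a positive distance from them. *)

Fixpoint rsum (n : nat) (f : nat -> R) : R :=
  match n with O => 0 | S k => rsum k f + f k end.

Lemma rsum_ext n f g : (forall i, (i < n)%nat -> f i = g i) -> rsum n f = rsum n g.
Proof.
  induction n as [|n IH]; simpl; intros H; [reflexivity|].
  rewrite IH, H; [reflexivity|lia|]. intros; apply H; lia.
Qed.

Lemma rsum_le n f g : (forall i, (i < n)%nat -> f i <= g i) -> rsum n f <= rsum n g.
Proof.
  induction n as [|n IH]; simpl; intros H; [lra|].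
  apply Rplus_le_compat; [apply IH; intros; apply H; lia|apply H; lia].
Qed.

Lemma rsum_const n c : rsum n (fun _ => c) = INR n * c.
Proof. induction n as [|n IH]; [simpl; ring|]. simpl rsum. rewrite IH, S_INR. ring. Qed.

Lemma rsum_nonneg n f : (forall i, (i < n)%nat -> 0 <= f i) -> 0 <= rsum n f.
Proof.
  intros H. apply Rle_trans with (rsum n (fun _ => 0)).
  - rewrite rsum_const; lra.
  - apply rsum_le; assumption.
Qed.

Lemma rsum_plus n f g : rsum n (fun i => f i + g i) = rsum n f + rsum n g.
Proof. induction n as [|n IH]; simpl; [ring|rewrite IH; ring]. Qed.

Lemma rsum_scal n c f : rsum n (fun i => c * f i) = c * rsum n f.
Proof. induction n as [|n IH]; simpl; [ring|rewrite IH; ring]. Qed.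

Lemma rsum_swap n m f :
  rsum n (fun i => rsum m (fun j => f i j)) = rsum m (fun j => rsum n (fun i => f i j)).
Proof.
  induction n as [|n IH]; simpl.
  - rewrite rsum_const; ring.
  - rewrite IH, <- rsum_plus. reflexivity.
Qed.

Lemma rsum_app n m f : rsum (n + m) f = rsum n f + rsum m (fun i => f (n + i)%nat).
Proof.
  induction m as [|m IH]; simpl; [rewrite Nat.add_0_r; ring|].
  rewrite Nat.add_succ_r. simpl. rewrite IH. ring.
Qed.

Lemma rsum_S_l n f : rsum (S n) f = f 0%nat + rsum n (fun i => f (S i)).
Proof. rewrite (rsum_app 1 n f : rsum (S n) f = _). simpl. ring. Qed.

Lemma rsum_le_len n m f :
  (n <= m)%nat -> (forall i, 0 <= f i) -> rsum n f <= rsum m f.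
Proof.
  intros H Hf. replace m with (n + (m - n))%nat by lia. rewrite rsum_app.
  assert (0 <= rsum (m - n) (fun i => f (n + i)%nat)) by (apply rsum_nonneg; auto).
  lra.
Qed.

Lemma rsum_pos_ex n f :
  rsum n f <> 0 -> exists i, (i < n)%nat /\ f i <> 0.
Proof.
  induction n as [|n IH]; simpl; intros H; [lra|].
  destruct (Req_EM_T (f n) 0) as [E|E].
  - destruct IH as [i [Hi Hf]]; [lra|]. exists i; split; [lia|exact Hf].
  - exists n; split; [lia|exact E].
Qed.

Lemma sum_f_R0_rsum f n : sum_f_R0 f n = rsum (S n) f.
Proof. induction n as [|n IH]; simpl in *; [ring|rewrite IH; reflexivity]. Qed.

Lemma rsum_geom_half n c : 0 <= c -> rsum n (fun k => c * (/ 2) ^ (S k)) <= c.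
Proof.
  intros Hc. assert (H : rsum n (fun k => c * (/ 2) ^ (S k)) = c * (1 - (/ 2) ^ n)).
  { induction n as [|n IH]; [simpl; ring|].
    change (rsum n (fun k => c * (/ 2) ^ (S k)) + c * (/ 2) ^ (S n) = c * (1 - (/ 2) ^ (S n))).
    rewrite IH. simpl. field. }
  rewrite H. assert (0 < (/ 2) ^ n) by (apply pow_lt; lra). nra.
Qed.

Definition lsum {A : Type} (f : A -> R) (l : list A) : R :=
  fold_right (fun a s => f a + s) 0 l.

Lemma lsum_app {A} (f : A -> R) l1 l2 : lsum f (l1 ++ l2) = lsum f l1 + lsum f l2.
Proof. induction l1 as [|a l IH]; simpl; [ring|rewrite IH; ring]. Qed.

Lemma lsum_nonneg {A} (f : A -> R) l : (forall a, In a l -> 0 <= f a) -> 0 <= lsum f l.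
Proof.
  induction l as [|a l IH]; simpl; intros H; [lra|].
  assert (0 <= f a) by auto. assert (0 <= lsum f l) by auto. lra.
Qed.

Lemma lsum_le {A} (f g : A -> R) l :
  (forall a, In a l -> f a <= g a) -> lsum f l <= lsum g l.
Proof.
  induction l as [|a l IH]; simpl; intros H; [lra|].
  assert (f a <= g a) by auto. assert (lsum f l <= lsum g l) by auto. lra.
Qed.

Lemma lsum_map {A B} (f : B -> R) (g : A -> B) l :
  lsum f (map g l) = lsum (fun a => f (g a)) l.
Proof. induction l as [|a l IH]; simpl; [reflexivity|rewrite IH; reflexivity]. Qed.

Lemma lsum_flat_map {A B} (f : B -> R) (g : A -> list B) l :
  lsum f (flat_map g l) = lsum (fun a => lsum f (g a)) l.
Proof.
  induction l as [|a l IH]; simpl; [reflexivity|]. rewrite lsum_app, IH; reflexivity.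
Qed.

Lemma lsum_scal {A} (f : A -> R) c l : lsum (fun a => c * f a) l = c * lsum f l.
Proof. induction l as [|a l IH]; simpl; [ring|rewrite IH; ring]. Qed.

Lemma lsum_seq f n : lsum f (seq 0 n) = rsum n f.
Proof.
  induction n as [|n IH]; [reflexivity|].
  rewrite seq_S, lsum_app, IH. simpl. ring.
Qed.

Lemma lsum_incl {A} (f : A -> R) (l l' : list A) :
  (forall a, 0 <= f a) -> NoDup l -> incl l l' -> lsum f l <= lsum f l'.
Proof.
  intros Hf Hnd. revert l'. induction Hnd as [|a l Ha Hnd IH]; intros l' Hi; simpl.
  - apply lsum_nonneg; auto.
  - destruct (in_split a l') as [l1 [l2 E]]; [apply Hi; left; reflexivity|].
    subst l'. rewrite lsum_app. simpl.
    assert (lsum f l <= lsum f (l1 ++ l2)).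
    { apply IH. intros x Hx. specialize (Hi x (or_intror Hx)).
      apply in_app_or in Hi. apply in_or_app. destruct Hi as [Hi|[Hi|Hi]]; auto.
      subst; contradiction. }
    rewrite lsum_app in H. lra.
Qed.

Lemma lsum_nth {A} (f : A -> R) (d : A) l m :
  (forall a, 0 <= f a) -> f d = 0 -> rsum m (fun j => f (nth j l d)) <= lsum f l.
Proof.
  intros Hf Hd. revert m. induction l as [|a l IH]; intros m; simpl.
  - rewrite (rsum_ext _ _ (fun _ => 0)), rsum_const; [lra|].
    intros i _. destruct i; exact Hd.
  - destruct m as [|m].
    + simpl. pose proof (Hf a). assert (0 <= lsum f l) by (apply lsum_nonneg; auto). lra.
    + rewrite rsum_S_l. specialize (IH m). lra.
Qed.

(** The pairs coded by [i < n] lie in the square of side [n], because the pairing function dominates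
    both coordinates; a partial sum along the enumeration is thus below a rectangular one. *)
Lemma cantor_rsum_le (b : nat * nat -> R) c :
  (forall x, 0 <= b x) ->
  (forall n m, rsum n (fun k => rsum m (fun j => b (k, j))) <= c) ->
  forall n, rsum n (fun i => b (Cantor.of_nat i)) <= c.
Proof.
  intros Hb H n. rewrite <- lsum_seq, <- (lsum_map b Cantor.of_nat).
  apply Rle_trans with (lsum b (list_prod (seq 0 n) (seq 0 n))).
  - apply lsum_incl; [exact Hb| |].
    + apply Injective_map_NoDup; [|apply seq_NoDup].
      intros x y E. rewrite <- (Cantor.cancel_to_of x), <- (Cantor.cancel_to_of y).
      now rewrite E.
    + intros [k j] Hin. apply in_map_iff in Hin. destruct Hin as [i [E Hi]].
      apply in_seq in Hi. pose proof (Cantor.to_nat_non_decreasing k j) as Hk.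
      rewrite <- E, Cantor.cancel_to_of in Hk.
      apply in_prod; apply in_seq; lia.
  - rewrite list_prod_as_flat_map, lsum_flat_map.
    rewrite lsum_seq. specialize (H n n). erewrite rsum_ext; [exact H|].
    intros k _. cbn beta. rewrite lsum_map, lsum_seq. reflexivity.
Qed.

Lemma rpow_nonneg d s : 0 <= rpow d s.
Proof. unfold rpow. destruct (Req_EM_T d 0); [lra|left; apply exp_pos]. Qed.

Lemma rpow_0 s : rpow 0 s = 0.
Proof. unfold rpow. destruct (Req_EM_T 0 0); [reflexivity|lra]. Qed.

Lemma rpow_pos_eq d s : 0 < d -> rpow d s = Rpower d s.
Proof. intros H. unfold rpow. destruct (Req_EM_T d 0); [lra|reflexivity]. Qed.

Lemma exp_le_compat x y : x <= y -> exp x <= exp y.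
Proof. intros [H|H]; [left; now apply exp_increasing|right; now f_equal]. Qed.

Lemma ln_le_compat x y : 0 < x -> x <= y -> ln x <= ln y.
Proof. intros H [H1|H1]; [left; now apply ln_increasing|right; now f_equal]. Qed.

Lemma Rpower_pos x y : 0 < Rpower x y.
Proof. apply exp_pos. Qed.

Lemma Rpower_lt_l a b s : 0 < s -> 0 < a < b -> Rpower a s < Rpower b s.
Proof.
  intros Hs [Ha Hb]. unfold Rpower. apply exp_increasing.
  apply Rmult_lt_compat_l; [exact Hs|]. now apply ln_increasing.
Qed.

Lemma Rpower_le_l a b s : 0 <= s -> 0 < a <= b -> Rpower a s <= Rpower b s.
Proof. intros. now apply Rle_Rpower_l. Qed.

(* For [0 < s] the scale restriction in [H_null] is automatic: a small value of
   [d ^ s] forces [d] to be small. *)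
Lemma H_null_double s (A : R -> Prop) : 0 < s ->
  (forall eps, 0 < eps -> exists (U : nat -> nat -> R -> Prop) (d : nat -> nat -> R),
     (forall x, A x -> exists k j, U k j x) /\
     (forall k j, 0 <= d k j /\ forall x y, U k j x -> U k j y -> Rabs (x - y) <= d k j) /\
     (forall n m, rsum n (fun k => rsum m (fun j => rpow (d k j) s)) <= eps)) ->
  H_null s A.
Proof.
  intros Hs H eta eps Heta Heps.
  destruct (H (Rmin eps (Rpower eta s))) as [U [d [HU [Hd Hsum]]]].
  { apply Rmin_glb_lt; [exact Heps|apply Rpower_pos]. }
  set (b := fun kj : nat * nat => rpow (d (fst kj) (snd kj)) s).
  assert (Hb : forall x, 0 <= b x) by (intros; apply rpow_nonneg).
  assert (HS := cantor_rsum_le b _ Hb Hsum).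
  exists (fun i => let kj := Cantor.of_nat i in U (fst kj) (snd kj)),
         (fun i => let kj := Cantor.of_nat i in d (fst kj) (snd kj)).
  split; [|split].
  - intros x Hx. destruct (HU x Hx) as [k [j Hkj]]. exists (Cantor.to_nat (k, j)).
    cbv zeta. rewrite Cantor.cancel_of_to. exact Hkj.
  - intros i. cbv zeta. destruct (Cantor.of_nat i) as [k j] eqn:E. simpl.
    destruct (Hd k j) as [Hd0 Hdiam]. split; [split; [exact Hd0|]|exact Hdiam].
    destruct (Rle_lt_dec (d k j) eta) as [Hle|Hlt]; [exact Hle|exfalso].
    assert (Hp : Rpower eta s < Rpower (d k j) s) by (apply Rpower_lt_l; lra).
    specialize (HS (S i)). simpl in HS. rewrite E in HS. unfold b at 2 in HS. simpl in HS.
    rewrite rpow_pos_eq in HS by lra.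
    assert (0 <= rsum i (fun i => b (of_nat i))) by (apply rsum_nonneg; auto).
    pose proof (Rmin_r eps (Rpower eta s)). lra.
  - intros n. rewrite sum_f_R0_rsum. specialize (HS (S n)).
    pose proof (Rmin_l eps (Rpower eta s)).
    apply Rle_trans with (2 := H0). exact HS.
Qed.

(** The format of the explicit covers below: level [k] is a finite list of sets with their diameter
    bounds. Each list is padded by the empty set with diameter 0, which costs nothing since
    [rpow 0 s = 0]. *)
Lemma H_null_lists s (A : R -> Prop) : 0 < s ->
  (forall eps, 0 < eps -> exists C : nat -> list ((R -> Prop) * R),
     (forall x, A x -> exists k e, In e (C k) /\ fst e x) /\
     (forall k e, In e (C k) ->
        0 <= snd e /\ forall x y, fst e x -> fst e y -> Rabs (x - y) <= snd e) /\
     (forall n, rsum n (fun k => lsum (fun e => rpow (snd e) s) (C k)) <= eps)) ->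
  H_null s A.
Proof.
  intros Hs H. apply H_null_double; [exact Hs|]. intros eps Heps.
  destruct (H eps Heps) as [C [HU [Hd Hsum]]].
  set (e0 := ((fun _ : R => False), 0)).
  exists (fun k j => fst (nth j (C k) e0)), (fun k j => snd (nth j (C k) e0)).
  split; [|split].
  - intros x Hx. destruct (HU x Hx) as [k [e [He Hex]]]. exists k.
    destruct (In_nth _ _ e0 He) as [j [_ Hj]]. exists j. now rewrite Hj.
  - intros k j. destruct (nth_in_or_default j (C k) e0) as [Hin|E].
    + exact (Hd _ _ Hin).
    + rewrite E. simpl. split; [lra|tauto].
  - intros n m. eapply Rle_trans; [|apply (Hsum n)]. apply rsum_le. intros k _.
    apply (lsum_nth (fun e => rpow (snd e) s)); [intros; apply rpow_nonneg|].
    apply rpow_0.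
Qed.

Lemma H_null_union s (A : R -> Prop) (B : nat -> R -> Prop) : 0 < s ->
  (forall k, H_null s (B k)) -> (forall x, A x -> exists k, B k x) -> H_null s A.
Proof.
  intros Hs HB HA. apply H_null_double; [exact Hs|]. intros eps Heps.
  assert (HC : forall k, exists Ud : (nat -> R -> Prop) * (nat -> R),
    (forall x, B k x -> exists i, fst Ud i x) /\
    (forall i, 0 <= snd Ud i /\
       (forall x y, fst Ud i x -> fst Ud i y -> Rabs (x - y) <= snd Ud i)) /\
    (forall n, rsum n (fun i => rpow (snd Ud i) s) <= eps * (/ 2) ^ (S k))).
  { intros k. assert (0 < eps * (/ 2) ^ (S k)).
    { apply Rmult_lt_0_compat; [exact Heps|apply pow_lt; lra]. }
    destruct (HB k 1 (eps * (/ 2) ^ (S k))) as [U [d [H1 [H2 H3]]]]; [lra|exact H|].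
    exists (U, d). simpl fst; simpl snd. split; [exact H1|split].
    - intros i. destruct (H2 i) as [H4 H5]. split; [lra|exact H5].
    - intros [|n]; [change (rsum 0 _) with 0; lra|]. rewrite <- sum_f_R0_rsum. apply H3. }
  set (ch := fun k => proj1_sig (constructive_indefinite_description _ (HC k))).
  assert (Hch := fun k => proj2_sig (constructive_indefinite_description _ (HC k))).
  fold ch in Hch. exists (fun k => fst (ch k)), (fun k => snd (ch k)).
  split; [|split].
  - intros x Hx. destruct (HA x Hx) as [k Hk]. exists k. now apply (Hch k).
  - intros k j. apply (Hch k).
  - intros n m. eapply Rle_trans; [|apply (rsum_geom_half n eps); lra].
    apply rsum_le. intros k _. apply (Hch k).
Qed.

Lemma H_null_subset s (A B : R -> Prop) :
  (forall x, A x -> B x) -> H_null s B -> H_null s A.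
Proof.
  intros H HB eta eps Heta Heps. destruct (HB eta eps Heta Heps) as [U [d [H1 H2]]].
  exists U, d. split; [|exact H2]. intros x Hx; apply H1, H, Hx.
Qed.

Lemma H_null_union2 s (A B C : R -> Prop) : 0 < s ->
  (forall x, A x -> B x \/ C x) -> H_null s B -> H_null s C -> H_null s A.
Proof.
  intros Hs H HB HC.
  apply (H_null_union s A (fun k => match k with O => B | _ => C end)); [exact Hs| |].
  - intros [|k]; assumption.
  - intros x Hx. destruct (H x Hx); [now exists 0%nat|now exists 1%nat].
Qed.

Lemma H_null_mono s s' (A : R -> Prop) : s <= s' -> H_null s A -> H_null s' A.
Proof.
  intros Hs HA eta eps Heta Heps.
  (* With diameters at most 1, raising the exponent cannot increase a term. *)
  destruct (HA (Rmin eta 1) eps) as [U [d [H1 [H2 H3]]]]; [apply Rmin_glb_lt; lra|lra|].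
  exists U, d. split; [exact H1|split].
  - intros i. destruct (H2 i) as [H4 H5]. pose proof (Rmin_l eta 1). split; [lra|exact H5].
  - intros n. eapply Rle_trans; [|apply (H3 n)]. rewrite !sum_f_R0_rsum.
    apply rsum_le. intros i _. destruct (H2 i) as [H4 _]. pose proof (Rmin_r eta 1).
    unfold rpow. destruct (Req_EM_T (d i) 0); [lra|]. unfold Rpower.
    assert (ln (d i) <= 0).
    { destruct (Req_dec (d i) 1) as [E|E]; [rewrite E, ln_1; lra|].
      left. rewrite <- ln_1. apply ln_increasing; lra. }
    apply exp_le_compat. nra.
Qed.

(** Minimum of finitely many thresholds. It yields the separation constant of the first-level images
    and the constants for the finitely many rationals with short codings. *)
Lemma finite_common {T : Type} (l : list T) (P : T -> R -> Prop) :
  (forall a e e', 0 < e' <= e -> P a e -> P a e') ->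
  (forall a, In a l -> exists e, 0 < e /\ P a e) ->
  exists e, 0 < e /\ forall a, In a l -> P a e.
Proof.
  intros Hm. induction l as [|a l IH]; intros H.
  - exists 1. split; [lra|]. intros a [].
  - destruct (H a) as [e1 [H1 H1']]; [now left|].
    destruct IH as [e2 [H2 H2']]; [intros; apply H; now right|].
    exists (Rmin e1 e2). assert (0 < Rmin e1 e2) by (apply Rmin_glb_lt; lra).
    split; [assumption|]. intros b [E|E].
    + subst b. apply (Hm a e1); [pose proof (Rmin_l e1 e2); lra|exact H1'].
    + apply (Hm b e2); [pose proof (Rmin_r e1 e2); lra|auto].
Qed.

(** * Coding map *)

Definition shiftw (n : nat) (w : nat -> nat) : nat -> nat := fun i => w (n + i)%nat.

Fixpoint Qp (F : IFS) (w : nat -> nat) (n : nat) : R :=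
  match n with O => 1 | S k => Qp F w k * INR (ifsq F (w k)) end.

(** The coding map made total by choice; its value is meaningful on valid words, by [pt_coding]. *)
Definition pt (F : IFS) (w : nat -> nat) : R := epsilon (inhabits 0) (coding F w).

Lemma pow2_gt n : INR n < 2 ^ n.
Proof.
  induction n as [|n IH]; [simpl; lra|]. rewrite S_INR. simpl.
  assert (1 <= 2 ^ n) by (apply pow_R1_Rle; lra). lra.
Qed.

Lemma pow2_small c e : 0 < e -> exists n0, forall n, (n0 <= n)%nat -> c / 2 ^ n < e.
Proof.
  intros He. destruct (INR_archimed e (Rabs c) He) as [n0 Hn0]. exists n0. intros n Hn.
  assert (H2 : INR n0 < 2 ^ n).
  { apply Rle_lt_trans with (INR n); [now apply le_INR|apply pow2_gt]. }
  pose proof (pos_INR n0). apply Rmult_lt_reg_r with (2 ^ n); [lra|].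
  unfold Rdiv. rewrite Rmult_assoc, Rinv_l, Rmult_1_r by lra.
  pose proof (Rle_abs c). nra.
Qed.

Lemma Un_cv_le_close (x y : nat -> R) l c :
  Un_cv x l -> (forall n, Rabs (y n - x n) <= c / 2 ^ n) -> Un_cv y l.
Proof.
  intros Hx Hy e He. destruct (Hx (e / 2)) as [N1 H1]; [lra|].
  destruct (pow2_small c (e / 2)) as [N2 H2]; [lra|].
  exists (max N1 N2). intros n Hn. unfold R_dist in *.
  specialize (H1 n ltac:(lia)). specialize (H2 n ltac:(lia)). specialize (Hy n).
  replace (y n - l) with ((y n - x n) + (x n - l)) by ring.
  eapply Rle_lt_trans; [apply Rabs_triang|]. lra.
Qed.

Lemma Un_cv_bounds (x : nat -> R) l a b :
  Un_cv x l -> (forall n, a <= x n <= b) -> a <= l <= b.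
Proof.
  intros Hx Hb. split; apply Rnot_lt_le; intros Hl.
  - destruct (Hx (a - l)) as [n0 H0]; [lra|]. specialize (H0 n0 (le_n _)).
    unfold R_dist in H0. apply Rabs_def2 in H0. specialize (Hb n0). lra.
  - destruct (Hx (l - b)) as [n0 H0]; [lra|]. specialize (H0 n0 (le_n _)).
    unfold R_dist in H0. apply Rabs_def2 in H0. specialize (Hb n0). lra.
Qed.

Lemma comp_ext F w w' n x :
  (forall i, (i < n)%nat -> w i = w' i) -> comp F w n x = comp F w' n x.
Proof.
  revert x. induction n as [|n IH]; intros x H; simpl; [reflexivity|].
  rewrite (H n) by lia. apply IH. intros; apply H; lia.
Qed.

Lemma Qp_ext F w w' n :
  (forall i, (i < n)%nat -> w i = w' i) -> Qp F w n = Qp F w' n.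
Proof.
  induction n as [|n IH]; intros H; simpl; [reflexivity|].
  rewrite (H n), IH; [reflexivity| |]; intros; try apply H; lia.
Qed.

Lemma Qp_app F w n m : Qp F w (n + m) = Qp F w n * Qp F (shiftw n w) m.
Proof.
  induction m as [|m IH]; simpl; [rewrite Nat.add_0_r; ring|].
  rewrite Nat.add_succ_r. simpl. rewrite IH. change (shiftw n w m) with (w (n + m)%nat). ring.
Qed.

Lemma comp_app F w n m x : comp F w (n + m) x = comp F w n (comp F (shiftw n w) m x).
Proof.
  revert x. induction m as [|m IH]; intros x; simpl; [now rewrite Nat.add_0_r|].
  rewrite Nat.add_succ_r. simpl. rewrite IH. reflexivity.
Qed.

Lemma valid_shift F w n : valid_word F w -> valid_word F (shiftw n w).
Proof. intros H i. apply H. Qed.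

Section Geometry.
Context (F : IFS) (lo hi : R).
Context (HN : (2 <= ifsN F)%nat).
Context (Hp : forall a, (a < ifsN F)%nat -> ifsp F a = 1%Z \/ ifsp F a = (-1)%Z).
Context (Hq : forall a, (a < ifsN F)%nat -> (2 <= ifsq F a)%nat).
Context (Hlh : lo <= hi).
Context (Hin : forall a x, (a < ifsN F)%nat -> in_I lo hi x -> in_I lo hi (u F a x)).
Context (Hsep : forall a b x y, (a < ifsN F)%nat -> (b < ifsN F)%nat -> a <> b ->
        in_I lo hi x -> in_I lo hi y -> u F a x <> u F b y).

Lemma q_ge2 a : (a < ifsN F)%nat -> 2 <= INR (ifsq F a).
Proof. intros H. change 2 with (INR 2). apply le_INR. auto. Qed.

Lemma u_diff a x y : (a < ifsN F)%nat ->
  Rabs (u F a x - u F a y) = Rabs (x - y) / INR (ifsq F a).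
Proof.
  intros H. pose proof (q_ge2 a H). unfold u.
  replace ((IZR (ifsp F a) * x + IZR (ifsr F a)) / INR (ifsq F a) -
           (IZR (ifsp F a) * y + IZR (ifsr F a)) / INR (ifsq F a))
    with (IZR (ifsp F a) * ((x - y) / INR (ifsq F a))) by (field; lra).
  rewrite Rabs_mult. unfold Rdiv. rewrite (Rabs_mult (x - y)).
  rewrite (Rabs_pos_eq (/ INR (ifsq F a))) by (left; apply Rinv_0_lt_compat; lra).
  replace (Rabs (IZR (ifsp F a))) with 1; [ring|].
  destruct (Hp a H) as [E|E]; rewrite E; [rewrite Rabs_pos_eq; lra|].
  rewrite Rabs_left; lra.
Qed.

Lemma Qp_ge w n : valid_word F w -> 2 ^ n <= Qp F w n.
Proof.
  intros Hw. induction n as [|n IH]; simpl; [lra|].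
  pose proof (q_ge2 (w n) (Hw n)). assert (0 < 2 ^ n) by (apply pow_lt; lra). nra.
Qed.

Lemma Qp_pos w n : valid_word F w -> 0 < Qp F w n.
Proof.
  intros Hw. pose proof (Qp_ge w n Hw). assert (0 < 2 ^ n) by (apply pow_lt; lra). lra.
Qed.

Lemma Qp_mono w n m : valid_word F w -> (n <= m)%nat -> Qp F w n <= Qp F w m.
Proof.
  intros Hw H. replace m with (n + (m - n))%nat by lia. rewrite Qp_app.
  pose proof (Qp_pos w n Hw). pose proof (Qp_ge (shiftw n w) (m - n) (valid_shift _ _ n Hw)).
  assert (1 <= 2 ^ (m - n)) by (apply pow_R1_Rle; lra). nra.
Qed.

Lemma comp_diff w n x y : valid_word F w ->
  Rabs (comp F w n x - comp F w n y) = Rabs (x - y) / Qp F w n.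
Proof.
  intros Hw. revert x y. induction n as [|n IH]; intros x y; simpl; [field|].
  rewrite IH, u_diff by apply Hw. pose proof (Qp_pos w n Hw).
  pose proof (q_ge2 (w n) (Hw n)). field. lra.
Qed.

Lemma comp_diff_le w n x y : valid_word F w ->
  Rabs (comp F w n x - comp F w n y) <= Rabs (x - y) / 2 ^ n.
Proof.
  intros Hw. rewrite comp_diff by assumption. unfold Rdiv.
  apply Rmult_le_compat_l; [apply Rabs_pos|].
  apply Rinv_le_contravar; [apply pow_lt; lra|now apply Qp_ge].
Qed.

Lemma comp_in w n x : valid_word F w -> in_I lo hi x -> in_I lo hi (comp F w n x).
Proof.
  intros Hw. revert x. induction n as [|n IH]; intros x Hx; simpl; auto.
Qed.

Lemma in_I_diff x y : in_I lo hi x -> in_I lo hi y -> Rabs (x - y) <= hi - lo.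
Proof. intros [] []. apply Rabs_le. lra. Qed.

Lemma lo_in : in_I lo hi lo.
Proof. unfold in_I. lra. Qed.

Lemma coding_exists w : valid_word F w -> exists x, coding F w x.
Proof.
  intros Hw.
  (* The base point [lo] keeps the orbit in the invariant interval, which gives the Cauchy property;
     the base point 0 of [coding] may lie outside, and contraction transfers the limit to it. *)
  destruct (R_complete (fun n => comp F w n lo)) as [x Hx].
  { intros e He. destruct (pow2_small (hi - lo) (e / 2)) as [n0 Hn0]; [lra|].
    assert (H : forall n, (n0 <= n)%nat -> Rabs (comp F w n lo - comp F w n0 lo) < e / 2).
    { intros n Hn. eapply Rle_lt_trans; [|apply (Hn0 n0 (le_n _))].
      replace n with (n0 + (n - n0))%nat by lia. rewrite comp_app.
      eapply Rle_trans; [now apply comp_diff_le|]. unfold Rdiv.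
      apply Rmult_le_compat_r; [left; apply Rinv_0_lt_compat, pow_lt; lra|].
      apply in_I_diff; [|apply lo_in]. apply comp_in; [now apply valid_shift|apply lo_in]. }
    exists n0. intros n m Hn Hm. unfold R_dist.
    replace (comp F w n lo - comp F w m lo) with
      ((comp F w n lo - comp F w n0 lo) - (comp F w m lo - comp F w n0 lo)) by ring.
    eapply Rle_lt_trans; [apply Rabs_triang|]. rewrite Rabs_Ropp.
    pose proof (H n ltac:(lia)). pose proof (H m ltac:(lia)). lra. }
  exists x. apply (Un_cv_le_close _ _ _ (Rabs (0 - lo)) Hx).
  intros n. now apply comp_diff_le.
Qed.

Lemma pt_coding w : valid_word F w -> coding F w (pt F w).
Proof. intros Hw. unfold pt. apply epsilon_spec. now apply coding_exists. Qed.

Lemma coding_pt w x : valid_word F w -> coding F w x -> x = pt F w.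
Proof. intros Hw H. exact (UL_sequence _ _ _ H (pt_coding w Hw)). Qed.

Lemma pt_limit_set w : valid_word F w -> limit_set F (pt F w).
Proof. intros Hw. exists w. split; [exact Hw|now apply pt_coding]. Qed.

Lemma pt_in w : valid_word F w -> in_I lo hi (pt F w).
Proof.
  intros Hw. apply (Un_cv_bounds (fun n => comp F w n lo)).
  - apply (Un_cv_le_close (fun n => comp F w n 0) _ _ (Rabs (lo - 0))); [now apply pt_coding|].
    intros n. now apply comp_diff_le.
  - intros n. apply comp_in; [exact Hw|apply lo_in].
Qed.

Lemma pt_comp w n : valid_word F w -> pt F w = comp F w n (pt F (shiftw n w)).
Proof.
  intros Hw. symmetry. apply coding_pt; [exact Hw|].
  assert (Hs := valid_shift F w n Hw). intros e He.
  destruct (pt_coding _ Hs e He) as [n0 H0]. exists (n + n0)%nat. intros m Hm.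
  replace m with (n + (m - n))%nat by lia. rewrite comp_app.
  unfold R_dist. eapply Rle_lt_trans; [now apply comp_diff_le|].
  eapply Rle_lt_trans; [|apply (H0 (m - n)%nat); lia]. unfold R_dist.
  unfold Rdiv. rewrite <- (Rmult_1_r (Rabs (_ - pt F (shiftw n w)))) at 2.
  apply Rmult_le_compat_l; [apply Rabs_pos|]. rewrite <- Rinv_1.
  apply Rinv_le_contravar; [lra|]. apply pow_R1_Rle; lra.
Qed.

Lemma pt_close w w' n : valid_word F w -> valid_word F w' ->
  (forall i, (i < n)%nat -> w i = w' i) ->
  Rabs (pt F w - pt F w') <= (hi - lo) / Qp F w n.
Proof.
  intros Hw Hw' H. rewrite (pt_comp w n Hw), (pt_comp w' n Hw').
  rewrite <- (comp_ext F w w' n _ H), comp_diff by assumption.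
  unfold Rdiv. apply Rmult_le_compat_r; [left; apply Rinv_0_lt_compat; now apply Qp_pos|].
  apply in_I_diff; apply pt_in; now apply valid_shift.
Qed.

(** The preimage is explicit, since the sign [p_a] is its own inverse; no continuity argument is
    needed. *)
Lemma u_image a t : (a < ifsN F)%nat ->
  Rmin (u F a lo) (u F a hi) <= t <= Rmax (u F a lo) (u F a hi) ->
  exists x, in_I lo hi x /\ u F a x = t.
Proof.
  intros Ha Ht. pose proof (q_ge2 a Ha).
  exists (IZR (ifsp F a) * (INR (ifsq F a) * t - IZR (ifsr F a))).
  assert (E1 : u F a lo * INR (ifsq F a) = IZR (ifsp F a) * lo + IZR (ifsr F a))
    by (unfold u; field; lra).
  assert (E2 : u F a hi * INR (ifsq F a) = IZR (ifsp F a) * hi + IZR (ifsr F a))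
    by (unfold u; field; lra).
  unfold in_I.
  destruct (Hp a Ha) as [E|E]; rewrite E in *; split; try (unfold u; rewrite E; field; lra).
  - assert (u F a lo <= u F a hi) by nra.
    rewrite Rmin_left, Rmax_right in Ht by assumption. nra.
  - assert (u F a hi <= u F a lo) by nra.
    rewrite Rmin_right, Rmax_left in Ht by assumption. nra.
Qed.

Lemma u_between a x : (a < ifsN F)%nat -> in_I lo hi x ->
  Rmin (u F a lo) (u F a hi) <= u F a x <= Rmax (u F a lo) (u F a hi).
Proof.
  intros Ha [H1 H2]. pose proof (q_ge2 a Ha) as Hq2.
  assert (Hi : 0 < / INR (ifsq F a)) by (apply Rinv_0_lt_compat; lra).
  unfold u, Rdiv.
  destruct (Hp a Ha) as [E|E]; rewrite E.
  - rewrite Rmin_left, Rmax_right by nra. nra.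
  - rewrite Rmin_right, Rmax_left by nra. nra.
Qed.

(** Both images are closed intervals. If neither lies strictly to one side of the other, the larger
    of the two left endpoints belongs to both, against disjointness; otherwise the gap between them
    serves as [D]. *)
Lemma u_sep a b : (a < ifsN F)%nat -> (b < ifsN F)%nat -> a <> b ->
  exists D, 0 < D /\ forall x y, in_I lo hi x -> in_I lo hi y ->
    D <= Rabs (u F a x - u F b y).
Proof.
  intros Ha Hb Hab.
  pose proof (u_between a lo Ha lo_in). pose proof (u_between b lo Hb lo_in).
  set (al := Rmin (u F a lo) (u F a hi)) in *. set (ar := Rmax (u F a lo) (u F a hi)) in *.
  set (bl := Rmin (u F b lo) (u F b hi)) in *. set (br := Rmax (u F b lo) (u F b hi)) in *.
  destruct (Rlt_le_dec ar bl) as [H1|H1].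
  - exists (bl - ar). split; [lra|]. intros x y Hx Hy.
    pose proof (u_between a x Ha Hx). pose proof (u_between b y Hb Hy).
    fold al ar in H2. fold bl br in H3. rewrite Rabs_left; lra.
  - destruct (Rlt_le_dec br al) as [H2|H2].
    + exists (al - br). split; [lra|]. intros x y Hx Hy.
      pose proof (u_between a x Ha Hx). pose proof (u_between b y Hb Hy).
      fold al ar in H3. fold bl br in H4. rewrite Rabs_pos_eq; lra.
    + exfalso. destruct (u_image a (Rmax al bl) Ha) as [x [Hx Ex]].
      { fold al ar. split; [apply Rmax_l|apply Rmax_lub; lra]. }
      destruct (u_image b (Rmax al bl) Hb) as [y [Hy Ey]].
      { fold bl br. split; [apply Rmax_r|apply Rmax_lub; lra]. }
      apply (Hsep a b x y Ha Hb Hab Hx Hy). congruence.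
Qed.

(** Converse estimate to [pt_close]: [D] is a common gap for the finitely many pairs of first-level
    images, and the common prefix scales it by exactly [/ Qp F w n]. *)
Lemma pt_sep : exists D, 0 < D /\ forall w w' n, valid_word F w -> valid_word F w' ->
  (forall i, (i < n)%nat -> w i = w' i) -> w n <> w' n ->
  D / Qp F w n <= Rabs (pt F w - pt F w').
Proof.
  destruct (finite_common (list_prod (seq 0 (ifsN F)) (seq 0 (ifsN F)))
    (fun ab D => fst ab <> snd ab -> forall x y, in_I lo hi x -> in_I lo hi y ->
       D <= Rabs (u F (fst ab) x - u F (snd ab) y))) as [D [HD H]].
  - intros ab e e' He H Hab x y Hx Hy. specialize (H Hab x y Hx Hy). lra.
  - intros [a b] Hab. apply in_prod_iff in Hab. rewrite !in_seq in Hab. simpl.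
    destruct (Nat.eq_dec a b) as [E|E]; [exists 1; split; [lra|contradiction]|].
    destruct (u_sep a b) as [D [HD H]]; try lia. exists D; auto.
  - exists D. split; [exact HD|]. intros w w' n Hw Hw' Hag Hne.
    rewrite (pt_comp w n Hw), (pt_comp w' n Hw').
    rewrite <- (comp_ext F w w' n _ Hag), comp_diff by assumption.
    unfold Rdiv. apply Rmult_le_compat_r; [left; apply Rinv_0_lt_compat; now apply Qp_pos|].
    rewrite (pt_comp (shiftw n w) 1), (pt_comp (shiftw n w') 1) by now apply valid_shift.
    simpl. change (shiftw n w 0) with (w (n + 0)%nat).
    change (shiftw n w' 0) with (w' (n + 0)%nat). rewrite Nat.add_0_r.
    apply (H (w n, w' n)); [|exact Hne| |]; [|apply pt_in; repeat apply valid_shift; assumption..].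
    apply in_prod; apply in_seq; [specialize (Hw n)|specialize (Hw' n)]; lia.
Qed.

End Geometry.

(** * Weights of words and lower bound for the dimension *)

Definition pw (F : IFS) (s : R) (a : nat) : R := Rpower (INR (ifsq F a)) (- s).

(** The power [- s] of [qw F v] (see [wt_qw]): the Bernoulli mass of the cylinder [v] when
    [moran F s = 1], and comparable to its diameter to the power [s]. *)
Definition wt (F : IFS) (s : R) (v : list nat) : R :=
  fold_right (fun a r => pw F s a * r) 1 v.

Definition qw (F : IFS) (v : list nat) : R :=
  fold_right (fun a r => INR (ifsq F a) * r) 1 v.

Definition moran (F : IFS) (s : R) : R := rsum (ifsN F) (pw F s).

Definition pre (w : nat -> nat) (n : nat) : list nat := map w (seq 0 n).

Definition validl (F : IFS) (v : list nat) : Prop := Forall (fun a => (a < ifsN F)%nat) v.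

Lemma pw_pos F s a : 0 < pw F s a.
Proof. apply Rpower_pos. Qed.

Lemma wt_pos F s v : 0 < wt F s v.
Proof.
  induction v as [|a v IH]; simpl; [lra|]. apply Rmult_lt_0_compat; [apply pw_pos|exact IH].
Qed.

Lemma qw_app F v v' : qw F (v ++ v') = qw F v * qw F v'.
Proof. induction v as [|a v IH]; simpl; [ring|rewrite IH; ring]. Qed.

Lemma pre_S w n : pre w (S n) = pre w n ++ [w n].
Proof. unfold pre. rewrite seq_S, map_app. reflexivity. Qed.

Lemma pre_length w n : length (pre w n) = n.
Proof. unfold pre. now rewrite length_map, length_seq. Qed.

Lemma pre_valid F w n : valid_word F w -> validl F (pre w n).
Proof.
  intros Hw. apply Forall_forall. intros a Ha. unfold pre in Ha.
  apply in_map_iff in Ha. destruct Ha as [i [<- _]]. apply Hw.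
Qed.

Lemma pre_nth w n i : (i < n)%nat -> nth i (pre w n) 0%nat = w i.
Proof.
  intros H. unfold pre. rewrite nth_indep with (d' := w 0%nat).
  - rewrite map_nth, seq_nth by exact H. reflexivity.
  - now rewrite length_map, length_seq.
Qed.

Lemma pre_eq w w' n : pre w n = pre w' n -> forall i, (i < n)%nat -> w i = w' i.
Proof. intros E i Hi. rewrite <- (pre_nth w n i Hi), E. now apply pre_nth. Qed.

Lemma pre_ext w w' n : (forall i, (i < n)%nat -> w i = w' i) -> pre w n = pre w' n.
Proof. intros H. apply map_ext_in. intros i Hi. apply in_seq in Hi. apply H. lia. Qed.

Lemma pre_app w n m : pre w (n + m) = pre w n ++ pre (shiftw n w) m.
Proof.
  induction m as [|m IH]; [rewrite Nat.add_0_r; simpl; now rewrite app_nil_r|].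
  rewrite Nat.add_succ_r, !pre_S, IH, <- app_assoc. reflexivity.
Qed.

Lemma qw_pre F w n : qw F (pre w n) = Qp F w n.
Proof.
  induction n as [|n IH]; [reflexivity|]. rewrite pre_S, qw_app, IH. simpl. ring.
Qed.

Lemma rsum_lt n f g : (0 < n)%nat -> (forall i, (i < n)%nat -> f i < g i) -> rsum n f < rsum n g.
Proof.
  intros Hn H. destruct n as [|n]; [lia|]. simpl.
  apply Rplus_le_lt_compat; [apply rsum_le; intros; left; apply H; lia|apply H; lia].
Qed.

Lemma rsum_delta n f b : (b < n)%nat ->
  rsum n (fun a => if Nat.eqb a b then f a else 0) = f b.
Proof.
  intros Hb. induction n as [|n IH]; [lia|]. simpl.
  destruct (Nat.eqb n b) eqn:E.
  - apply Nat.eqb_eq in E. subst b. rewrite (rsum_ext _ _ (fun _ => 0)), rsum_const; [ring|].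
    intros i Hi. replace (Nat.eqb i n) with false; [reflexivity|].
    symmetry. apply Nat.eqb_neq. lia.
  - apply Nat.eqb_neq in E. rewrite IH by lia. ring.
Qed.

Lemma rsum_delta0 n f b : (n <= b)%nat ->
  rsum n (fun a => if Nat.eqb a b then f a else 0) = 0.
Proof.
  intros Hb. rewrite (rsum_ext _ _ (fun _ => 0)), rsum_const; [ring|].
  intros i Hi. replace (Nat.eqb i b) with false; [reflexivity|].
  symmetry. apply Nat.eqb_neq. lia.
Qed.

Section Weights.
Context (F : IFS) (s : R).
Context (HN : (2 <= ifsN F)%nat).
Context (Hq : forall a, (a < ifsN F)%nat -> (2 <= ifsq F a)%nat).

Lemma qw_pos v : validl F v -> 0 < qw F v.
Proof.
  induction 1 as [|a v Ha Hv IH]; simpl; [lra|].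
  apply Rmult_lt_0_compat; [|exact IH]. pose proof (q_ge2 F Hq a Ha). lra.
Qed.

Lemma wt_qw v : validl F v -> wt F s v = Rpower (qw F v) (- s).
Proof.
  induction 1 as [|a v Ha Hv IH]; simpl.
  - unfold Rpower. rewrite ln_1, Rmult_0_r, exp_0. reflexivity.
  - rewrite IH. unfold pw. pose proof (q_ge2 F Hq a Ha).
    rewrite Rpower_mult_distr; [reflexivity|lra|now apply qw_pos].
Qed.

(* [rel v u] is the relative mass of the cylinder [v] inside the cylinder [u]. *)
Fixpoint rel (v u : list nat) {struct u} : R :=
  match u, v with
  | [], _ => wt F s v
  | _ :: _, [] => 1
  | a :: u', b :: v' => if Nat.eqb a b then rel v' u' else 0
  end.

Lemma rel_nonneg v u : 0 <= rel v u.
Proof.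
  revert v. induction u as [|a u IH]; intros v; simpl; [left; apply wt_pos|].
  destruct v as [|b v]; [lra|]. destruct (Nat.eqb a b); [apply IH|lra].
Qed.

Lemma rel_diag v : rel v v = 1.
Proof. induction v as [|a v IH]; simpl; [reflexivity|]. now rewrite Nat.eqb_refl. Qed.

(** Extending [u] by a random letter does not increase the relative mass on average. The exception
    is that [v] is already a prefix of [u]: the average would then be [moran F s], which may exceed
    1. *)
Lemma rel_step v u : rel v u = 1 \/
  rsum (ifsN F) (fun a => pw F s a * rel v (u ++ [a])) <= rel v u.
Proof.
  revert v. induction u as [|a u IH]; intros [|b v]; simpl; try (now left).
  - right. rewrite (rsum_ext _ _ (fun a => if Nat.eqb a b then pw F s a * wt F s v else 0)).
    + destruct (Nat.lt_ge_cases b (ifsN F)) as [Hb|Hb].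
      * rewrite (rsum_delta _ (fun a => pw F s a * wt F s v)) by exact Hb. lra.
      * rewrite (rsum_delta0 _ (fun a => pw F s a * wt F s v)) by exact Hb.
        left. apply Rmult_lt_0_compat; [apply pw_pos|apply wt_pos].
    + intros i _. destruct (Nat.eqb i b); ring.
  - destruct (Nat.eqb a b); [apply IH|]. right.
    rewrite (rsum_ext _ _ (fun _ => 0)), rsum_const; [lra|]. intros; apply Rmult_0_r.
Qed.

(** Partial sums of nonnegative terms increase, so the largest of finitely many lengths works for
    all letters. *)
Lemma rsum_common_len (v : nat -> nat -> R) c N :
  (forall a i, 0 <= v a i) ->
  (forall a, (a < N)%nat -> exists n, c < rsum n (v a)) ->
  exists n, forall a, (a < N)%nat -> c < rsum n (v a).
Proof.
  intros Hv. induction N as [|N IH]; intros H; [exists 0%nat; intros; lia|].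
  destruct IH as [n1 H1]; [intros; apply H; lia|].
  destruct (H N) as [n2 H2]; [lia|]. exists (max n1 n2). intros a Ha.
  destruct (Nat.eq_dec a N) as [->|E].
  - eapply Rlt_le_trans; [apply H2|apply rsum_le_len; [lia|apply Hv]].
  - eapply Rlt_le_trans; [apply (H1 a); lia|apply rsum_le_len; [lia|apply Hv]].
Qed.

(* Letters are chosen one by one so that the total relative mass of the cylinders stays
   at most [c]; this replaces a compactness argument. *)
Lemma cylinders_miss_word (v : nat -> list nat) c : 1 <= moran F s -> c < 1 ->
  (forall n, rsum n (fun i => wt F s (v i)) <= c) ->
  exists w, valid_word F w /\ forall i, pre w (length (v i)) <> v i.
Proof.
  intros HW Hc Hsum.
  assert (Hc0 : 0 <= c) by (specialize (Hsum 0%nat); simpl in Hsum; lra).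
  set (good := fun u => forall n, rsum n (fun i => rel (v i) u) <= c).
  assert (Hlt : forall u i, good u -> rel (v i) u < 1).
  { intros u i Hu. specialize (Hu (S i)). simpl in Hu.
    assert (0 <= rsum i (fun i => rel (v i) u)) by (apply rsum_nonneg; intros; apply rel_nonneg).
    lra. }
  (* If every letter overshot [c], one common truncation [n] would give [moran F s * c] below the
     weighted sum over the letters, which [rel_step] bounds by [c]; this contradicts
     [1 <= moran F s]. The exceptional case of [rel_step] is excluded by [c < 1]. *)
  assert (Hstep : forall u, good u -> exists a, (a < ifsN F)%nat /\ good (u ++ [a])).
  { intros u Hu. apply NNPP. intros Hno.
    destruct (rsum_common_len (fun a i => rel (v i) (u ++ [a])) c (ifsN F)) as [n Hn].
    - intros; apply rel_nonneg.
    - intros a Ha. apply NNPP. intros H. apply Hno. exists a. split; [exact Ha|].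
      intros n. apply Rnot_lt_le. intros H'. apply H. now exists n.
    - assert (H1 : rsum (ifsN F) (fun a => pw F s a * c) <
        rsum (ifsN F) (fun a => pw F s a * rsum n (fun i => rel (v i) (u ++ [a])))).
      { apply rsum_lt; [lia|]. intros a Ha. apply Rmult_lt_compat_l; [apply pw_pos|now apply Hn]. }
      rewrite (rsum_ext _ (fun a => pw F s a * c) (fun a => c * pw F s a)) in H1
        by (intros; ring).
      rewrite rsum_scal in H1. fold (moran F s) in H1.
      rewrite (rsum_ext _ _ (fun a => rsum n (fun i => pw F s a * rel (v i) (u ++ [a])))) in H1
        by (intros; now rewrite rsum_scal).
      rewrite rsum_swap in H1.
      assert (H2 : rsum n (fun i => rsum (ifsN F) (fun a => pw F s a * rel (v i) (u ++ [a])))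
        <= rsum n (fun i => rel (v i) u)).
      { apply rsum_le. intros i _. destruct (rel_step (v i) u) as [E|E]; [|exact E].
        specialize (Hlt u i Hu). lra. }
      specialize (Hu n). nra. }
  set (next := fun u => epsilon (inhabits 0%nat) (fun a => (a < ifsN F)%nat /\ good (u ++ [a]))).
  assert (Hnext : forall u, good u -> (next u < ifsN F)%nat /\ good (u ++ [next u])).
  { intros u Hu. unfold next. apply epsilon_spec. now apply Hstep. }
  set (us := fix us k := match k with O => [] | S k' => us k' ++ [next (us k')] end).
  set (w := fun k => next (us k)).
  assert (Hpre : forall k, pre w k = us k).
  { induction k as [|k IH]; [reflexivity|]. rewrite pre_S, IH. reflexivity. }
  assert (Hgood : forall k, good (us k)).
  { induction k as [|k IH]; [exact Hsum|]. simpl. now apply Hnext. }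
  exists w. split; [intros k; now apply Hnext|].
  intros i E. specialize (Hlt _ i (Hgood (length (v i)))).
  rewrite <- Hpre, E, rel_diag in Hlt. lra.
Qed.

End Weights.

Section NonNull.
Context (F : IFS) (lo hi : R).
Context (HN : (2 <= ifsN F)%nat).
Context (Hp : forall a, (a < ifsN F)%nat -> ifsp F a = 1%Z \/ ifsp F a = (-1)%Z).
Context (Hq : forall a, (a < ifsN F)%nat -> (2 <= ifsq F a)%nat).
Context (Hlh : lo <= hi).
Context (Hin : forall a x, (a < ifsN F)%nat -> in_I lo hi x -> in_I lo hi (u F a x)).
Context (Hsep : forall a b x y, (a < ifsN F)%nat -> (b < ifsN F)%nat -> a <> b ->
        in_I lo hi x -> in_I lo hi y -> u F a x <> u F b y).

Lemma wt_small s w e : 0 < s -> valid_word F w -> 0 < e -> exists n, wt F s (pre w n) <= e.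
Proof.
  intros Hs Hw He. destruct (pow2_small 1 (Rpower e (/ s))) as [n Hn]; [apply Rpower_pos|].
  exists n. specialize (Hn n (le_n _)).
  rewrite (wt_qw F s Hq) by now apply pre_valid. rewrite qw_pre.
  pose proof (Qp_ge F Hq w n Hw) as HQ. assert (H2 : 0 < 2 ^ n) by (apply pow_lt; lra).
  rewrite Rpower_Ropp, <- Rpower_Ropp.
  replace (Rpower (Qp F w n) (- s)) with (Rpower (/ Qp F w n) s).
  - apply Rle_trans with (Rpower (Rpower e (/ s)) s).
    + apply Rpower_le_l; [lra|]. split; [apply Rinv_0_lt_compat; lra|].
      assert (/ Qp F w n <= / 2 ^ n) by (apply Rinv_le_contravar; lra).
      unfold Rdiv in Hn. lra.
    + rewrite Rpower_mult, Rinv_l, Rpower_1 by lra. lra.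
  - unfold Rpower. rewrite ln_Rinv by lra. f_equal. ring.
Qed.

Lemma least_nat (P : nat -> Prop) : (exists n, P n) ->
  exists n, P n /\ forall m, (m < n)%nat -> ~ P m.
Proof.
  intros [n Hn]. revert Hn. induction n as [n IH] using lt_wf_ind. intros Hn.
  destruct (classic (exists m, (m < n)%nat /\ P m)) as [[m [Hm HPm]]|H].
  - now apply (IH m).
  - exists n. split; [exact Hn|]. intros m Hm HP. apply H. now exists m.
Qed.

Lemma first_diff (w w' : nat -> nat) n :
  (forall i, (i < n)%nat -> w i = w' i) \/
  exists l, (l < n)%nat /\ (forall i, (i < l)%nat -> w i = w' i) /\ w l <> w' l.
Proof.
  induction n as [|n [IH|IH]].
  - left. intros; lia.
  - destruct (Nat.eq_dec (w n) (w' n)) as [E|E].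
    + left. intros i Hi. destruct (Nat.eq_dec i n) as [->|]; [exact E|apply IH; lia].
    + right. exists n. auto.
  - right. destruct IH as [l [Hl H]]. exists l. split; [lia|exact H].
Qed.

(** Words leaving [w] at position [l] code points at distance at least [D / Qp F w l]. Hence [U]
    stays in the cylinder of [w] up to the first [n] with [D / Qp F w n <= d], and this inequality
    bounds its weight by [(d / D) ^ s]. The slack [e] serves sets of diameter 0 and sets missing the
    limit set, for which an arbitrarily light cylinder is taken. *)
Lemma cylinder_of_set s : 0 < s -> exists C, 0 < C /\
  forall (U : R -> Prop) d e, 0 <= d -> 0 < e ->
  (forall x y, U x -> U y -> Rabs (x - y) <= d) ->
  exists v, (forall w, valid_word F w -> U (pt F w) -> pre w (length v) = v) /\
    wt F s v <= C * rpow d s + e.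
Proof.
  intros Hs. destruct (pt_sep F lo hi HN Hp Hq Hlh Hin Hsep) as [D [HD HDs]].
  exists (Rpower D (- s)). split; [apply Rpower_pos|]. intros U d e Hd He HU.
  pose proof (Rpower_pos D (- s)) as HC. pose proof (rpow_nonneg d s) as Hr.
  destruct (classic (exists w, valid_word F w /\ U (pt F w))) as [[w [Hw HUw]]|Hno].
  2:{ destruct (wt_small s (fun _ => 0%nat) e Hs) as [n Hn]; [intros i; lia|exact He|].
      exists (pre (fun _ => 0%nat) n). split; [|nra].
      intros w Hw HUw. exfalso. apply Hno. now exists w. }
  assert (Key : forall n, (forall l, (l < n)%nat -> d < D / Qp F w l) ->
     forall w', valid_word F w' -> U (pt F w') -> pre w' (length (pre w n)) = pre w n).
  { intros n Hn w' Hw' HUw'. rewrite pre_length. apply pre_ext.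
    destruct (first_diff w w' n) as [H|[l [Hl [H1 H2]]]]; [intros; symmetry; auto|exfalso].
    specialize (HDs w w' l Hw Hw' H1 H2). specialize (Hn l Hl).
    specialize (HU _ _ HUw HUw'). lra. }
  assert (HQ := fun l => Qp_pos F Hq w l Hw).
  destruct (Req_dec d 0) as [E|E].
  - destruct (wt_small s w e Hs Hw He) as [n Hn]. exists (pre w n). split; [|nra].
    apply Key. intros l _. rewrite E. apply Rdiv_lt_0_compat; auto.
  - destruct (least_nat (fun n => D / Qp F w n <= d)) as [n [Hn Hmin]].
    { destruct (pow2_small D d) as [n Hn]; [lra|]. exists n. specialize (Hn n (le_n _)).
      apply Rle_trans with (D / 2 ^ n); [|lra]. unfold Rdiv.
      apply Rmult_le_compat_l; [lra|]. apply Rinv_le_contravar; [apply pow_lt; lra|].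
      now apply Qp_ge. }
    exists (pre w n). split.
    + apply Key. intros l Hl. apply Rnot_le_lt. now apply Hmin.
    + rewrite (wt_qw F s Hq), qw_pre by now apply pre_valid.
      rewrite rpow_pos_eq by lra. specialize (HQ n).
      assert (Hle : Rpower (Qp F w n) (- s) <= Rpower D (- s) * Rpower d s).
      { unfold Rpower. rewrite <- exp_plus. apply exp_le_compat.
        assert (ln D <= ln (Qp F w n) + ln d).
        { rewrite <- ln_mult by lra. apply ln_le_compat; [exact HD|].
          apply Rmult_le_reg_r with (/ Qp F w n); [now apply Rinv_0_lt_compat|].
          unfold Rdiv in Hn. replace (Qp F w n * d * / Qp F w n) with d by (field; lra). exact Hn. }
        nra. }
      lra.
Qed.

(** Mass distribution principle without a measure. A cover of cost [/ (4 * C)] is replaced by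
    cylinders of total weight at most 1/4 from the cover plus 1/4 from the slacks; a word avoiding
    all of them codes an uncovered point. *)
Theorem limit_set_not_null s : 0 < s -> 1 <= moran F s -> ~ H_null s (limit_set F).
Proof.
  intros Hs HW Hnull. destruct (cylinder_of_set s Hs) as [C [HC Hcyl]].
  destruct (Hnull 1 (/ (4 * C))) as [U [d [HU [Hd Hsum]]]]; [lra|apply Rinv_0_lt_compat; lra|].
  assert (Hv : forall i, exists v,
    (forall w, valid_word F w -> U i (pt F w) -> pre w (length v) = v) /\
    wt F s v <= C * rpow (d i) s + / 4 * (/ 2) ^ (S i)).
  { intros i. destruct (Hd i) as [[Hd0 _] Hdd]. apply Hcyl; [exact Hd0| |exact Hdd].
    apply Rmult_lt_0_compat; [lra|apply pow_lt; lra]. }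
  set (v := fun i => proj1_sig (constructive_indefinite_description _ (Hv i))).
  assert (Hv' := fun i => proj2_sig (constructive_indefinite_description _ (Hv i))).
  fold v in Hv'.
  destruct (cylinders_miss_word F s HN v (1 / 2) HW) as [w [Hw Hmiss]]; [lra| |].
  - intros n. apply Rle_trans with
      (rsum n (fun i => C * rpow (d i) s + / 4 * (/ 2) ^ (S i))).
    + apply rsum_le. intros i _. apply (Hv' i).
    + rewrite rsum_plus, rsum_scal. pose proof (rsum_geom_half n (/ 4) ltac:(lra)).
      assert (rsum n (fun i => rpow (d i) s) <= / (4 * C)).
      { destruct n as [|n]; [simpl; left; apply Rinv_0_lt_compat; lra|].
        rewrite <- sum_f_R0_rsum. apply Hsum. }
      assert (C * rsum n (fun i => rpow (d i) s) <= / 4).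
      { apply Rle_trans with (C * / (4 * C)); [apply Rmult_le_compat_l; lra|].
        right. field. lra. }
      lra.
  - destruct (HU (pt F w)) as [i Hi]; [now apply (pt_limit_set F lo hi)|].
    apply (Hmiss i). now apply (Hv' i).
Qed.

End NonNull.

(** * Eventually periodic words and the convergence part *)

Definition perw (w : nat -> nat) (n m : nat) : nat -> nat :=
  fun i => if Nat.ltb i n then w i else w (n + (i - n) mod m)%nat.

Definition lw (v : list nat) : nat -> nat := fun i => nth i v 0%nat.

Fixpoint words (N k : nat) : list (list nat) :=
  match k with
  | O => [[]]
  | S k' => flat_map (fun a => map (cons a) (words N k')) (seq 0 N)
  end.

Lemma perw_low w n m i : (i < n + m)%nat -> perw w n m i = w i.
Proof.
  intros H. unfold perw. destruct (Nat.ltb_spec i n) as [Hi|Hi]; [reflexivity|].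
  rewrite Nat.mod_small by lia. f_equal. lia.
Qed.

Lemma perw_ext w w' n m : (1 <= m)%nat ->
  (forall i, (i < n + m)%nat -> w i = w' i) -> perw w n m = perw w' n m.
Proof.
  intros Hm H. apply functional_extensionality. intros i. unfold perw.
  destruct (Nat.ltb_spec i n) as [Hi|Hi]; apply H; [lia|].
  pose proof (Nat.mod_upper_bound (i - n) m). lia.
Qed.

Lemma perw_periodic w n m : (1 <= m)%nat -> periodic_from (perw w n m) n m.
Proof.
  intros Hm i Hi. unfold perw.
  destruct (Nat.ltb_spec (i + m) n) as [H1|H1]; [lia|].
  destruct (Nat.ltb_spec i n) as [H2|H2]; [lia|].
  replace (i + m - n)%nat with (i - n + 1 * m)%nat by lia.
  rewrite Nat.Div0.mod_add. reflexivity.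
Qed.

Lemma perw_valid F w n m : valid_word F w -> valid_word F (perw w n m).
Proof. intros Hw i. unfold perw. destruct (Nat.ltb i n); apply Hw. Qed.

Lemma periodic_mult w n m i k : periodic_from w n m -> (n <= i)%nat ->
  w (i + k * m)%nat = w i.
Proof.
  intros H Hi. induction k as [|k IH]; [f_equal; lia|].
  replace (i + S k * m)%nat with ((i + k * m) + m)%nat by lia.
  rewrite H by lia. exact IH.
Qed.

Lemma perw_id w n m : (1 <= m)%nat -> periodic_from w n m -> perw w n m = w.
Proof.
  intros Hm H. apply functional_extensionality. intros i. unfold perw.
  destruct (Nat.ltb_spec i n) as [Hi|Hi]; [reflexivity|].
  rewrite <- (periodic_mult w n m _ ((i - n) / m) H) by lia. f_equal.
  pose proof (Nat.div_mod_eq (i - n) m). lia.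
Qed.

Lemma min_pre_period_exists w n m : (1 <= m)%nat -> periodic_from w n m ->
  exists n0 m0, min_pre_period w n0 m0 /\ (n0 <= n)%nat /\ (m0 <= m)%nat.
Proof.
  intros Hm Hper.
  destruct (least_nat (fun n' => exists m', (1 <= m')%nat /\ periodic_from w n' m'))
    as [n0 [[m1 [Hm1 Hp1]] Hn0]]; [now exists n, m|].
  destruct (least_nat (fun m' => (1 <= m')%nat /\ periodic_from w n0 m'))
    as [m0 [[Hm0 Hp0] Hmin]]; [now exists m1|].
  assert (Hmin' : forall m', (1 <= m')%nat -> periodic_from w n0 m' -> (m0 <= m')%nat).
  { intros m' H1 H2. apply Nat.nlt_ge. intros H3. now apply (Hmin m' H3). }
  assert (Hmin2 : forall n' m', (1 <= m')%nat -> periodic_from w n' m' -> (n0 <= n')%nat).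
  { intros n' m' H1 H2. apply Nat.nlt_ge. intros H3. apply (Hn0 n' H3). now exists m'. }
  exists n0, m0. split; [|split].
  - repeat split; assumption.
  - now apply (Hmin2 n m).
  (* The period [m] is known only from [n] on. Advancing by [n * m0 >= n] letters does not change
     the letter past [n0], so the comparison can be made where [m] is a period. *)
  - apply Hmin'; [exact Hm|]. intros i Hi.
    rewrite <- (periodic_mult w n0 m0 i n Hp0), <- (periodic_mult w n0 m0 (i + m) n Hp0) by lia.
    replace (i + m + n * m0)%nat with (i + n * m0 + m)%nat by lia. apply Hper. nia.
Qed.

Lemma in_words N k v :
  In v (words N k) <-> length v = k /\ Forall (fun a => (a < N)%nat) v.
Proof.
  revert v. induction k as [|k IH]; intros v; simpl.
  - split.
    + intros [<-|[]]. split; [reflexivity|constructor].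
    + intros [H _]. left. now destruct v.
  - rewrite in_flat_map. split.
    + intros [a [Ha Hv]]. apply in_map_iff in Hv. destruct Hv as [v' [<- Hv']].
      apply IH in Hv'. apply in_seq in Ha. simpl. destruct Hv' as [<- Hv'].
      split; [reflexivity|]. constructor; [lia|exact Hv'].
    + intros [Hl Hv]. destruct v as [|a v]; [discriminate|]. inversion Hv; subst.
      exists a. split; [apply in_seq; lia|]. apply in_map, IH.
      split; [now injection Hl|assumption].
Qed.

Lemma lw_valid F v : (1 <= ifsN F)%nat -> validl F v -> valid_word F (lw v).
Proof.
  intros HN Hv i. unfold lw. destruct (Nat.lt_ge_cases i (length v)) as [H|H].
  - unfold validl in Hv. rewrite Forall_forall in Hv. apply Hv. now apply nth_In.
  - rewrite nth_overflow by exact H. lia.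
Qed.

Lemma lw_pre w n i : (i < n)%nat -> lw (pre w n) i = w i.
Proof. apply pre_nth. Qed.

Lemma pre_lw v : pre (lw v) (length v) = v.
Proof.
  apply (nth_ext _ _ 0%nat 0%nat); [apply pre_length|].
  intros i Hi. rewrite pre_length in Hi. now rewrite pre_nth.
Qed.

Lemma lsum_words_wt F s k : lsum (wt F s) (words (ifsN F) k) = moran F s ^ k.
Proof.
  induction k as [|k IH]; simpl; [ring|].
  rewrite lsum_flat_map. unfold moran at 1. rewrite <- lsum_seq, Rmult_comm, <- lsum_scal.
  f_equal. apply functional_extensionality. intros a. rewrite lsum_map. simpl.
  rewrite lsum_scal, IH. ring.
Qed.

(** Eventually periodic points are indexed by a word of length preperiod plus period together with
    the preperiod. Neither need be minimal, so a point may be listed repeatedly, which only enlarges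
    covers. *)
Definition perpt (F : IFS) (v : list nat) (n : nat) : R :=
  pt F (perw (lw v) n (length v - n)).

Definition eventually_periodic_points (F : IFS) (x : R) : Prop :=
  exists v n, validl F v /\ (n < length v)%nat /\ x = perpt F v n.

Section Periodic.
Context (F : IFS) (lo hi : R).
Context (HN : (2 <= ifsN F)%nat).
Context (Hp : forall a, (a < ifsN F)%nat -> ifsp F a = 1%Z \/ ifsp F a = (-1)%Z).
Context (Hq : forall a, (a < ifsN F)%nat -> (2 <= ifsq F a)%nat).
Context (Hlh : lo <= hi).
Context (Hin : forall a x, (a < ifsN F)%nat -> in_I lo hi x -> in_I lo hi (u F a x)).

Lemma perw_lw_pre w n m : (1 <= m)%nat -> perw (lw (pre w (n + m))) n m = perw w n m.
Proof. intros Hm. apply perw_ext; [exact Hm|]. intros i Hi. now apply lw_pre. Qed.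

Lemma perpt_pre w n m : (1 <= m)%nat -> perpt F (pre w (n + m)) n = pt F (perw w n m).
Proof.
  intros Hm. unfold perpt. rewrite pre_length.
  replace (n + m - n)%nat with m by lia. now rewrite perw_lw_pre.
Qed.

Lemma IZR_prod_q w n k :
  IZR (prodZ (fun i => Z.of_nat (ifsq F (w (n + i)%nat))) k) = Qp F (shiftw n w) k.
Proof.
  induction k as [|k IH]; simpl; [reflexivity|].
  rewrite mult_IZR, IH, <- INR_IZR_INZ. reflexivity.
Qed.

Lemma IZR_prod_p w k : valid_word F w ->
  -1 <= IZR (prodZ (fun i => ifsp F (w i)) k) <= 1.
Proof.
  intros Hw. induction k as [|k IH]; simpl; [lra|].
  rewrite mult_IZR. destruct (Hp (w k) (Hw k)) as [E|E]; rewrite E; lra.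
Qed.

(** The denominator of the period is at least 2 and the product of signs lies between -1 and 1, so
    subtracting the latter changes the former by a factor between 1/2 and 2. *)
Lemma q_int_bounds w n m : valid_word F w -> (1 <= m)%nat ->
  Qp F w (n + m) / 2 <= IZR (q_int F w n m) <= 2 * Qp F w (n + m).
Proof.
  intros Hw Hm. unfold q_int. rewrite mult_IZR, minus_IZR, IZR_prod_q.
  change (fun i => Z.of_nat (ifsq F (w i))) with (fun i => Z.of_nat (ifsq F (w (0 + i)%nat))).
  rewrite (IZR_prod_q w 0 n), Qp_app. change (shiftw 0 w) with w.
  assert (Hs : -1 <= IZR (prodZ (fun i => ifsp F (w (n + i)%nat)) m) <= 1)
    by exact (IZR_prod_p (shiftw n w) m (valid_shift _ _ n Hw)).
  pose proof (Qp_pos F Hq w n Hw). pose proof (Qp_ge F Hq _ m (valid_shift _ _ n Hw)).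
  assert (2 <= 2 ^ m). { replace 2 with (2 ^ 1) at 1 by lra. apply Rle_pow; [lra|lia]. }
  set (P := IZR (prodZ (fun i => ifsp F (w (n + i)%nat)) m)) in *.
  set (a := Qp F w n) in *. set (b := Qp F (shiftw n w) m) in *. split; nra.
Qed.

Lemma comp_rational_affine w k : valid_word F w -> exists P S Q : Z,
  IZR Q = Qp F w k /\ -1 <= IZR P <= 1 /\
  forall x, comp F w k x = (IZR P * x + IZR S) / IZR Q.
Proof.
  intros Hw. induction k as [|k [P [S [Q [HQ [HP IH]]]]]].
  - exists 1%Z, 0%Z, 1%Z. split; [reflexivity|split; [lra|]]. intros x. simpl. field.
  - exists (P * ifsp F (w k))%Z,
      (P * ifsr F (w k) + S * Z.of_nat (ifsq F (w k)))%Z, (Q * Z.of_nat (ifsq F (w k)))%Z.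
    split; [|split].
    + rewrite mult_IZR, <- INR_IZR_INZ, HQ. reflexivity.
    + rewrite mult_IZR. destruct (Hp (w k) (Hw k)) as [E|E]; rewrite E; lra.
    + intros x. simpl. rewrite IH. unfold u.
      rewrite !mult_IZR, plus_IZR, !mult_IZR, <- !INR_IZR_INZ.
      pose proof (q_ge2 F Hq (w k) (Hw k)). pose proof (Qp_pos F Hq w k Hw).
      field. rewrite HQ. lra.
Qed.

(** The periodic tail codes the fixed point of an affine map [(P x + S) / Q], namely [S / (Q - P)],
    where [Q >= 2 > P]; the preperiod is another rational affine map. *)
Lemma pt_periodic_rational w n m : valid_word F w -> (1 <= m)%nat ->
  periodic_from w n m -> is_rational (pt F w).
Proof.
  intros Hw Hm Hper. assert (Hs := valid_shift F w n Hw).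
  assert (E : shiftw m (shiftw n w) = shiftw n w).
  { apply functional_extensionality. intros i. unfold shiftw.
    replace (n + (m + i))%nat with (n + i + m)%nat by lia. apply Hper. lia. }
  assert (Ez := pt_comp F lo hi HN Hp Hq Hlh Hin (shiftw n w) m Hs). rewrite E in Ez.
  set (z := pt F (shiftw n w)) in *.
  destruct (comp_rational_affine (shiftw n w) m Hs) as [P [S [Q [HQ [HP Hc]]]]].
  rewrite Hc in Ez.
  assert (HQ2 : 2 <= IZR Q).
  { rewrite HQ. eapply Rle_trans; [|now apply Qp_ge].
    replace 2 with (2 ^ 1) at 1 by lra. apply Rle_pow; [lra|lia]. }
  assert (Ez' : z = IZR S / (IZR Q - IZR P)).
  { apply Rmult_eq_reg_r with (IZR Q - IZR P); [|lra].
    replace (IZR S / (IZR Q - IZR P) * (IZR Q - IZR P)) with (IZR S) by (field; lra).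
    assert (z * IZR Q = IZR P * z + IZR S) by (rewrite Ez at 1; field; lra). lra. }
  destruct (comp_rational_affine w n Hw) as [P' [S' [Q' [HQ' [HP' Hc']]]]].
  assert (HQ0 : 0 < IZR Q') by (rewrite HQ'; now apply Qp_pos).
  exists (P' * S + S' * (Q - P))%Z, (Q' * (Q - P))%Z. split.
  - intros E0. apply (f_equal IZR) in E0. rewrite mult_IZR, minus_IZR in E0. nra.
  - rewrite (pt_comp F lo hi HN Hp Hq Hlh Hin w n Hw). fold z. rewrite Hc', Ez'.
    rewrite plus_IZR, !mult_IZR, minus_IZR. field. lra.
Qed.

(** Only finitely many points have codings of length below [k0]. This handles the rationals whose
    intrinsic denominator may fall below the range where psi is controlled. *)
Lemma perpt_separated x k0 : ~ eventually_periodic_points F x ->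
  exists e, 0 < e /\ forall v n, validl F v -> (length v < k0)%nat -> (n < length v)%nat ->
    e <= Rabs (x - perpt F v n).
Proof.
  intros Hx.
  destruct (finite_common
    (flat_map (fun k => list_prod (words (ifsN F) k) (seq 0 k)) (seq 0 k0))
    (fun vn e => e <= Rabs (x - perpt F (fst vn) (snd vn)))) as [e [He H]].
  - intros; lra.
  - intros [v n] Hvn. apply in_flat_map in Hvn. destruct Hvn as [k [_ Hvn]].
    apply in_prod_iff in Hvn. rewrite in_words, in_seq in Hvn. destruct Hvn as [[Hl Hv] Hn].
    simpl. exists (Rabs (x - perpt F v n)). split; [|lra].
    apply Rabs_pos_lt. intros E. apply Hx. exists v, n.
    split; [exact Hv|split; [lia|lra]].
  - exists e. split; [exact He|]. intros v n Hv Hl Hn. apply (H (v, n)).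
    apply in_flat_map. exists (length v). split; [apply in_seq; lia|].
    apply in_prod; [apply in_words; split; [reflexivity|exact Hv]|apply in_seq; lia].
Qed.

(** A countable union of singletons, each of diameter 0 and therefore of cost 0. *)
Lemma eventually_periodic_points_null s : 0 < s -> H_null s (eventually_periodic_points F).
Proof.
  intros Hs. apply H_null_lists; [exact Hs|]. intros eps Heps.
  exists (fun k => map (fun vn => ((fun x => x = perpt F (fst vn) (snd vn)), 0))
     (list_prod (words (ifsN F) k) (seq 0 k))). split; [|split].
  - intros x [v [n [Hv [Hn Hx]]]]. exists (length v).
    exists ((fun x => x = perpt F v n), 0). split; [|exact Hx].
    apply in_map_iff. exists (v, n). split; [reflexivity|].
    apply in_prod; [apply in_words; split; [reflexivity|exact Hv]|apply in_seq; lia].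
  - intros k e He. apply in_map_iff in He. destruct He as [vn [<- _]]. simpl.
    split; [lra|]. intros x y -> ->. rewrite Rminus_diag, Rabs_R0. lra.
  - intros n. rewrite (rsum_ext _ _ (fun _ => 0)); [rewrite rsum_const; lra|].
    intros k _. rewrite lsum_map. simpl. rewrite rpow_0.
    induction (list_prod (words (ifsN F) k) (seq 0 k)); simpl; lra.
Qed.

Definition perq (v : list nat) (n : nat) : R :=
  IZR (q_int F (perw (lw v) n (length v - n)) n (length v - n)).

Lemma perq_pre w n m : (1 <= m)%nat -> periodic_from w n m ->
  perq (pre w (n + m)) n = IZR (q_int F w n m).
Proof.
  intros Hm Hper. unfold perq. rewrite pre_length.
  replace (n + m - n)%nat with m by lia. now rewrite perw_lw_pre, perw_id.
Qed.

Lemma perpt_pre_periodic w n m : (1 <= m)%nat -> periodic_from w n m ->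
  perpt F (pre w (n + m)) n = pt F w.
Proof. intros Hm Hper. now rewrite perpt_pre, perw_id. Qed.

Lemma perq_bounds v n : validl F v -> (n < length v)%nat ->
  qw F v / 2 <= perq v n <= 2 * qw F v.
Proof.
  intros Hv Hn. unfold perq.
  assert (Hw : valid_word F (lw v)) by (apply lw_valid; [lia|exact Hv]).
  replace (qw F v) with (Qp F (perw (lw v) n (length v - n)) (n + (length v - n))).
  - apply q_int_bounds; [now apply perw_valid|lia].
  - rewrite (Qp_ext F _ (lw v)) by (intros; now apply perw_low).
    replace (n + (length v - n))%nat with (length v) by lia.
    now rewrite <- qw_pre, pre_lw.
Qed.

Lemma qw_ge v : validl F v -> 2 ^ length v <= qw F v.
Proof.
  intros Hv. rewrite <- (pre_lw v) at 2. rewrite qw_pre. apply Qp_ge; [exact Hq|].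
  apply lw_valid; [lia|exact Hv].
Qed.

(** First Borel-Cantelli lemma. A point outside the balls of all words longer than [K] satisfies the
    inequality with constant 1 for these words; if it is not eventually periodic, the finitely many
    shorter words admit some constant [e], and the minimum of both works for all. *)
Lemma badly_ae (delta : R) (psi : R -> R) (q0 : R) :
  0 < delta -> moran F delta <= 1 ->
  (forall q, q0 <= q -> 0 < psi q) ->
  (forall x y, q0 <= x -> x <= y -> psi y <= psi x) ->
  (forall eps, 0 < eps -> exists K, q0 <= 2 ^ K /\
     forall n, rsum n (fun j => INR (S (K + j)) * Rpower (psi (2 ^ (K + j))) delta) <= eps) ->
  mu_ae F delta (badly_symb_approx F psi).
Proof.
  intros Hd HW Hpos Hdec Hconv. unfold mu_ae.
  apply (H_null_union2 delta _ (eventually_periodic_points F)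
    (fun x => (limit_set F x /\ ~ badly_symb_approx F psi x) /\
              ~ eventually_periodic_points F x)); [exact Hd| | |].
  { intros x Hx. destruct (classic (eventually_periodic_points F x)); tauto. }
  { now apply eventually_periodic_points_null. }
  apply H_null_lists; [exact Hd|]. intros eps Heps.
  destruct (Hconv (eps / Rpower 4 delta)) as [K [HK Hsum]].
  { apply Rdiv_lt_0_compat; [exact Heps|apply Rpower_pos]. }
  set (r := fun v n => psi (perq v n) / perq v n).
  (* The length is [S (K + j)] so that [perq v n >= qw F v / 2 >= 2 ^ (K + j)]. The 4 combines
     diameter against radius with the factor 2 between [perq] and [qw]. *)
  assert (Hr : forall v n j, length v = S (K + j) -> validl F v -> (n < length v)%nat ->
     0 < r v n /\ Rpower (2 * r v n) delta
        <= Rpower 4 delta * Rpower (psi (2 ^ (K + j))) delta * wt F delta v).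
  { intros v n j Hl Hv Hn. pose proof (perq_bounds v n Hv Hn) as Hb.
    pose proof (qw_ge v Hv) as Hge. rewrite Hl in Hge. simpl in Hge.
    assert (H2K : 2 ^ K <= 2 ^ (K + j)) by (apply Rle_pow; [lra|lia]).
    assert (HK0 : 0 < 2 ^ K) by (apply pow_lt; lra).
    assert (Hpq : 0 < perq v n) by lra.
    assert (H1 : 0 < psi (perq v n)) by (apply Hpos; lra).
    assert (H2 : psi (perq v n) <= psi (2 ^ (K + j))) by (apply Hdec; lra).
    assert (Hrp : 0 < r v n) by (apply Rdiv_lt_0_compat; assumption).
    split; [exact Hrp|].
    rewrite (wt_qw F delta Hq) by exact Hv.
    assert (Hqv : 0 < qw F v) by now apply qw_pos.
    replace (Rpower (qw F v) (- delta)) with (Rpower (/ qw F v) delta)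
      by (unfold Rpower; rewrite ln_Rinv by exact Hqv; f_equal; ring).
    rewrite !Rpower_mult_distr; try nra; [|apply Rinv_0_lt_compat; lra].
    apply Rpower_le_l; [lra|]. split; [lra|]. unfold r.
    assert (Hi : / perq v n <= 2 * / qw F v).
    { replace (2 * / qw F v) with (/ (qw F v / 2)) by (field; lra).
      apply Rinv_le_contravar; lra. }
    assert (0 < / perq v n) by now apply Rinv_0_lt_compat.
    unfold Rdiv. nra. }
  exists (fun j => flat_map (fun v => map (fun n =>
     ((fun x => Rabs (x - perpt F v n) < r v n), 2 * r v n)) (seq 0 (S (K + j))))
     (words (ifsN F) (S (K + j)))). split; [|split].
  - intros x [[HJ Hnb] Hper].
    destruct (finite_common
      (flat_map (fun k => list_prod (words (ifsN F) k) (seq 0 k)) (seq 0 (S K)))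
      (fun vn e => e * psi (perq (fst vn) (snd vn)) / perq (fst vn) (snd vn)
         <= Rabs (x - perpt F (fst vn) (snd vn)))) as [e [He H]].
    + intros [v n] e e' He. simpl. unfold Rdiv. rewrite !Rmult_assoc.
      set (t := psi (perq v n) * / perq v n). intros H.
      pose proof (Rabs_pos (x - perpt F v n)). destruct (Rle_lt_dec 0 t); nra.
    + intros [v n] Hvn. apply in_flat_map in Hvn. destruct Hvn as [k [_ Hvn]].
      apply in_prod_iff in Hvn. rewrite in_words, in_seq in Hvn.
      destruct Hvn as [[Hl Hv] Hn]. simpl.
      assert (Hx : 0 < Rabs (x - perpt F v n)).
      { apply Rabs_pos_lt. intros E. apply Hper. exists v, n.
        split; [exact Hv|split; [lia|lra]]. }
      set (t := psi (perq v n) / perq v n).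
      (* For a short word nothing is known about the sign or size of psi, hence of [t]; the
         denominator [1 + Rabs t] covers all cases. *)
      exists (Rabs (x - perpt F v n) / (1 + Rabs t)).
      pose proof (Rabs_pos t). pose proof (Rle_abs t).
      split; [apply Rdiv_lt_0_compat; lra|].
      unfold Rdiv at 1. rewrite Rmult_assoc. fold (Rdiv (psi (perq v n)) (perq v n)). fold t.
      apply Rmult_le_reg_r with (1 + Rabs t); [lra|].
      replace (Rabs (x - perpt F v n) / (1 + Rabs t) * t * (1 + Rabs t))
        with (Rabs (x - perpt F v n) * t) by (field; lra).
      nra.
    + apply NNPP. intros Hno. apply Hnb. exists (Rmin e 1).
      assert (Hm : 0 < Rmin e 1) by (apply Rmin_glb_lt; lra). split; [exact Hm|].
      intros y w n m Hrat HyJ Hw Hcod [Hm1 [Hperiod _]].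
      apply (coding_pt F lo hi HN Hp Hq Hlh Hin) in Hcod; [|exact Hw].
      set (v := pre w (n + m)).
      assert (Hv : validl F v) by now apply pre_valid.
      assert (Hl : length v = (n + m)%nat) by apply pre_length.
      rewrite <- (perq_pre w n m Hm1 Hperiod).
      rewrite Hcod, <- (perpt_pre_periodic w n m Hm1 Hperiod). fold v.
      destruct (Nat.le_gt_cases (n + m) K) as [Hs|Hs].
      * assert (H' : e * psi (perq v n) / perq v n <= Rabs (x - perpt F v n)).
        { apply (H (v, n)). apply in_flat_map. exists (n + m)%nat.
          split; [apply in_seq; lia|].
          apply in_prod; [apply in_words; split; [exact Hl|exact Hv]|apply in_seq; lia]. }
        revert H'. unfold Rdiv. rewrite !Rmult_assoc.
        set (t := psi (perq v n) * / perq v n). intros H'.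
        pose proof (Rabs_pos (x - perpt F v n)). pose proof (Rmin_l e 1).
        apply Rle_ge. destruct (Rle_lt_dec 0 t); nra.
      * apply Rnot_lt_ge. intros Hlt. apply Hno.
        exists (n + m - S K)%nat.
        exists ((fun x => Rabs (x - perpt F v n) < r v n), 2 * r v n).
        replace (S (K + (n + m - S K))) with (n + m)%nat by lia. split.
        -- apply in_flat_map. exists v. split; [apply in_words; split; [exact Hl|exact Hv]|].
           apply in_map_iff. exists n. split; [reflexivity|apply in_seq; lia].
        -- simpl. destruct (Hr v n (n + m - S K)%nat) as [Hrp _]; [lia|exact Hv|lia|].
           pose proof (Rmin_r e 1). unfold Rdiv in Hlt. rewrite Rmult_assoc in Hlt.
           fold (Rdiv (psi (perq v n)) (perq v n)) in Hlt. fold (r v n) in Hlt. nra.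
  - intros j e He. apply in_flat_map in He. destruct He as [v [Hv He]].
    apply in_map_iff in He. destruct He as [n [<- Hn]]. apply in_words in Hv.
    apply in_seq in Hn. destruct Hv as [Hl Hv]. simpl.
    destruct (Hr v n j) as [Hrp _]; [exact Hl|exact Hv|lia|]. split; [lra|].
    intros x y Hx Hy. replace (x - y) with ((x - perpt F v n) - (y - perpt F v n)) by ring.
    eapply Rle_trans; [apply Rabs_triang|]. rewrite Rabs_Ropp. lra.
  - intros N. apply Rle_trans with (Rpower 4 delta *
      rsum N (fun j => INR (S (K + j)) * Rpower (psi (2 ^ (K + j))) delta)).
    + rewrite <- rsum_scal. apply rsum_le. intros j _. rewrite lsum_flat_map.
      apply Rle_trans with (lsum (fun v => (Rpower 4 delta * (INR (S (K + j)) *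
        Rpower (psi (2 ^ (K + j))) delta)) * wt F delta v) (words (ifsN F) (S (K + j)))).
      * apply lsum_le. intros v Hv. apply in_words in Hv. destruct Hv as [Hl Hv].
        rewrite lsum_map. simpl snd. rewrite lsum_seq.
        apply Rle_trans with (rsum (S (K + j)) (fun _ =>
           Rpower 4 delta * Rpower (psi (2 ^ (K + j))) delta * wt F delta v)).
        -- apply rsum_le. intros n Hn. destruct (Hr v n j Hl Hv) as [H1 H2]; [lia|].
           rewrite rpow_pos_eq by lra. exact H2.
        -- rewrite rsum_const. right. ring.
      * rewrite lsum_scal, lsum_words_wt.
        assert (moran F delta ^ S (K + j) <= 1).
        { rewrite <- (pow1 (S (K + j))). apply pow_incr. split; [|exact HW].
          apply rsum_nonneg. intros; left; apply pw_pos. }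
        assert (0 <= Rpower 4 delta * (INR (S (K + j)) * Rpower (psi (2 ^ (K + j))) delta)).
        { apply Rmult_le_pos; [left; apply Rpower_pos|].
          apply Rmult_le_pos; [apply pos_INR|left; apply Rpower_pos]. }
        nra.
    + specialize (Hsum N). pose proof (Rpower_pos 4 delta).
      apply Rmult_le_reg_l with (/ Rpower 4 delta); [now apply Rinv_0_lt_compat|].
      rewrite <- Rmult_assoc, Rinv_l, Rmult_1_l by lra. unfold Rdiv in Hsum. lra.
Qed.

End Periodic.

(** * Occurrences of random words *)

Fixpoint prefixb (c w : list nat) : bool :=
  match c, w with
  | [], _ => true
  | _ :: _, [] => false
  | b :: c', a :: w' => Nat.eqb a b && prefixb c' w'
  end.

Definition ind (b : bool) : R := if b then 1 else 0.

(* The shortest prefix of [z] with denominator at least [t], or [z] if there is none. *)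
Fixpoint cut (F : IFS) (t : R) (z : list nat) : list nat :=
  match z with
  | [] => []
  | a :: z' => if Rle_dec t (INR (ifsq F a)) then [a]
               else a :: cut F (t / INR (ifsq F a)) z'
  end.

(** Expectation over [n] independent letters, as an iterated finite sum: splitting the word
    ([E_app]) and exchanging independent parts ([E_swap]) then follow by induction, and
    [lsum_words_E] returns to covers. *)
Fixpoint Ex (F : IFS) (s : R) (n : nat) (f : list nat -> R) : R :=
  match n with
  | O => f []
  | S k => rsum (ifsN F) (fun a => pw F s a * Ex F s k (fun w => f (a :: w)))
  end.

Lemma ind_range b : 0 <= ind b <= 1.
Proof. destruct b; simpl; lra. Qed.

Lemma Rpower_anti a b s : 0 <= s -> 0 < a <= b -> Rpower b (- s) <= Rpower a (- s).
Proof.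
  intros Hs [Ha Hb]. unfold Rpower. apply exp_le_compat.
  pose proof (ln_le_compat a b Ha Hb). nra.
Qed.

Section Expectation.
Context (F : IFS) (s : R).
Notation E := (Ex F s).
Notation N := (ifsN F).

Lemma E_le n f g :
  (forall w, length w = n -> validl F w -> f w <= g w) -> E n f <= E n g.
Proof.
  revert f g. induction n as [|n IH]; intros f g H; simpl.
  - apply H; [reflexivity|constructor].
  - apply rsum_le. intros a Ha. apply Rmult_le_compat_l; [left; apply pw_pos|].
    apply IH. intros w Hw Hv. apply H; [simpl; now f_equal|now constructor].
Qed.

Lemma E_ext n f g :
  (forall w, length w = n -> validl F w -> f w = g w) -> E n f = E n g.
Proof. intros H. apply Rle_antisym; apply E_le; intros; right; [|symmetry]; auto. Qed.

Lemma E_plus n f g : E n (fun w => f w + g w) = E n f + E n g.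
Proof.
  revert f g. induction n as [|n IH]; intros f g; simpl; [reflexivity|].
  rewrite <- rsum_plus. apply rsum_ext. intros a _. rewrite IH. ring.
Qed.

Lemma E_scal n c f : E n (fun w => c * f w) = c * E n f.
Proof.
  revert f. induction n as [|n IH]; intros f; simpl; [reflexivity|].
  rewrite <- rsum_scal. apply rsum_ext. intros a _. rewrite IH. ring.
Qed.

Lemma E_rsum n m f :
  E n (fun w => rsum m (fun i => f i w)) = rsum m (fun i => E n (f i)).
Proof.
  induction m as [|m IH]; simpl.
  - rewrite (E_ext n _ (fun _ => 0 * 0)) by (intros; ring).
    rewrite (E_scal n 0 (fun _ => 0)). ring.
  - rewrite E_plus, IH. reflexivity.
Qed.

Lemma E_app n m f : E (n + m) f = E n (fun u => E m (fun v => f (u ++ v))).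
Proof.
  revert f. induction n as [|n IH]; intros f; simpl; [reflexivity|].
  apply rsum_ext. intros a _. rewrite IH. reflexivity.
Qed.

Lemma E_swap n m (f : list nat -> list nat -> R) :
  E n (fun u => E m (fun v => f u v)) = E m (fun v => E n (fun u => f u v)).
Proof.
  revert f. induction n as [|n IH]; intros f; simpl; [reflexivity|].
  rewrite E_rsum. apply rsum_ext. intros a _. rewrite E_scal. now rewrite IH.
Qed.

Lemma lsum_words_E n f :
  lsum (fun v => wt F s v * f v) (words N n) = E n f.
Proof.
  revert f. induction n as [|n IH]; intros f; simpl; [ring|].
  rewrite lsum_flat_map, lsum_seq. apply rsum_ext. intros a _.
  rewrite lsum_map, <- IH, <- lsum_scal. simpl. f_equal.
  apply functional_extensionality. intros v. ring.
Qed.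

Context (HW : moran F s = 1).

Lemma E_const n c : E n (fun _ => c) = c.
Proof.
  induction n as [|n IH]; simpl; [reflexivity|]. rewrite IH.
  rewrite (rsum_ext _ _ (fun a => c * pw F s a)) by (intros; ring).
  rewrite rsum_scal. fold (moran F s). rewrite HW. ring.
Qed.

(** Shift invariance of the product weights, which have total mass 1. *)
Lemma E_skipn i n h : E (i + n) (fun f => h (skipn i f)) = E n h.
Proof.
  rewrite E_app. transitivity (E i (fun _ => E n h)); [|apply E_const].
  apply E_ext. intros u Hu _. apply E_ext. intros v _ _.
  now rewrite <- Hu, skipn_app, skipn_all, Nat.sub_diag.
Qed.

Lemma rsum_cons_ind b (h : nat -> bool -> R) :
  (forall a, h a false = 0) ->
  rsum N (fun a => h a (Nat.eqb a b)) =
  if Nat.ltb b N then h b true else 0.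
Proof.
  intros H. rewrite (rsum_ext _ _ (fun a => if Nat.eqb a b then h a true else 0)).
  - destruct (Nat.ltb_spec b N) as [Hb|Hb].
    + now rewrite (rsum_delta N (fun a => h a true)).
    + now apply (rsum_delta0 N (fun a => h a true)).
  - intros a _. destruct (Nat.eqb a b); [reflexivity|apply H].
Qed.

Lemma E_zero n : E n (fun _ => 0) = 0.
Proof. apply E_const. Qed.

Lemma E_prefix_le n c : E n (fun w => ind (prefixb c w)) <= wt F s c.
Proof.
  revert c. induction n as [|n IH]; intros [|b c].
  - simpl. lra.
  - simpl. left. apply (wt_pos F s (b :: c)).
  - rewrite (E_ext (S n) _ (fun _ => 1)) by (intros w _ _; destruct w; reflexivity).
    rewrite E_const. simpl. lra.
  - simpl. rewrite (rsum_cons_ind b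
      (fun a e => pw F s a * E n (fun w => ind (e && prefixb c w)))).
    + destruct (Nat.ltb b N); simpl.
      * apply Rmult_le_compat_l; [left; apply pw_pos|apply IH].
      * left. apply (wt_pos F s (b :: c)).
    + intros a. simpl. rewrite E_zero. ring.
Qed.

Lemma E_prefix n c : validl F c -> (length c <= n)%nat ->
  E n (fun w => ind (prefixb c w)) = wt F s c.
Proof.
  revert c. induction n as [|n IH]; intros c Hc Hl.
  - destruct c as [|b c]; simpl in *; [reflexivity|lia].
  - destruct Hc as [|b c Hb Hc].
    + rewrite (E_ext (S n) _ (fun _ => 1)) by (intros w _ _; destruct w; reflexivity).
      rewrite E_const. reflexivity.
    + simpl. rewrite (rsum_cons_ind b
        (fun a e => pw F s a * E n (fun w => ind (e && prefixb c w)))).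
      * apply Nat.ltb_lt in Hb. rewrite Hb. simpl in *. rewrite IH; [reflexivity|exact Hc|lia].
      * intros a. simpl. rewrite E_zero. ring.
Qed.

Lemma prefixb_firstn c u v :
  prefixb c (u ++ v) = true -> prefixb (firstn (length u) c) u = true.
Proof.
  revert c. induction u as [|a u IH]; intros [|b c]; simpl; try reflexivity.
  intros H. apply andb_prop in H. destruct H as [H1 H2]. rewrite H1. simpl. now apply IH.
Qed.

(* If [c] occurs at [0] and at [d], then the first [d] letters spell [firstn d c] and the
   remaining ones start with [c]: these two events are independent, overlap or not. *)
Lemma E_prefix_pair n d c : (d <= n)%nat ->
  E n (fun f => ind (prefixb c f) * ind (prefixb c (skipn d f)))
    <= wt F s (firstn d c) * wt F s c.
Proof.
  intros H. replace n with (d + (n - d))%nat by lia. rewrite E_app.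
  apply Rle_trans with
    (E d (fun u => E (n - d) (fun v => ind (prefixb c v)) * ind (prefixb (firstn d c) u))).
  - apply E_le. intros u Hu _. rewrite Rmult_comm, <- E_scal. apply E_le. intros v _ _.
    rewrite <- Hu, skipn_app, skipn_all, Nat.sub_diag. simpl.
    apply Rmult_le_compat_r; [apply ind_range|].
    destruct (prefixb c (u ++ v)) eqn:Ep; [|apply ind_range].
    rewrite (prefixb_firstn _ _ _ Ep). lra.
  - rewrite E_scal, Rmult_comm. pose proof (E_prefix_le (n - d) c).
    pose proof (E_prefix_le d (firstn d c)).
    pose proof (wt_pos F s c). pose proof (wt_pos F s (firstn d c)).
    apply Rmult_le_compat; try assumption.
    + rewrite <- (E_zero d). apply E_le. intros; apply ind_range.
    + rewrite <- (E_zero (n - d)). apply E_le. intros; apply ind_range.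
Qed.

Context (Hs : 0 < s).
Context (HN : (2 <= ifsN F)%nat).
Context (Hq : forall a, (a < ifsN F)%nat -> (2 <= ifsq F a)%nat).
Context (Qm : R).
Context (HQ1 : 1 <= Qm).
Context (HQm : forall a, (a < ifsN F)%nat -> INR (ifsq F a) <= Qm).

Notation theta := (Rpower 2 (- s)).

Lemma theta_lt1 : 0 < theta < 1.
Proof.
  split; [apply Rpower_pos|]. unfold Rpower. rewrite <- exp_0. apply exp_increasing.
  pose proof ln_lt_2. nra.
Qed.

Lemma pw_le_theta a : (a < N)%nat -> pw F s a <= theta.
Proof.
  intros Ha. apply Rpower_anti; [lra|]. pose proof (q_ge2 F Hq a Ha). lra.
Qed.

Lemma wt_le_theta c : validl F c -> wt F s c <= theta ^ length c.
Proof.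
  induction 1 as [|a c Ha Hc IH]; simpl; [lra|].
  apply Rmult_le_compat; [left; apply pw_pos|left; apply wt_pos|now apply pw_le_theta|exact IH].
Qed.

Lemma validl_firstn d c : validl F c -> validl F (firstn d c).
Proof.
  intros H. revert d. induction H as [|a c Ha Hc IH]; intros [|d]; simpl; constructor; auto.
  apply IH.
Qed.

(** For [d >= length c] the two occurrences do not overlap and the first term suffices; for smaller
    [d] the truncation has exactly [d] letters, each of weight at most [theta]. *)
Lemma wt_firstn_le d c : validl F c -> wt F s (firstn d c) <= wt F s c + theta ^ d.
Proof.
  intros Hc. pose proof theta_lt1. assert (0 < theta ^ d) by (apply pow_lt; lra).
  destruct (Nat.le_gt_cases (length c) d) as [H1|H1].
  - rewrite firstn_all2 by exact H1. lra.
  - pose proof (wt_le_theta _ (validl_firstn d c Hc)) as H2.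
    rewrite length_firstn, Nat.min_l in H2 by lia. pose proof (wt_pos F s c). lra.
Qed.

Lemma cut_valid t z : validl F z -> validl F (cut F t z).
Proof.
  intros H. revert t. induction H as [|a z Ha Hz IH]; intros t; simpl; [constructor|].
  destruct (Rle_dec t (INR (ifsq F a)));
    [constructor; [exact Ha|constructor]|constructor; [exact Ha|apply IH]].
Qed.

Lemma cut_length t z : (length (cut F t z) <= length z)%nat.
Proof.
  revert t. induction z as [|a z IH]; intros t; simpl; [lia|].
  destruct (Rle_dec t (INR (ifsq F a))); simpl; [lia|].
  specialize (IH (t / INR (ifsq F a))). lia.
Qed.

Lemma cut_prefix t z : prefixb (cut F t z) z = true.
Proof.
  revert t. induction z as [|a z IH]; intros t; simpl; [reflexivity|].
  destruct (Rle_dec t (INR (ifsq F a))); simpl; rewrite Nat.eqb_refl; simpl; [reflexivity|apply IH].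
Qed.

(** Denominators at least double with each letter, so a block of this length reaches [t] before it
    is exhausted. *)
Lemma cut_qw_ge t z : validl F z -> 0 < t <= 2 ^ length z -> t <= qw F (cut F t z).
Proof.
  intros H. revert t. induction H as [|a z Ha Hz IH]; intros t Ht; simpl in *; [lra|].
  pose proof (q_ge2 F Hq a Ha). destruct (Rle_dec t (INR (ifsq F a))) as [H1|H1]; simpl; [lra|].
  assert (H2 : 0 < t / INR (ifsq F a) <= 2 ^ length z).
  { split; [apply Rdiv_lt_0_compat; lra|]. apply Rmult_le_reg_r with (INR (ifsq F a)); [lra|].
    unfold Rdiv. rewrite Rmult_assoc, Rinv_l by lra.
    assert (0 < 2 ^ length z) by (apply pow_lt; lra). nra. }
  specialize (IH _ H2).
  replace t with (INR (ifsq F a) * (t / INR (ifsq F a))) at 1 by (field; lra).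
  apply Rmult_le_compat_l; lra.
Qed.

(** The cut stops at the first passage over [t], so it overshoots by at most one letter. *)
Lemma cut_qw_le t z : validl F z -> 1 <= t -> qw F (cut F t z) <= Qm * t.
Proof.
  intros H. revert t. induction H as [|a z Ha Hz IH]; intros t Ht; simpl; [nra|].
  pose proof (q_ge2 F Hq a Ha). pose proof (HQm a Ha).
  destruct (Rle_dec t (INR (ifsq F a))) as [H2|H2]; simpl; [nra|].
  assert (H3 : 1 <= t / INR (ifsq F a)).
  { apply Rmult_le_reg_r with (INR (ifsq F a)); [lra|].
    unfold Rdiv. rewrite Rmult_assoc, Rinv_l; lra. }
  specialize (IH _ H3).
  replace (Qm * t) with (INR (ifsq F a) * (Qm * (t / INR (ifsq F a)))) by (field; lra).
  apply Rmult_le_compat_l; lra.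
Qed.

Lemma wt_cut_le t z : validl F z -> 0 < t <= 2 ^ length z ->
  wt F s (cut F t z) <= Rpower t (- s).
Proof.
  intros Hz Ht. rewrite (wt_qw F s Hq) by now apply cut_valid.
  apply Rpower_anti; [lra|]. split; [lra|now apply cut_qw_ge].
Qed.

Lemma wt_cut_ge t z : validl F z -> 1 <= t ->
  Rpower Qm (- s) * Rpower t (- s) <= wt F s (cut F t z).
Proof.
  intros Hz Ht. rewrite (wt_qw F s Hq) by now apply cut_valid.
  rewrite Rpower_mult_distr by lra. apply Rpower_anti; [lra|].
  split; [apply qw_pos; [exact Hq|now apply cut_valid]|now apply cut_qw_le].
Qed.

(** The cut words are prefix-free, so at most one of them is a prefix of the fixed [y], and its
    denominator is at least [t]. The induction reads [y]: its first letter is forced, and the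
    threshold is divided by the denominator of that letter. This bounds the mean count for every
    text, not just for a typical one. *)
Lemma E_cut_prefix_le l t y : 0 < t <= 2 ^ l ->
  E l (fun z => ind (prefixb (cut F t z) y)) <= Rpower t (- s).
Proof.
  revert t y. induction l as [|l IH]; intros t y Ht.
  - simpl in *. replace 1 with (Rpower 1 (- s)).
    + apply Rpower_anti; lra.
    + unfold Rpower. rewrite ln_1, Rmult_0_r. apply exp_0.
  - pose proof (Rpower_pos t (- s)) as Hpos. destruct y as [|b y].
    + rewrite (E_ext (S l) _ (fun _ => 0)); [rewrite E_zero; lra|].
      intros [|a w] Hw _; [discriminate|]. simpl.
      destruct (Rle_dec t (INR (ifsq F a))); reflexivity.
    + destruct (Nat.lt_ge_cases b N) as [Hb|Hb].
      * apply Rle_trans with (rsum N (fun a => if Nat.eqb a b then Rpower t (- s) else 0));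
          [|now rewrite (rsum_delta N (fun _ => Rpower t (- s))); [lra|]].
        simpl. apply rsum_le. intros a Ha. destruct (Nat.eqb a b) eqn:Eab.
        -- apply Nat.eqb_eq in Eab. subst b. pose proof (q_ge2 F Hq a Ha).
           pose proof (pw_pos F s a). destruct (Rle_dec t (INR (ifsq F a))) as [H1|H1].
           ++ apply Rle_trans with (pw F s a).
              ** rewrite <- (Rmult_1_r (pw F s a)) at 2. apply Rmult_le_compat_l; [lra|].
                 rewrite <- (E_const l 1). apply E_le. intros; apply ind_range.
              ** apply Rpower_anti; lra.
           ++ apply Rle_trans with (pw F s a * Rpower (t / INR (ifsq F a)) (- s)).
              ** apply Rmult_le_compat_l; [lra|].
                 eapply Rle_trans; [|apply (IH (t / INR (ifsq F a)) y)].
                 --- apply E_le. intros w _ _. simpl. rewrite Nat.eqb_refl. simpl. lra.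
                 --- split; [apply Rdiv_lt_0_compat; lra|].
                     apply Rmult_le_reg_r with (INR (ifsq F a)); [lra|].
                     unfold Rdiv. rewrite Rmult_assoc, Rinv_l by lra. simpl in Ht.
                     assert (0 < 2 ^ l) by (apply pow_lt; lra). nra.
              ** unfold pw. rewrite Rpower_mult_distr by (try apply Rdiv_lt_0_compat; lra).
                 right. f_equal. field. lra.
        -- right. rewrite (E_ext l _ (fun _ => 0)); [rewrite E_zero; ring|].
           intros w _ _. rewrite Nat.eqb_sym in Eab.
           destruct (Rle_dec t (INR (ifsq F a))); simpl; rewrite Eab; reflexivity.
      * rewrite (E_ext (S l) _ (fun _ => 0)); [rewrite E_zero; lra|].
        intros [|a w] Hw Hv; [discriminate|]. inversion Hv; subst.
        assert (Eab : Nat.eqb b a = false) by (apply Nat.eqb_neq; lia). simpl.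
        destruct (Rle_dec t (INR (ifsq F a))); simpl; rewrite Eab; reflexivity.
Qed.

(* Number of occurrences, among the first [L] starting positions of [f], of the cut block [z]. *)
Definition gcount (t : R) (L : nat) (f z : list nat) : R :=
  rsum L (fun i => ind (prefixb (cut F t z) (skipn i f))).

Lemma gcount_nonneg t L f z : 0 <= gcount t L f z.
Proof. apply rsum_nonneg. intros; apply ind_range. Qed.

(** With truncated subtraction the exponent is the distance between [i] and [j]; each side of [i]
    contributes a geometric sum of at most [/ (1 - theta)]. *)
Lemma theta_sum_le L i : (i < L)%nat ->
  rsum L (fun j => theta ^ ((i - j) + (j - i))) <= 2 / (1 - theta).
Proof.
  intros Hi. pose proof theta_lt1 as Ht.
  assert (H1 : forall m, (1 - theta) * rsum m (fun j => theta ^ (m - j)) = theta - theta ^ (S m)).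
  { induction m as [|m IH]; [simpl; ring|]. rewrite rsum_S_l.
    change (rsum m (fun j => theta ^ (S m - S j))) with (rsum m (fun j => theta ^ (m - j))).
    rewrite Rmult_plus_distr_l, IH. rewrite Nat.sub_0_r. simpl. ring. }
  assert (H2 : forall m, (1 - theta) * rsum m (fun j => theta ^ j) = 1 - theta ^ m).
  { induction m as [|m IH]; [simpl; ring|]. simpl rsum.
    rewrite Rmult_plus_distr_l, IH. simpl. ring. }
  replace L with (i + (L - i))%nat by lia. rewrite rsum_app.
  rewrite (rsum_ext i _ (fun j => theta ^ (i - j))) by (intros; f_equal; lia).
  rewrite (rsum_ext (L - i) _ (fun j => theta ^ j)) by (intros; f_equal; lia).
  specialize (H1 i). specialize (H2 (L - i)%nat).
  assert (0 < theta ^ (S i)) by (apply pow_lt; lra).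
  assert (0 < theta ^ (L - i)) by (apply pow_lt; lra).
  apply Rmult_le_reg_l with (1 - theta); [lra|].
  replace ((1 - theta) * (2 / (1 - theta))) with 2 by (field; lra).
  rewrite Rmult_plus_distr_l. lra.
Qed.

(** Shift invariance moves the earlier occurrence to position 0, where [E_prefix_pair] applies with
    [d] the distance of the two. *)
Lemma E_occurrences_pair n i j c : (i <= n)%nat -> (j <= n)%nat -> validl F c ->
  E n (fun f => ind (prefixb c (skipn i f)) * ind (prefixb c (skipn j f)))
   <= wt F s c * (wt F s c + theta ^ ((i - j) + (j - i))).
Proof.
  assert (H : forall i j, (i <= j)%nat -> (j <= n)%nat -> validl F c ->
    E n (fun f => ind (prefixb c (skipn i f)) * ind (prefixb c (skipn j f)))
     <= wt F s c * (wt F s c + theta ^ ((i - j) + (j - i)))).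
  { clear i j. intros i j Hij Hj Hc. replace (i - j + (j - i))%nat with (j - i)%nat by lia.
    replace n with (i + (n - i))%nat by lia.
    rewrite (E_ext _ _ (fun f => (fun g => ind (prefixb c g) * ind (prefixb c (skipn (j - i) g)))
       (skipn i f))).
    - rewrite (E_skipn i (n - i) (fun g => ind (prefixb c g) * ind (prefixb c (skipn (j - i) g)))).
      eapply Rle_trans; [apply E_prefix_pair; lia|]. rewrite Rmult_comm.
      apply Rmult_le_compat_l; [left; apply wt_pos|now apply wt_firstn_le].
    - intros f _ _. cbv beta. rewrite skipn_skipn. do 4 f_equal. lia. }
  intros Hi Hj Hc. destruct (Nat.le_ge_cases i j) as [Hij|Hij]; [now apply H|].
  rewrite (E_ext _ _ (fun f => ind (prefixb c (skipn j f)) * ind (prefixb c (skipn i f))))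
    by (intros; ring).
  rewrite Nat.add_comm. now apply H.
Qed.

(** Over all pairs of positions, the independent part gives the square of [L t^(-s)]; the
    self-overlaps give [L t^(-s)] times a constant that does not depend on the block. *)
Lemma E_gcount_sq t L l z : validl F z -> length z = l -> 0 < t <= 2 ^ l ->
  E (L + l) (fun f => gcount t L f z * gcount t L f z) <=
  INR L * Rpower t (- s) * (INR L * Rpower t (- s) + 2 / (1 - theta)).
Proof.
  intros Hz Hl Ht. subst l. pose proof (cut_valid t z Hz) as Hc.
  pose proof (wt_cut_le t z Hz Ht) as Hwt. pose proof (wt_pos F s (cut F t z)) as Hwp.
  pose proof theta_lt1 as Hth.
  set (c := cut F t z) in *. set (x := wt F s c) in *. set (tau := Rpower t (- s)) in *.
  apply Rle_trans with (rsum L (fun i => rsum L (fun j => x * (x + theta ^ ((i - j) + (j - i)))))).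
  - rewrite (E_ext _ _ (fun f => rsum L (fun i => rsum L (fun j =>
       ind (prefixb c (skipn i f)) * ind (prefixb c (skipn j f)))))).
    + rewrite E_rsum. apply rsum_le. intros i Hi. rewrite E_rsum. apply rsum_le. intros j Hj.
      apply E_occurrences_pair; [lia|lia|exact Hc].
    + intros f _ _. unfold gcount. fold c. rewrite <- rsum_scal. apply rsum_ext. intros i _.
      rewrite rsum_scal, Rmult_comm. reflexivity.
  - apply Rle_trans with (rsum L (fun _ => tau * (INR L * tau + 2 / (1 - theta)))).
    + apply rsum_le. intros i Hi. rewrite rsum_scal, rsum_plus, rsum_const.
      pose proof (theta_sum_le L i Hi). pose proof (pos_INR L).
      assert (0 <= rsum L (fun j => theta ^ ((i - j) + (j - i)))).
      { apply rsum_nonneg. intros. left. apply pow_lt. lra. }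
      apply Rmult_le_compat; [lra|nra|lra|nra].
    + rewrite rsum_const. right. ring.
Qed.

(** The [l] letters beyond the first [L] leave room for an occurrence at each of the [L] starting
    positions, so each has probability exactly the weight of the cut block. *)
Lemma E_gcount_ge t L l z : validl F z -> length z = l -> 1 <= t ->
  INR L * (Rpower Qm (- s) * Rpower t (- s)) <= E (L + l) (fun f => gcount t L f z).
Proof.
  intros Hz Hl Ht. unfold gcount. rewrite E_rsum, <- rsum_const. apply rsum_le. intros i Hi.
  replace (L + l)%nat with (i + (L + l - i))%nat by lia.
  rewrite (E_skipn i (L + l - i) (fun g => ind (prefixb (cut F t z) g))).
  rewrite E_prefix; [now apply wt_cut_ge|now apply cut_valid|].
  pose proof (cut_length t z). lia.
Qed.

(** * Second moment of the number of hits in one stage *)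

Fixpoint Xs (t : R) (L l B : nat) (f v : list nat) : R :=
  match B with
  | O => 0
  | S B' => gcount t L f (firstn l v) + Xs t L l B' f (skipn l v)
  end.

Lemma firstn_app_exact {A} (u v : list A) : firstn (length u) (u ++ v) = u.
Proof. rewrite firstn_app, firstn_all, Nat.sub_diag. simpl. apply app_nil_r. Qed.

Lemma skipn_app_exact {A} (u v : list A) : skipn (length u) (u ++ v) = v.
Proof. rewrite skipn_app, skipn_all, Nat.sub_diag. reflexivity. Qed.

Lemma E_Xs t L l B f : E (B * l) (Xs t L l B f) = INR B * E l (gcount t L f).
Proof.
  induction B as [|B IH]; [simpl; ring|].
  change (S B * l)%nat with (l + B * l)%nat. rewrite E_app, S_INR.
  rewrite (E_ext l _ (fun u => gcount t L f u + INR B * E l (gcount t L f))).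
  - rewrite E_plus, E_const. ring.
  - intros u Hu _. rewrite (E_ext _ _ (fun v => gcount t L f u + Xs t L l B f v)).
    + rewrite E_plus, E_const, IH. reflexivity.
    + intros v _ _. simpl. now rewrite <- Hu, firstn_app_exact, skipn_app_exact.
Qed.

(** For a fixed text [f] the counts of the [B] blocks are independent and identically distributed;
    the [B (B - 1)] mixed terms are bounded by [B ^ 2] of them. *)
Lemma E_Xs_sq t L l B f :
  E (B * l) (fun v => Xs t L l B f v * Xs t L l B f v) <=
  INR B * E l (fun z => gcount t L f z * gcount t L f z) +
  INR B * INR B * (E l (gcount t L f) * E l (gcount t L f)).
Proof.
  set (G := E l (gcount t L f)).
  set (G2 := E l (fun z => gcount t L f z * gcount t L f z)).
  induction B as [|B IH]; [simpl; lra|].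
  change (S B * l)%nat with (l + B * l)%nat. rewrite E_app, S_INR.
  rewrite (E_ext l _ (fun u => gcount t L f u * gcount t L f u +
     ((2 * INR B * G) * gcount t L f u + E (B * l) (fun v => Xs t L l B f v * Xs t L l B f v)))).
  - rewrite !E_plus, E_scal, E_const. fold G G2. pose proof (pos_INR B). nra.
  - intros u Hu _. rewrite (E_ext _ _ (fun v => gcount t L f u * gcount t L f u +
       ((2 * gcount t L f u) * Xs t L l B f v + Xs t L l B f v * Xs t L l B f v))).
    + rewrite E_plus, E_const, E_plus, E_scal.
      change (fun w => Xs t L l B f w) with (Xs t L l B f). rewrite E_Xs. fold G. ring.
    + intros v _ _. simpl. rewrite <- Hu, firstn_app_exact, skipn_app_exact. ring.
Qed.

Definition stage_count (t : R) (L l B : nat) (v : list nat) : R :=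
  Xs t L l B (firstn (L + l) v) (skipn (L + l) v).

Definition nohit (t : R) (L l B : nat) (v : list nat) : R :=
  if Req_EM_T (stage_count t L l B v) 0 then 1 else 0.

Lemma nohit_range t L l B v : 0 <= nohit t L l B v <= 1.
Proof. unfold nohit. destruct (Req_EM_T _ _); lra. Qed.

(* Second moment method, through the pointwise bound
   [1_{X = 0} <= (1 - lam X)^2] with the optimal [lam]. *)
Lemma E_nohit_le t L l B : 1 <= t <= 2 ^ l ->
  let mu := INR L * INR B * Rpower t (- s) in
  let c := Rpower Qm (- s) in
  let K := 2 / (1 - theta) in
  E ((L + l) + B * l) (nohit t L l B) <= 1 - c * c * mu / (2 * mu + K).
Proof.
  intros Ht mu c K. pose proof theta_lt1 as Hth.
  assert (Ht' : 0 < t <= 2 ^ l) by lra.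
  assert (HK : 0 < K) by (apply Rdiv_lt_0_compat; lra).
  assert (Hc : 0 < c) by apply Rpower_pos.
  set (tau := Rpower t (- s)) in *. assert (Htau : 0 < tau) by apply Rpower_pos.
  pose proof (pos_INR L) as HL. pose proof (pos_INR B) as HB.
  (* It absorbs the term [B (L tau)^2] of the diagonal into [mu^2], whence the factor 2 in the
     second moment. *)
  assert (HBB : INR B <= INR B * INR B).
  { destruct B as [|B]; [simpl; lra|]. rewrite S_INR in *. pose proof (pos_INR B). nra. }
  assert (Hmu : 0 <= mu) by (unfold mu; repeat apply Rmult_le_pos; lra).
  set (X := stage_count t L l B).
  assert (HX : forall h : R -> R, E (L + l + B * l) (fun v => h (X v)) =
     E (L + l) (fun f => E (B * l) (fun v => h (Xs t L l B f v)))).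
  { intros h. rewrite E_app. apply E_ext. intros f Hf _. apply E_ext. intros v _ _.
    unfold X, stage_count. now rewrite <- Hf, firstn_app_exact, skipn_app_exact. }
  assert (H1 : c * mu <= E (L + l + B * l) X).
  { eapply Rle_trans; [|right; symmetry; exact (HX (fun x => x))].
    rewrite (E_ext (L + l) _ (fun f => INR B * E l (gcount t L f)))
      by (intros; apply E_Xs).
    rewrite E_scal.
    rewrite (E_swap (L + l) l (gcount t L) : E (L + l) (fun f => E l (gcount t L f)) = _).
    replace (c * mu) with (INR B * (INR L * (c * tau))) by (unfold mu; ring).
    apply Rmult_le_compat_l; [exact HB|]. rewrite <- (E_const l (INR L * (c * tau))).
    apply E_le. intros z Hl Hz. apply E_gcount_ge; [exact Hz|exact Hl|lra]. }
  assert (H2 : E (L + l + B * l) (fun v => X v * X v) <= 2 * (mu * mu) + K * mu).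
  { rewrite (HX (fun x => x * x)).
    apply Rle_trans with (E (L + l) (fun f => INR B * E l (fun z => gcount t L f z * gcount t L f z)
       + INR B * INR B * ((INR L * tau) * (INR L * tau)))).
    - apply E_le. intros f _ _. eapply Rle_trans; [apply E_Xs_sq|].
      apply Rplus_le_compat_l. apply Rmult_le_compat_l; [nra|].
      assert (0 <= E l (gcount t L f) <= INR L * tau).
      { split.
        - rewrite <- (E_zero l). apply E_le. intros; apply gcount_nonneg.
        - unfold gcount. rewrite E_rsum, <- rsum_const. apply rsum_le. intros i _.
          now apply E_cut_prefix_le. }
      apply Rmult_le_compat; lra.
    (* The mixed terms were bounded for each fixed text. For the squares the order is exchanged: the
       block is fixed and the text averaged, which is where the self-overlap estimate applies. *)
    - rewrite E_plus, E_scal, E_const, E_swap.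
      assert (H3 : E l (fun z => E (L + l) (fun f => gcount t L f z * gcount t L f z))
         <= INR L * tau * (INR L * tau + K)).
      { rewrite <- (E_const l (INR L * tau * (INR L * tau + K))). apply E_le.
        intros z Hl Hz. now apply E_gcount_sq. }
      apply Rle_trans with (INR B * (INR L * tau * (INR L * tau + K)) +
        INR B * INR B * (INR L * tau * (INR L * tau))).
      + apply Rplus_le_compat_r, Rmult_le_compat_l; assumption.
      + unfold mu. assert (0 <= INR L * tau * (INR L * tau)) by nra. nra. }
  (* Minimizer of [1 - 2 lam c mu + lam^2 (2 mu^2 + K mu)]. *)
  set (lam := c / (2 * mu + K)).
  assert (Hlam : 0 < lam) by (apply Rdiv_lt_0_compat; lra).
  apply Rle_trans with (E (L + l + B * l) (fun v => 1 + (- (2 * lam) * X v + (lam * lam) * (X v * X v)))).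
  - apply E_le. intros v _ _. unfold nohit. fold (X v).
    destruct (Req_EM_T (X v) 0) as [E0|E0].
    + rewrite E0. lra.
    + pose proof (Rle_0_sqr (1 - lam * X v)). unfold Rsqr in H. nra.
  - rewrite !E_plus, !E_scal, E_const.
    replace (c * c * mu / (2 * mu + K)) with
      (2 * lam * (c * mu) - lam * lam * (2 * (mu * mu) + K * mu))
      by (unfold lam; field; lra).
    assert (0 <= lam * lam) by nra. nra.
Qed.

End Expectation.

(** * Independent stages *)

Fixpoint rprod (n : nat) (f : nat -> R) : R :=
  match n with O => 1 | S k => rprod k f * f k end.

Fixpoint nsum (n : nat) (f : nat -> nat) : nat :=
  match n with O => O | S k => (nsum k f + f k)%nat end.

Lemma rprod_01 n f : (forall i, f i = 0 \/ f i = 1) -> rprod n f = 0 \/ rprod n f = 1.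
Proof.
  intros H. induction n as [|n [IH|IH]]; simpl; [now right|left; rewrite IH; ring|].
  rewrite IH. destruct (H n) as [E|E]; rewrite E; [left|right]; ring.
Qed.

Lemma rprod_1 n f : (forall i, (i < n)%nat -> f i = 1) -> rprod n f = 1.
Proof.
  induction n as [|n IH]; intros H; simpl; [reflexivity|].
  rewrite IH, H; [ring|lia|]. intros; apply H; lia.
Qed.

Lemma rprod_ext n f g : (forall i, (i < n)%nat -> f i = g i) -> rprod n f = rprod n g.
Proof.
  induction n as [|n IH]; intros H; simpl; [reflexivity|].
  rewrite IH, H; [reflexivity|lia|]. intros; apply H; lia.
Qed.

Lemma rprod_le_exp n p : (forall i, 0 <= 1 - p i) ->
  0 <= rprod n (fun i => 1 - p i) <= exp (- rsum n p).
Proof.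
  intros H. induction n as [|n IH]; simpl.
  - rewrite Ropp_0, exp_0. lra.
  - rewrite Ropp_plus_distr, exp_plus. specialize (H n).
    pose proof (exp_ineq1_le (- p n)). split; [apply Rmult_le_pos; tauto|].
    apply Rmult_le_compat; tauto || lra.
Qed.

Lemma nsum_mono n m f : (n <= m)%nat -> (nsum n f <= nsum m f)%nat.
Proof. induction 1; simpl; lia. Qed.

(** The map [x / (2 x + K)] is at least [x / (3 K)] for [x <= K] and at least 1/3 beyond. Either all
    late terms are of the first kind and divergence is inherited, or infinitely many are of the
    second. *)
Lemma sum_saturate K mu : 0 < K -> (forall i, 0 <= mu i) ->
  (forall M, exists n, M <= rsum n mu) ->
  forall M, exists n, M <= rsum n (fun i => mu i / (2 * mu i + K)).
Proof.
  intros HK Hmu Hdiv.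
  assert (Hx : forall i, 0 <= mu i / (2 * mu i + K)).
  { intros i. specialize (Hmu i). unfold Rdiv. apply Rmult_le_pos; [lra|].
    left. apply Rinv_0_lt_compat. lra. }
  destruct (classic (exists i0, forall i, (i0 <= i)%nat -> mu i <= K)) as [[i0 H0]|Hno].
  - intros M. destruct (Hdiv (rsum i0 mu + Rabs M * (3 * K))) as [n Hn].
    exists (i0 + (max n i0 - i0))%nat. rewrite rsum_app.
    assert (H1 : rsum n mu <= rsum (i0 + (max n i0 - i0)) mu)
      by (apply rsum_le_len; [lia|exact Hmu]).
    rewrite rsum_app in H1.
    set (d := (max n i0 - i0)%nat) in *.
    assert (H2 : rsum d (fun i => mu (i0 + i)%nat) <=
      3 * K * rsum d (fun i => mu (i0 + i)%nat / (2 * mu (i0 + i)%nat + K))).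
    { rewrite <- rsum_scal. apply rsum_le. intros i _.
      specialize (H0 (i0 + i)%nat ltac:(lia)). specialize (Hmu (i0 + i)%nat).
      set (m := mu (i0 + i)%nat) in *.
      apply Rmult_le_reg_r with (2 * m + K); [lra|].
      replace (3 * K * (m / (2 * m + K)) * (2 * m + K)) with (3 * K * m) by (field; lra). nra. }
    assert (H3 : 0 <= rsum i0 (fun i => mu i / (2 * mu i + K)))
      by (apply rsum_nonneg; auto).
    pose proof (Rle_abs M). nra.
  - assert (H3 : forall i, K < mu i -> / 3 <= mu i / (2 * mu i + K)).
    { intros i Hi. apply Rmult_le_reg_r with (2 * mu i + K); [lra|].
      unfold Rdiv. rewrite Rmult_assoc, Rinv_l; lra. }
    assert (H4 : forall k, exists n, INR k * / 3 <= rsum n (fun i => mu i / (2 * mu i + K))).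
    { induction k as [|k [n Hn]]; [exists 0%nat; simpl; lra|].
      assert (exists i, (n <= i)%nat /\ K < mu i) as [i [Hi Hmi]].
      { apply NNPP. intros H. apply Hno. exists n. intros i Hi. apply Rnot_lt_le.
        intros Hlt. apply H. now exists i. }
      exists (S i). rewrite S_INR. simpl.
      pose proof (rsum_le_len n i _ Hi Hx). specialize (H3 i Hmi). lra. }
    intros M. destruct (INR_archimed (/ 3) M) as [k Hk]; [lra|].
    destruct (H4 k) as [n Hn]. exists n. lra.
Qed.

Lemma firstn_skipn_app {A} a b (u v : list A) : (a + b <= length u)%nat ->
  firstn b (skipn a (u ++ v)) = firstn b (skipn a u).
Proof.
  intros H. rewrite skipn_app. replace (a - length u)%nat with 0%nat by lia. simpl.
  rewrite firstn_app, length_skipn. replace (b - (length u - a))%nat with 0%nat by lia.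
  simpl. apply app_nil_r.
Qed.

Lemma skipn_pre w a n : skipn a (pre w n) = pre (shiftw a w) (n - a).
Proof.
  destruct (Nat.le_gt_cases a n) as [H|H].
  - replace n with (a + (n - a))%nat at 1 by lia. rewrite pre_app.
    rewrite <- (pre_length w a) at 1. apply skipn_app_exact.
  - rewrite skipn_all2 by (rewrite pre_length; lia).
    replace (n - a)%nat with 0%nat by lia. reflexivity.
Qed.

Lemma firstn_pre w a n : (a <= n)%nat -> firstn a (pre w n) = pre w a.
Proof.
  intros H. replace n with (a + (n - a))%nat by lia. rewrite pre_app.
  rewrite <- (pre_length w a) at 1. apply firstn_app_exact.
Qed.

Lemma prefixb_pre c w k : prefixb c (pre w k) = true -> c = pre w (length c).
Proof.
  revert w k. induction c as [|b c IH]; intros w k H; [reflexivity|].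
  destruct k as [|k]; [discriminate|].
  rewrite (pre_app w 1 k : pre w (S k) = _) in H. simpl in H.
  apply andb_prop in H. destruct H as [H1 H2]. apply Nat.eqb_eq in H1. subst b.
  simpl length. rewrite (pre_app w 1 (length c) : pre w (S (length c)) = _). simpl.
  f_equal. now apply (IH _ k).
Qed.

(** Past [n + m] both words repeat what they had [m] letters earlier, so a strong induction carries
    the agreement on through the [r] repeated letters. *)
Lemma perw_agree w n m r : (1 <= m)%nat ->
  (forall i, (i < r)%nat -> w (n + m + i)%nat = w (n + i)%nat) ->
  forall i, (i < n + m + r)%nat -> w i = perw w n m i.
Proof.
  intros Hm H i. induction i as [i IH] using lt_wf_ind. intros Hi.
  destruct (Nat.lt_ge_cases i (n + m)) as [H1|H1]; [symmetry; now apply perw_low|].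
  replace i with (n + m + (i - n - m))%nat at 1 by lia. rewrite H by lia.
  replace i with (n + (i - n - m) + m)%nat at 2 by lia.
  rewrite (perw_periodic w n m Hm) by lia. apply IH; lia.
Qed.

Lemma Xs_nonzero F t L l B f v : Xs F t L l B f v <> 0 ->
  exists b, (b < B)%nat /\ gcount F t L f (firstn l (skipn (b * l) v)) <> 0.
Proof.
  revert v. induction B as [|B IH]; intros v H; simpl in H; [lra|].
  destruct (Req_EM_T (gcount F t L f (firstn l v)) 0) as [E|E].
  - destruct (IH (skipn l v)) as [b [Hb H']]; [lra|]. exists (S b). split; [lia|].
    rewrite skipn_skipn in H'. simpl. now rewrite Nat.add_comm.
  - exists 0%nat. split; [lia|exact E].
Qed.

Section Stages.
Context (F : IFS) (lo hi s : R).
Context (HN : (2 <= ifsN F)%nat).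
Context (Hp : forall a, (a < ifsN F)%nat -> ifsp F a = 1%Z \/ ifsp F a = (-1)%Z).
Context (Hq : forall a, (a < ifsN F)%nat -> (2 <= ifsq F a)%nat).
Context (Hlh : lo <= hi).
Context (Hin : forall a x, (a < ifsN F)%nat -> in_I lo hi x -> in_I lo hi (u F a x)).

Lemma hit_approx w T t L l B : valid_word F w -> 0 < t <= 2 ^ l ->
  stage_count F t L l B (pre (shiftw T w) (L + l + B * l)) <> 0 ->
  exists n m, (1 <= m)%nat /\ (L <= n + m <= T + (L + l + B * l))%nat /\
    Rabs (pt F w - pt F (perw w n m)) <= (hi - lo) / (Qp F w (n + m) * t).
Proof.
  intros Hw Ht H. unfold stage_count in H.
  rewrite firstn_pre, skipn_pre in H by lia.
  replace (L + l + B * l - (L + l))%nat with (B * l)%nat in H by lia.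
  apply Xs_nonzero in H. destruct H as [b [Hb H]].
  assert (Hbl : (b * l + l <= B * l)%nat) by nia.
  rewrite skipn_pre, firstn_pre in H by lia.
  unfold gcount in H. apply rsum_pos_ex in H. destruct H as [i [Hi H]].
  set (w' := shiftw (b * l) (shiftw (L + l) (shiftw T w))) in *.
  assert (Hw' : valid_word F w') by (repeat apply valid_shift; exact Hw).
  assert (Hz : validl F (pre w' l)) by now apply pre_valid.
  pose proof (cut_prefix F t (pre w' l)) as Hpz.
  assert (Hqc : t <= qw F (cut F t (pre w' l)))
    by (apply cut_qw_ge; [exact Hq|exact Hz|rewrite pre_length; exact Ht]).
  set (c := cut F t (pre w' l)) in *.
  destruct (prefixb c (skipn i (pre (shiftw T w) (L + l)))) eqn:Ep; [|simpl in H; lra].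
  rewrite skipn_pre in Ep. apply prefixb_pre in Ep. apply prefixb_pre in Hpz.
  (* The preperiod ends where the cut block occurs in the text, and the period is the distance from
     there to block [b]; it is positive because [i < L]. Agreement with the periodic word then
     extends over the whole cut block, whose denominator is at least [t]. *)
  exists (T + i)%nat, (L + l + b * l - i)%nat.
  replace (T + i + (L + l + b * l - i))%nat with (T + (L + l + b * l))%nat by lia.
  assert (Hm : (1 <= L + l + b * l - i)%nat) by (destruct L; lia).
  split; [exact Hm|split; [lia|]].
  assert (Hag : forall k, (k < length c)%nat ->
    w (T + i + (L + l + b * l - i) + k)%nat = w (T + i + k)%nat).
  { intros k Hk. assert (E := pre_eq w' _ _ (eq_trans (eq_sym Hpz) Ep) k Hk).
    unfold w', shiftw in E.
    replace (T + i + (L + l + b * l - i) + k)%nat with (T + (L + l + (b * l + k)))%nat by lia.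
    replace (T + i + k)%nat with (T + (i + k))%nat by lia. exact E. }
  eapply Rle_trans.
  - apply (pt_close F lo hi HN Hp Hq Hlh Hin w _ (T + (L + l + b * l) + length c));
      [exact Hw|now apply perw_valid|].
    intros k Hk. apply (perw_agree w _ _ (length c) Hm Hag). lia.
  - unfold Rdiv. apply Rmult_le_compat_l; [lra|].
    pose proof (Qp_pos F Hq w (T + (L + l + b * l)) Hw).
    apply Rinv_le_contravar; [apply Rmult_lt_0_compat; lra|].
    rewrite (Qp_app F w (T + (L + l + b * l)) (length c)). apply Rmult_le_compat_l; [lra|].
    eapply Rle_trans; [exact Hqc|]. rewrite Hpz at 1. rewrite qw_pre. right.
    apply Qp_ext. intros k _. unfold w', shiftw. f_equal. lia.
Qed.

Context (Hs : 0 < s) (HW : moran F s = 1).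
Context (t : nat -> R) (L l B : nat -> nat).

Definition stage_len (j : nat) : nat := (L j + l j + B j * l j)%nat.

Definition stage_start (j : nat) : nat := nsum j stage_len.

Definition stage_nohit (j : nat) (v : list nat) : R := nohit F (t j) (L j) (l j) (B j) v.

Notation len := stage_len.
Notation T := stage_start.
Notation nh := stage_nohit.

Definition no_hits (J k : nat) (v : list nat) : R :=
  rprod k (fun i => nh (J + i)%nat (firstn (len (J + i)%nat) (skipn (T (J + i)%nat) v))).

Lemma no_hits_01 J k v : no_hits J k v = 0 \/ no_hits J k v = 1.
Proof. apply rprod_01. intros i. unfold stage_nohit, nohit. destruct (Req_EM_T _ _); tauto. Qed.

(** Independence of stages: the last stage reads letters beyond position [T (J + k)], the earlier
    factors only letters before it, so the expectation factors at that position. *)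
Lemma E_no_hits p J k :
  (forall j, 0 <= p j <= 1) -> (forall j, Ex F s (len j) (nh j) <= 1 - p j) ->
  Ex F s (T (J + k)%nat) (no_hits J k) <= rprod k (fun i => 1 - p (J + i)%nat).
Proof.
  intros Hp01 HE. induction k as [|k IH].
  - unfold no_hits. simpl. rewrite (E_const F s HW). lra.
  - rewrite Nat.add_succ_r. change (T (S (J + k))) with (T (J + k)%nat + len (J + k)%nat)%nat.
    rewrite E_app.
    rewrite (E_ext F s _ _ (fun u => Ex F s (len (J + k)%nat) (nh (J + k)%nat) * no_hits J k u)).
    + rewrite E_scal. simpl rprod. rewrite Rmult_comm.
      apply Rmult_le_compat; [| |exact IH|apply HE].
      * rewrite <- (E_zero F s HW (T (J + k)%nat)). apply E_le. intros v _ _.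
        destruct (no_hits_01 J k v); lra.
      * rewrite <- (E_zero F s HW (len (J + k)%nat)). apply E_le. intros v _ _.
        apply nohit_range.
    + intros v Hv _. rewrite Rmult_comm, <- E_scal. apply E_ext. intros v' Hv' _.
      unfold no_hits. simpl rprod. f_equal.
      * apply rprod_ext. intros i Hi. cbv beta. f_equal. apply firstn_skipn_app. rewrite Hv.
        change (T (S (J + i)) <= T (J + k))%nat. apply nsum_mono. lia.
      * f_equal. rewrite <- Hv, skipn_app_exact. apply firstn_all2. rewrite Hv'. apply le_n.
Qed.

(** The cover consists of the cylinders of generation [T (J + k)] without a hit. Multiplying a
    diameter bound by the 0-1 valued [no_hits] discards the other cylinders and makes the cost
    [D ^ s] times an expectation. *)
Lemma no_hits_null J :
  (forall e, 0 < e -> exists k, Ex F s (T (J + k)%nat) (no_hits J k) <= e) ->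
  H_null s (fun x => exists w, valid_word F w /\ x = pt F w /\
     forall j, (J <= j)%nat -> nh j (pre (shiftw (T j) w) (len j)) = 1).
Proof.
  intros H. apply H_null_lists; [exact Hs|]. intros eps Heps.
  (* The summand 1 gives [D > 0] without a separate argument that [lo < hi]. *)
  set (D := hi - lo + 1). assert (HD : 0 < D) by (unfold D; lra).
  pose proof (Rpower_pos D s) as HDs.
  destruct (H (eps / Rpower D s)) as [k Hk]; [apply Rdiv_lt_0_compat; lra|].
  set (n := T (J + k)%nat) in *.
  exists (fun i => match i with O =>
     map (fun v => ((fun x => no_hits J k v = 1 /\ exists w, valid_word F w /\
            pre w n = v /\ x = pt F w), no_hits J k v * (D / qw F v))) (words (ifsN F) n)
     | _ => [] end). split; [|split].
  - intros x [w [Hw [Hx Hnh]]]. exists 0%nat. eexists. split.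
    + apply in_map_iff. exists (pre w n). split; [reflexivity|].
      apply in_words. split; [apply pre_length|now apply pre_valid].
    + simpl. split; [|now exists w]. apply rprod_1. intros i Hi. cbv beta.
      rewrite skipn_pre, firstn_pre; [apply Hnh; lia|].
      assert (T (S (J + i)) <= n)%nat by (apply nsum_mono; lia). unfold stage_start in *. simpl in H0. lia.
  - intros [|i] e He; [|destruct He]. apply in_map_iff in He. destruct He as [v [<- Hv]].
    apply in_words in Hv. destruct Hv as [_ Hv]. simpl.
    assert (0 < D / qw F v) by (apply Rdiv_lt_0_compat; [lra|now apply qw_pos]).
    split; [destruct (no_hits_01 J k v) as [E|E]; rewrite E; lra|].
    intros x y [H1 [w [Hw [Ew Hx]]]] [_ [w' [Hw' [Ew' Hy]]]]. rewrite H1, Rmult_1_l, Hx, Hy.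
    eapply Rle_trans; [apply (pt_close F lo hi HN Hp Hq Hlh Hin w w' n Hw Hw')|].
    + apply pre_eq. congruence.
    + rewrite <- Ew, qw_pre. unfold Rdiv. apply Rmult_le_compat_r; [|unfold D; lra].
      left. apply Rinv_0_lt_compat. now apply Qp_pos.
  - intros m. apply Rle_trans with (lsum (fun v => Rpower D s * (wt F s v * no_hits J k v))
      (words (ifsN F) n)).
    + destruct m as [|m]; [simpl; apply lsum_nonneg; intros v _|].
      { apply Rmult_le_pos; [lra|]. apply Rmult_le_pos; [left; apply wt_pos|].
        destruct (no_hits_01 J k v); lra. }
      rewrite rsum_S_l. rewrite (rsum_ext m _ (fun _ => 0)) by reflexivity.
      rewrite rsum_const, lsum_map, Rmult_0_r, Rplus_0_r. apply lsum_le. intros v Hv.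
      apply in_words in Hv. destruct Hv as [_ Hv]. simpl.
      assert (Hqv : 0 < qw F v) by now apply qw_pos.
      destruct (no_hits_01 J k v) as [E|E]; rewrite E.
      * rewrite Rmult_0_l, rpow_0. lra.
      * rewrite Rmult_1_l, rpow_pos_eq by (now apply Rdiv_lt_0_compat).
        rewrite (wt_qw F s Hq) by exact Hv. right. rewrite Rmult_1_r. unfold Rpower.
        rewrite <- exp_plus. f_equal. unfold Rdiv.
        rewrite ln_mult, ln_Rinv by (try apply Rinv_0_lt_compat; assumption). ring.
    + rewrite lsum_scal, lsum_words_E. apply Rmult_le_reg_l with (/ Rpower D s);
        [now apply Rinv_0_lt_compat|].
      rewrite <- Rmult_assoc, Rinv_l, Rmult_1_l by lra. unfold Rdiv in Hk. lra.
Qed.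

End Stages.

(** * Choice of the parameters of the stages *)

(** [exp y] is the cube of [exp (y / 3) >= y / 3]. Cubic decay is enough: at [y] proportional to
    [2 ^ j] it beats the factor [4 ^ j] with [(/ 2) ^ j] to spare. *)
Lemma exp_neg_cube y : 0 < y -> exp (- y) <= 27 / (y * y * y).
Proof.
  intros Hy. assert (H : y * y * y / 27 <= exp y).
  { replace (exp y) with (exp (y / 3) * exp (y / 3) * exp (y / 3))
      by (rewrite <- !exp_plus; f_equal; field).
    pose proof (exp_ineq1_le (y / 3)). assert (H1 : 0 <= y / 3 <= exp (y / 3)) by lra.
    replace (y * y * y / 27) with (y / 3 * (y / 3) * (y / 3)) by field.
    apply Rmult_le_compat; try lra; [nra|apply Rmult_le_compat; lra]. }
  assert (0 < y * y * y) by (repeat apply Rmult_lt_0_compat; exact Hy).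
  rewrite exp_Ropp. replace (27 / (y * y * y)) with (/ (y * y * y / 27)) by (field; lra).
  apply Rinv_le_contravar; lra.
Qed.

Lemma rsum_pow_half n : rsum n (fun j => (/ 2) ^ j) <= 2.
Proof.
  assert (H : rsum n (fun j => (/ 2) ^ j) = 2 * (1 - (/ 2) ^ n)).
  { induction n as [|n IH]; simpl; [ring|]. rewrite IH. field. }
  rewrite H. assert (0 < (/ 2) ^ n) by (apply pow_lt; lra). lra.
Qed.

Lemma log2_ceil t : 1 <= t -> exists l : nat,
  (1 <= l)%nat /\ t <= 2 ^ l /\ INR l <= ln t / ln 2 + 1.
Proof.
  intros Ht. pose proof ln_lt_2 as Hl2.
  assert (H0 : 0 <= ln t / ln 2).
  { apply Rmult_le_pos; [|left; apply Rinv_0_lt_compat; lra].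
    rewrite <- ln_1. apply ln_le_compat; lra. }
  destruct (archimed (ln t / ln 2)) as [H1 H2].
  assert (Hu : (1 <= up (ln t / ln 2))%Z).
  { apply (Zlt_le_succ 0). apply lt_IZR. lra. }
  exists (Z.to_nat (up (ln t / ln 2))).
  assert (HI : INR (Z.to_nat (up (ln t / ln 2))) = IZR (up (ln t / ln 2))).
  { rewrite INR_IZR_INZ, Z2Nat.id by lia. reflexivity. }
  split; [lia|split; [|lra]].
  rewrite <- Rpower_pow by lra. rewrite HI.
  replace t with (exp (ln t)) at 1 by (apply exp_ln; lra). unfold Rpower.
  apply exp_le_compat. replace (ln t) with (ln t / ln 2 * ln 2) at 1 by (field; lra). nra.
Qed.

Lemma div_ge_half a l : (1 <= l <= a)%nat -> INR a / (2 * INR l) <= INR (a / l).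
Proof.
  intros H. assert (Hl : 1 <= INR l) by (change 1 with (INR 1); apply le_INR; lia).
  apply Rmult_le_reg_r with (2 * INR l); [lra|].
  replace (INR a / (2 * INR l) * (2 * INR l)) with (INR a) by (field; lra).
  change 2 with (INR 2). rewrite <- !mult_INR. apply le_INR.
  pose proof (Nat.div_mod_eq a l). pose proof (Nat.mod_upper_bound a l).
  assert (1 <= a / l)%nat by (apply Nat.div_le_lower_bound; lia). nia.
Qed.

(** The block length [l] is about the binary logarithm of [A / Psi j], so that a cut always reaches
    its threshold, and [B] is [2 ^ j / l]. If [l] exceeds [2 ^ j] the stage is left empty: then
    [Psi j] is exponentially small in [2 ^ j], and such indices contribute only a convergent part of
    the given series. *)
Lemma choose_stages delta A lam (Psi : nat -> R) :
  0 < delta -> 1 <= A -> 0 < lam ->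
  (forall j, 0 < Psi j /\ lam <= - ln (Psi j)) ->
  (forall M, exists n, M <= rsum n (fun j => 4 ^ j * (Rpower (Psi j) delta / - ln (Psi j)))) ->
  exists L l B : nat -> nat,
    (forall j, (L j = 0%nat /\ l j = 0%nat /\ B j = 0%nat) \/
       (L j = (2 ^ j)%nat /\ 1 <= A / Psi j <= 2 ^ (l j))) /\
    (forall j, (stage_len L l B j <= 3 * 2 ^ j)%nat) /\
    (forall M, exists n, M <= rsum n (fun j =>
       INR (L j) * INR (B j) * Rpower (A / Psi j) (- delta))).
Proof.
  intros Hd HA Hlam HPsi Hdiv. pose proof ln_lt_2 as Hl2.
  assert (HPsi1 : forall j, Psi j < 1).
  { intros j. destruct (HPsi j) as [H1 H2]. apply Rnot_le_lt. intros H.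
    pose proof (ln_le_compat 1 _ ltac:(lra) H). rewrite ln_1 in H0. lra. }
  assert (Ht : forall j, 1 <= A / Psi j).
  { intros j. destruct (HPsi j) as [H1 _]. specialize (HPsi1 j).
    apply Rmult_le_reg_r with (Psi j); [lra|]. unfold Rdiv.
    rewrite Rmult_assoc, Rinv_l; lra. }
  assert (HlnA : 0 <= ln A) by (rewrite <- ln_1; apply ln_le_compat; lra).
  (* Since [- ln (Psi j) >= lam], the additive constants [ln A] and 1 in the bound for [l] are
     absorbed into multiples of [- ln (Psi j)]. *)
  set (C1 := (ln A / lam + 1) / ln 2 + / lam).
  assert (Hil : 0 < / lam) by now apply Rinv_0_lt_compat.
  assert (HC1 : 0 < C1).
  { unfold C1. apply Rplus_le_lt_0_compat; [|exact Hil].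
    unfold Rdiv. apply Rmult_le_pos; [nra|left; apply Rinv_0_lt_compat; lra]. }
  assert (Hl : forall j, exists l : nat, (1 <= l)%nat /\ A / Psi j <= 2 ^ l /\
     INR l <= C1 * - ln (Psi j)).
  { intros j. destruct (log2_ceil _ (Ht j)) as [l [H1 [H2 H3]]]. exists l.
    split; [exact H1|split; [exact H2|]]. eapply Rle_trans; [exact H3|].
    destruct (HPsi j) as [HP HL]. unfold Rdiv at 2.
    rewrite ln_mult, ln_Rinv by (try apply Rinv_0_lt_compat; lra).
    set (y := - ln (Psi j)) in *. unfold C1.
    assert (HAy : ln A <= ln A / lam * y).
    { unfold Rdiv. rewrite Rmult_assoc. rewrite <- (Rmult_1_r (ln A)) at 1.
      apply Rmult_le_compat_l; [exact HlnA|]. apply Rmult_le_reg_l with lam; [exact Hlam|].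
      rewrite <- Rmult_assoc, Rinv_r by lra. lra. }
    assert (H1y : 1 <= / lam * y).
    { apply Rmult_le_reg_l with lam; [exact Hlam|].
      rewrite <- Rmult_assoc, Rinv_r by lra. lra. }
    assert (Hi2 : 0 < / ln 2) by (apply Rinv_0_lt_compat; lra).
    apply Rle_trans with ((ln A / lam * y + y) * / ln 2 + / lam * y); [|right; unfold Rdiv; ring].
    apply Rplus_le_compat; [|exact H1y]. apply Rmult_le_compat_r; lra. }
  set (l0 := fun j => proj1_sig (constructive_indefinite_description _ (Hl j))).
  assert (Hl0 : forall j, (1 <= l0 j)%nat /\ A / Psi j <= 2 ^ l0 j /\
     INR (l0 j) <= C1 * - ln (Psi j))
    by exact (fun j => proj2_sig (constructive_indefinite_description _ (Hl j))).
  clearbody l0.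
  set (good := fun j => Nat.leb (l0 j) (2 ^ j)).
  exists (fun j => if good j then (2 ^ j)%nat else 0%nat),
    (fun j => if good j then l0 j else 0%nat),
    (fun j => if good j then (2 ^ j / l0 j)%nat else 0%nat).
  split; [|split].
  - intros j. destruct (good j); [right|now left]. split; [reflexivity|].
    split; [apply Ht|apply (Hl0 j)].
  - intros j. unfold stage_len, good. destruct (Nat.leb_spec (l0 j) (2 ^ j)) as [H|H]; [|lia].
    pose proof (Nat.Div0.mul_div_le (2 ^ j) (l0 j)). nia.
  (* [Rpower A (- delta)] comes from the threshold, [C1] from the block length, and 2 from rounding
     down in [2 ^ j / l]. *)
  - set (C2 := Rpower A (- delta) / (2 * C1)).
    assert (HC2 : 0 < C2) by (apply Rdiv_lt_0_compat; [apply Rpower_pos|lra]).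
    (* An empty stage has [- ln (Psi j) >= 2 ^ j / C1]; [exp_neg_cube] at [delta * (2 ^ j / C1)]
       then bounds its term by [C3 * (/ 2) ^ j]. *)
    set (C3 := 27 * (C1 * C1 * C1) / (delta * delta * delta) / lam).
    assert (HC3 : 0 <= C3).
    { assert (0 < delta * delta * delta) by (repeat apply Rmult_lt_0_compat; exact Hd).
      assert (0 < C1 * C1 * C1) by (repeat apply Rmult_lt_0_compat; exact HC1).
      unfold C3, Rdiv. left. repeat apply Rmult_lt_0_compat; try lra;
      apply Rinv_0_lt_compat; lra. }
    match goal with |- forall M, exists n, M <= rsum n ?f => set (mu := f) end.
    assert (Hmu0 : forall j, 0 <= mu j).
    { intros j. unfold mu. repeat apply Rmult_le_pos; try apply pos_INR.
      left; apply Rpower_pos. }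
    assert (Key : forall j, 4 ^ j * (Rpower (Psi j) delta / - ln (Psi j))
       <= / C2 * mu j + C3 * (/ 2) ^ j).
    { intros j. destruct (HPsi j) as [HP HL]. destruct (Hl0 j) as [H1 [H2 H3]].
      assert (H2j : INR (2 ^ j) = 2 ^ j) by (rewrite pow_INR; reflexivity).
      assert (H4j : 4 ^ j = 2 ^ j * 2 ^ j) by (rewrite <- Rpow_mult_distr; f_equal; lra).
      assert (Hpj : 0 < 2 ^ j) by (apply pow_lt; lra).
      assert (Hhalf : 0 < (/ 2) ^ j) by (apply pow_lt; lra).
      set (y := - ln (Psi j)) in *.
      assert (Hy : 0 < y) by lra.
      unfold mu, good. destruct (Nat.leb_spec (l0 j) (2 ^ j)) as [Hg|Hg]; cbv beta iota.
      - apply Rle_trans with (/ C2 * (INR (2 ^ j) * INR (2 ^ j / l0 j) *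
            Rpower (A / Psi j) (- delta)));
          [|assert (0 <= C3 * (/ 2) ^ j) by (apply Rmult_le_pos; lra); lra].
        assert (HR : Rpower (A / Psi j) (- delta) = Rpower A (- delta) * Rpower (Psi j) delta).
        { unfold Rpower, Rdiv. rewrite <- exp_plus.
          rewrite ln_mult, ln_Rinv by (try apply Rinv_0_lt_compat; lra). f_equal. ring. }
        rewrite HR. pose proof (div_ge_half (2 ^ j) (l0 j) (conj H1 Hg)) as Hdh.
        rewrite H2j in *.
        assert (Hlp : 1 <= INR (l0 j)) by (change 1 with (INR 1); apply le_INR; exact H1).
        assert (Hb : 2 ^ j / (2 * (C1 * y)) <= INR (2 ^ j / l0 j)).
        { eapply Rle_trans; [|exact Hdh]. unfold Rdiv. apply Rmult_le_compat_l; [lra|].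
          apply Rinv_le_contravar; lra. }
        pose proof (Rpower_pos A (- delta)) as HPA. pose proof (Rpower_pos (Psi j) delta) as HPP.
        set (pa := Rpower A (- delta)) in *. set (pp := Rpower (Psi j) delta) in *.
        apply Rle_trans with (/ C2 * (2 ^ j * (2 ^ j / (2 * (C1 * y))) * (pa * pp))).
        + right. unfold C2. rewrite H4j. field. repeat split; lra.
        + apply Rmult_le_compat_l; [left; now apply Rinv_0_lt_compat|].
          apply Rmult_le_compat_r; [nra|]. apply Rmult_le_compat_l; [lra|exact Hb].
      - simpl INR. rewrite !Rmult_0_l, Rmult_0_r, Rplus_0_l.
        assert (Hyj : 2 ^ j <= C1 * y).
        { rewrite <- H2j. eapply Rle_trans; [|exact H3]. apply le_INR. lia. }
        assert (Hyj' : 2 ^ j / C1 <= y).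
        { apply Rmult_le_reg_r with C1; [exact HC1|].
          replace (2 ^ j / C1 * C1) with (2 ^ j) by (field; lra). lra. }
        set (x := delta * (2 ^ j / C1)).
        assert (Hx : 0 < x).
        { apply Rmult_lt_0_compat; [exact Hd|now apply Rdiv_lt_0_compat]. }
        assert (HRp : Rpower (Psi j) delta <= exp (- x)).
        { unfold Rpower. apply exp_le_compat. unfold x, y in *. nra. }
        pose proof (exp_neg_cube x Hx) as Hcube.
        assert (Hyl : / y <= / lam) by (apply Rinv_le_contravar; lra).
        assert (0 < / y) by now apply Rinv_0_lt_compat.
        pose proof (Rpower_pos (Psi j) delta).
        apply Rle_trans with (4 ^ j * (27 / (x * x * x) * / lam)).
        + apply Rmult_le_compat_l; [rewrite H4j; nra|].
          unfold Rdiv at 1. apply Rmult_le_compat; lra.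
        + right. rewrite H4j, pow_inv. unfold x, C3. field. repeat split; lra. }
    intros M. destruct (Hdiv (/ C2 * Rabs M + C3 * 2)) as [n Hn]. exists n.
    assert (Hs : rsum n (fun j => 4 ^ j * (Rpower (Psi j) delta / - ln (Psi j)))
       <= / C2 * rsum n mu + C3 * 2).
    { eapply Rle_trans; [apply rsum_le; intros j _; apply Key|].
      rewrite rsum_plus, !rsum_scal. apply Rplus_le_compat_l.
      apply Rmult_le_compat_l; [exact HC3|apply rsum_pow_half]. }
    pose proof (Rle_abs M). assert (0 < / C2) by now apply Rinv_0_lt_compat.
    assert (/ C2 * Rabs M <= / C2 * rsum n mu) by lra.
    apply Rmult_le_reg_l in H1; lra.
Qed.

Lemma nsum_le_geom n f : (forall j, (f j <= 3 * 2 ^ j)%nat) -> (nsum n f <= 3 * 2 ^ n)%nat.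
Proof.
  intros H. induction n as [|n IH]; simpl; [lia|]. specialize (H n). lia.
Qed.

(** * Divergence part *)

Lemma Rpower_le1 a s : 0 <= s -> 1 <= a -> Rpower a (- s) <= 1.
Proof.
  intros Hs Ha. replace 1 with (Rpower 1 (- s)); [apply Rpower_anti; lra|].
  unfold Rpower. rewrite ln_1, Rmult_0_r. apply exp_0.
Qed.

Lemma nat_bounded (f : nat -> nat) N : exists M, forall a, (a < N)%nat -> (f a <= M)%nat.
Proof.
  induction N as [|N [M HM]]; [exists 0%nat; intros; lia|].
  exists (max M (f N)). intros a Ha. destruct (Nat.eq_dec a N) as [->|E]; [lia|].
  specialize (HM a ltac:(lia)). lia.
Qed.

Section Divergence.
Context (F : IFS) (lo hi : R).
Context (HN : (2 <= ifsN F)%nat).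
Context (Hp : forall a, (a < ifsN F)%nat -> ifsp F a = 1%Z \/ ifsp F a = (-1)%Z).
Context (Hq : forall a, (a < ifsN F)%nat -> (2 <= ifsq F a)%nat).
Context (Hlh : lo <= hi).
Context (Hin : forall a x, (a < ifsN F)%nat -> in_I lo hi x -> in_I lo hi (u F a x)).

(** In the doubly exponential scale, passing from a number of letters of order [2 ^ j] to the
    denominator they form is a mere shift of [j]. *)
Lemma log_q_bounded : exists c, forall a, (a < ifsN F)%nat -> (ifsq F a <= 2 ^ (2 ^ c))%nat.
Proof.
  destruct (nat_bounded (ifsq F) (ifsN F)) as [M HM]. exists M. intros a Ha.
  specialize (HM a Ha). pose proof (Nat.pow_gt_lin_r 2 M ltac:(lia)).
  pose proof (Nat.pow_gt_lin_r 2 (2 ^ M) ltac:(lia)). lia.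
Qed.

Lemma Qp_le_pow c w n : valid_word F w ->
  (forall a, (a < ifsN F)%nat -> (ifsq F a <= 2 ^ (2 ^ c))%nat) ->
  Qp F w n <= 2 ^ (2 ^ c * n)%nat.
Proof.
  intros Hw Hc. induction n as [|n IH]; simpl; [rewrite Nat.mul_0_r; simpl; lra|].
  rewrite Nat.mul_succ_r, pow_add. pose proof (Qp_pos F Hq w n Hw).
  apply Rmult_le_compat; [lra|apply pos_INR|exact IH|].
  eapply Rle_trans; [apply le_INR, Hc, Hw|]. rewrite pow_INR.
  replace (INR 2) with 2 by (simpl; lra). lra.
Qed.

(** Second Borel-Cantelli lemma: the probability of missing all stages up to [k] is at most [exp] of
    minus the sum of the hit bounds [p], and this sum diverges by [sum_saturate]. Empty stages have
    [mu = 0] and [p = 0]. *)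
Lemma stages_null s t L l B J : 0 < s -> moran F s = 1 ->
  (forall j, (L j = 0%nat /\ l j = 0%nat /\ B j = 0%nat) \/
     (L j = (2 ^ j)%nat /\ 1 <= t j <= 2 ^ (l j))) ->
  (forall M, exists n, M <= rsum n (fun j => INR (L j) * INR (B j) * Rpower (t j) (- s))) ->
  H_null s (fun x => exists w, valid_word F w /\ x = pt F w /\
    forall j, (J <= j)%nat -> stage_nohit F t L l B j
      (pre (shiftw (stage_start L l B j) w) (stage_len L l B j)) = 1).
Proof.
  intros Hs HW Hst Hdiv. apply (no_hits_null F lo hi); try assumption.
  destruct (nat_bounded (ifsq F) (ifsN F)) as [M0 HM0].
  set (Qm := 1 + INR M0). pose proof (pos_INR M0).
  assert (HQ1 : 1 <= Qm) by (unfold Qm; lra).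
  assert (HQm : forall a, (a < ifsN F)%nat -> INR (ifsq F a) <= Qm).
  { intros a Ha. specialize (HM0 a Ha). apply le_INR in HM0. unfold Qm. lra. }
  set (mu := fun j => INR (L j) * INR (B j) * Rpower (t j) (- s)) in *.
  assert (Hmu : forall j, 0 <= mu j).
  { intros j. unfold mu. repeat apply Rmult_le_pos; try apply pos_INR. left; apply Rpower_pos. }
  set (c := Rpower Qm (- s)). assert (Hc : 0 < c) by apply Rpower_pos.
  assert (Hc1 : c <= 1) by (apply Rpower_le1; lra).
  set (K := 2 / (1 - Rpower 2 (- s))).
  assert (HK : 0 < K).
  { pose proof (theta_lt1 s Hs). apply Rdiv_lt_0_compat; lra. }
  set (p := fun j => c * c * (mu j / (2 * mu j + K))).
  assert (Hsat : forall j, 0 <= mu j / (2 * mu j + K) <= 1).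
  { intros j. specialize (Hmu j). split.
    - apply Rmult_le_pos; [lra|left; apply Rinv_0_lt_compat; lra].
    - apply Rmult_le_reg_r with (2 * mu j + K); [lra|].
      unfold Rdiv. rewrite Rmult_assoc, Rinv_l; lra. }
  assert (Hp01 : forall j, 0 <= p j <= 1).
  { intros j. specialize (Hsat j). assert (0 <= c * c <= 1) by nra. unfold p. nra. }
  assert (HE : forall j, Ex F s (stage_len L l B j) (stage_nohit F t L l B j) <= 1 - p j).
  { intros j. destruct (Hst j) as [[E1 [E2 E3]]|[E1 E2]].
    - assert (Emu : mu j = 0) by (unfold mu; rewrite E1; simpl; ring).
      unfold p. rewrite Emu. unfold Rdiv. rewrite Rmult_0_l, Rmult_0_r, Rminus_0_r.
      rewrite <- (E_const F s HW (stage_len L l B j) 1). apply E_le. intros v _ _.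
      apply nohit_range.
    - pose proof (E_nohit_le F s HW Hs HN Hq Qm HQ1 HQm (t j) (L j) (l j) (B j) E2) as H1.
      cbv zeta in H1. fold (mu j) c K in H1. eapply Rle_trans; [exact H1|].
      right. unfold p. unfold Rdiv. ring. }
  intros e He.
  assert (Htail : forall M, exists n, M <= rsum n (fun i => mu (J + i)%nat)).
  { intros M. destruct (Hdiv (rsum J mu + M)) as [n Hn]. exists n.
    assert (H1 : rsum n mu <= rsum (J + n) mu) by (apply rsum_le_len; [lia|exact Hmu]).
    rewrite rsum_app in H1. lra. }
  destruct (sum_saturate K (fun i => mu (J + i)%nat) HK (fun i => Hmu _) Htail
    (- ln e / (c * c))) as [k Hk].
  exists k. eapply Rle_trans; [exact (E_no_hits F s HN HW t L l B p J k Hp01 HE)|].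
  eapply Rle_trans; [apply (rprod_le_exp k (fun i => p (J + i)%nat))|].
  - intros i. specialize (Hp01 (J + i)%nat). lra.
  - rewrite <- (exp_ln e He). apply exp_le_compat. unfold p. rewrite rsum_scal.
    assert (Hcc : 0 < c * c) by nra.
    assert (- ln e <= c * c * rsum k (fun i => mu (J + i)%nat / (2 * mu (J + i)%nat + K))).
    { apply Rmult_le_reg_l with (/ (c * c)); [now apply Rinv_0_lt_compat|].
      rewrite <- Rmult_assoc, Rinv_l, Rmult_1_l by lra. unfold Rdiv in Hk. lra. }
    lra.
Qed.

(** Suppose [x] is badly approximable with constant [eps] and not eventually periodic. With
    [r > / eps], a hit with threshold [A r / Psi j] in a late stage would give a rational closer
    than [eps] permits, so all late stages miss. The exceptional set is thus a countable union over
    [r] and [J] of the null sets of [stages_null]. *)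
Lemma well_ae delta (psi : R -> R) q0 :
  0 < delta -> moran F delta = 1 ->
  (forall q, q0 <= q -> 0 < psi q) ->
  (forall x y, q0 <= x -> x <= y -> psi y <= psi x) ->
  (forall q, q0 <= q -> psi q < 1) ->
  (forall j0 M, exists n, M <= rsum n (fun i => 4 ^ (j0 + i) *
     (Rpower (psi (2 ^ (2 ^ (j0 + i))%nat)) delta / - ln (psi (2 ^ (2 ^ (j0 + i))%nat))))) ->
  mu_ae F delta (symb_well_approx F psi).
Proof.
  intros Hd HW Hpos Hdec Hlt1 Hdiv. unfold mu_ae.
  destruct log_q_bounded as [c1 Hc1].
  destruct (INR_archimed 1 (Rabs q0) ltac:(lra)) as [k2 Hk2].
  set (k1 := S k2).
  assert (Hq0 : forall k, (k1 <= k)%nat -> q0 <= 2 ^ k / 2 /\ q0 <= 2 ^ k).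
  { intros k Hk. assert (H1 : 2 ^ k1 <= 2 ^ k) by (apply Rle_pow; [lra|exact Hk]).
    unfold k1 in H1. simpl in H1. pose proof (pow2_gt k2). pose proof (Rle_abs q0).
    pose proof (Rabs_pos q0). lra. }
  (* [c1] converts letters to denominators; 4 stands for a factor 16, as [n + m <= 8 * 2 ^ j]
     letters occur and [q_int] exceeds their denominator at most twofold; [k1] moves beyond [q0]. *)
  set (c := (c1 + 4 + k1)%nat).
  set (Psi := fun j => psi (2 ^ (2 ^ (j + c))%nat)).
  assert (Hge : forall j, q0 <= 2 ^ (2 ^ (j + c))%nat).
  { intros j. apply Hq0. pose proof (Nat.pow_gt_lin_r 2 (j + c) ltac:(lia)). unfold c in *. lia. }
  set (lam := - ln (Psi 0%nat)).
  assert (HPsi0 : 0 < Psi 0%nat < 1) by (split; [apply Hpos|apply Hlt1]; apply Hge).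
  assert (Hlam : 0 < lam).
  { unfold lam. pose proof (ln_increasing (Psi 0%nat) 1). rewrite ln_1 in H. lra. }
  assert (HPsi : forall j, 0 < Psi j /\ lam <= - ln (Psi j)).
  { intros j. assert (H1 : 0 < Psi j) by apply Hpos, Hge. split; [exact H1|].
    unfold lam. apply Ropp_le_contravar, ln_le_compat; [exact H1|].
    apply Hdec; [apply Hge|]. apply Rle_pow; [lra|]. apply Nat.pow_le_mono_r; lia. }
  assert (HdivPsi : forall M, exists n, M <= rsum n (fun j =>
     4 ^ j * (Rpower (Psi j) delta / - ln (Psi j)))).
  { intros M. destruct (Hdiv c (4 ^ c * M)) as [n Hn]. exists n.
    rewrite (rsum_ext n _ (fun j => 4 ^ c * (4 ^ j * (Rpower (Psi j) delta / - ln (Psi j))))) in Hn.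
    - rewrite rsum_scal in Hn. apply Rmult_le_reg_l in Hn; [exact Hn|apply pow_lt; lra].
    - intros i _. unfold Psi. rewrite pow_add, (Nat.add_comm c i). ring. }
  (* Here 2 compensates [q_int <= 2 Qp], [hi - lo] is the size of the interval, and [INR (S r)]
     exceeds [/ eps] for the [r] selected below; the final 1 ensures [1 <= A r]. *)
  set (A := fun r => 2 * (hi - lo) * INR (S r) + 1).
  assert (HA : forall r, 1 <= A r).
  { intros r. unfold A. pose proof (pos_INR (S r)). nra. }
  assert (Hch : forall r, exists p : (nat -> nat) * (nat -> nat) * (nat -> nat),
    let '(L, l, B) := p in
    (forall j, (L j = 0%nat /\ l j = 0%nat /\ B j = 0%nat) \/
       (L j = (2 ^ j)%nat /\ 1 <= A r / Psi j <= 2 ^ (l j))) /\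
    (forall j, (stage_len L l B j <= 3 * 2 ^ j)%nat) /\
    (forall M, exists n, M <= rsum n (fun j =>
       INR (L j) * INR (B j) * Rpower (A r / Psi j) (- delta)))).
  { intros r. destruct (choose_stages delta (A r) lam Psi Hd (HA r) Hlam HPsi HdivPsi)
      as [L [l [B H]]]. now exists (L, l, B). }
  set (ch := fun r => proj1_sig (constructive_indefinite_description _ (Hch r))).
  assert (HchP : forall r, let '(L, l, B) := ch r in
    (forall j, (L j = 0%nat /\ l j = 0%nat /\ B j = 0%nat) \/
       (L j = (2 ^ j)%nat /\ 1 <= A r / Psi j <= 2 ^ (l j))) /\
    (forall j, (stage_len L l B j <= 3 * 2 ^ j)%nat) /\
    (forall M, exists n, M <= rsum n (fun j =>
       INR (L j) * INR (B j) * Rpower (A r / Psi j) (- delta))))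
    by exact (fun r => proj2_sig (constructive_indefinite_description _ (Hch r))).
  clearbody ch.
  set (Bad := fun r J x => let '(L, l, B) := ch r in
    exists w, valid_word F w /\ x = pt F w /\
    forall j, (J <= j)%nat -> stage_nohit F (fun j => A r / Psi j) L l B j
      (pre (shiftw (stage_start L l B j) w) (stage_len L l B j)) = 1).
  apply (H_null_union2 delta _ (eventually_periodic_points F)
    (fun x => exists r J, Bad r J x)); [exact Hd| |now apply eventually_periodic_points_null|].
  2:{ apply (H_null_union delta _ (fun r x => exists J, Bad r J x)); [exact Hd| |auto].
      intros r. apply (H_null_union delta _ (fun J x => Bad r J x)); [exact Hd| |auto].
      intros J. unfold Bad. specialize (HchP r). destruct (ch r) as [[L l] B].
      destruct HchP as [H1 [H2 H3]]. now apply stages_null. }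
  intros x [[w [Hw Hcod]] Hnw].
  apply (coding_pt F lo hi HN Hp Hq Hlh Hin) in Hcod; [|exact Hw].
  apply NNPP in Hnw. destruct Hnw as [eps [Heps Hbad]].
  destruct (classic (eventually_periodic_points F x)) as [Hper|Hper]; [now left|right].
  destruct (INR_archimed eps 1 Heps) as [r Hr]. exists r.
  (* Codings of length at least [k1] have [q_int >= q0]. For shorter ones psi is uncontrolled, but
     they stay at distance [kap], whereas a hit at a stage from [J] on is closer than [kap]. *)
  destruct (perpt_separated F HN x k1 Hper) as [kap [Hkap Hsep]].
  destruct (pow2_small (hi - lo) kap Hkap) as [J HJ]. exists J.
  unfold Bad. specialize (HchP r). destruct (ch r) as [[L l] B].
  destruct HchP as [Hst [Hlen _]]. exists w. split; [exact Hw|split; [exact Hcod|]].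
  intros j Hj. unfold stage_nohit, nohit.
  destruct (Req_EM_T _ _) as [E|E]; [reflexivity|exfalso].
  destruct (Hst j) as [[_ [_ E0]]|[EL Ht]]; [rewrite E0 in E; apply E; reflexivity|].
  destruct (hit_approx F lo hi HN Hp Hq Hlh Hin w (stage_start L l B j) (A r / Psi j)
     (L j) (l j) (B j) Hw ltac:(lra) E) as [n [m [Hm [Hnm Hclose]]]].
  assert (Hnm1 : (J <= n + m)%nat).
  { pose proof (Nat.pow_gt_lin_r 2 j ltac:(lia)). lia. }
  assert (Hnm2 : (n + m <= 8 * 2 ^ j)%nat).
  { pose proof (nsum_le_geom (S j) (stage_len L l B) Hlen) as H1.
    unfold stage_start, stage_len in *. simpl in H1. lia. }
  set (wy := perw w n m) in *.
  assert (Hwy : valid_word F wy) by now apply perw_valid.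
  assert (Hpy : periodic_from wy n m) by now apply perw_periodic.
  (* The hit yields some preperiod and period, but [q_int] is taken at the minimal ones. These are
     no larger, so the bound on the denominator persists, and monotonicity gives
     [Psi j <= psi q]. *)
  destruct (min_pre_period_exists wy n m Hm Hpy) as [n0 [m0 [Hmin [Hn0 Hm0]]]].
  assert (Hmin' := Hmin). destruct Hmin' as [Hm01 [Hpy0 _]].
  specialize (Hbad (pt F wy) wy n0 m0
    (pt_periodic_rational F lo hi HN Hp Hq Hlh Hin wy n m Hwy Hm Hpy)
    (pt_limit_set F lo hi HN Hp Hq Hlh Hin wy Hwy) Hwy
    (pt_coding F lo hi HN Hp Hq Hlh Hin wy Hwy) Hmin).
  rewrite <- Hcod in Hclose.
  assert (HQ := Qp_pos F Hq w (n + m) Hw).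
  assert (HQy : Qp F wy (n + m) = Qp F w (n + m))
    by (apply Qp_ext; intros; now apply perw_low).
  pose proof (Qp_ge F Hq w (n + m) Hw) as HQ2.
  destruct (Nat.lt_ge_cases (n0 + m0) k1) as [Hshort|Hlong].
  - specialize (Hsep (pre wy (n0 + m0)) n0 (pre_valid F wy _ Hwy)).
    rewrite pre_length, perpt_pre_periodic in Hsep by assumption.
    specialize (Hsep Hshort ltac:(lia)).
    specialize (HJ (n + m)%nat Hnm1).
    assert ((hi - lo) / (Qp F w (n + m) * (A r / Psi j)) <= (hi - lo) / 2 ^ (n + m)).
    { unfold Rdiv. apply Rmult_le_compat_l; [lra|].
      apply Rinv_le_contravar; [apply pow_lt; lra|]. unfold Rdiv in Ht. nra. }
    lra.
  - set (q := IZR (q_int F wy n0 m0)) in *.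
    destruct (q_int_bounds F HN Hp Hq wy n0 m0 Hwy Hm01) as [Hb1 Hb2]. fold q in Hb1, Hb2.
    pose proof (Qp_ge F Hq wy (n0 + m0) Hwy) as Hg.
    destruct (Hq0 _ Hlong) as [Hq1 _].
    assert (Hqq0 : q0 <= q) by lra.
    assert (Hp2 : 0 < 2 ^ (n0 + m0)) by (apply pow_lt; lra).
    assert (Hqpos : 0 < q) by lra.
    assert (Hq2 : q <= 2 * Qp F w (n + m)).
    { eapply Rle_trans; [exact Hb2|]. rewrite <- HQy.
      apply Rmult_le_compat_l; [lra|]. apply (Qp_mono F HN Hq); [exact Hwy|lia]. }
    assert (Hq3 : q <= 2 ^ (2 ^ (j + c))%nat).
    { eapply Rle_trans; [exact Hq2|]. pose proof (Qp_le_pow c1 w (n + m) Hw Hc1) as H1.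
      apply Rle_trans with (2 ^ S (2 ^ c1 * (n + m))); [simpl; lra|].
      apply Rle_pow; [lra|].
      apply Nat.le_trans with (2 ^ (j + (c1 + 4)))%nat;
        [|apply Nat.pow_le_mono_r; unfold c; lia].
      replace (j + (c1 + 4))%nat with (c1 + (j + 4))%nat by lia.
      rewrite Nat.pow_add_r, (Nat.pow_add_r 2 j 4).
      pose proof (Nat.pow_nonzero 2 c1 ltac:(lia)). pose proof (Nat.pow_nonzero 2 j ltac:(lia)).
      simpl (2 ^ 4)%nat. nia. }
    assert (Hps : Psi j <= psi q) by (apply Hdec; assumption).
    destruct (HPsi j) as [HPj _].
    assert (Hlow : eps * Psi j / (2 * Qp F w (n + m)) <= Rabs (x - pt F wy)).
    { apply Rle_trans with (eps * psi q / q); [|lra].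
      unfold Rdiv. apply Rmult_le_compat; [nra|left; apply Rinv_0_lt_compat; lra|nra|].
      apply Rinv_le_contravar; lra. }
    assert (Hup : (hi - lo) / (Qp F w (n + m) * (A r / Psi j)) < eps * Psi j / (2 * Qp F w (n + m))).
    { specialize (HA r).
      replace ((hi - lo) / (Qp F w (n + m) * (A r / Psi j))) with
        (((hi - lo) / A r) * (Psi j / Qp F w (n + m))) by (field; repeat split; lra).
      replace (eps * Psi j / (2 * Qp F w (n + m))) with
        ((eps / 2) * (Psi j / Qp F w (n + m))) by (field; lra).
      apply Rmult_lt_compat_r; [now apply Rdiv_lt_0_compat|].
      apply Rmult_lt_reg_r with (A r); [lra|].
      replace ((hi - lo) / A r * A r) with (hi - lo) by (field; lra).
      unfold A. rewrite S_INR. pose proof (pos_INR r).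
      assert ((hi - lo) <= (hi - lo) * (INR r * eps)) by nra. nra. }
    lra.
Qed.

End Divergence.

(** * Condensation of series and the logarithmic examples *)

Lemma ln_le_sub1 x : 0 < x -> ln x <= x - 1.
Proof. intros H. pose proof (exp_ineq1_le (ln x)). rewrite exp_ln in H0; lra. Qed.

Lemma series_tail_small a e : series_converges a -> 0 < e ->
  exists N0, forall M n, (N0 <= M)%nat -> rsum n (fun i => a (M + i)%nat) <= e.
Proof.
  intros [Q [l Hl]] He. destruct (Hl (e / 2)) as [N HN]; [lra|].
  exists (Q + S N)%nat. intros M n HM.
  set (k := (M - Q - 1)%nat).
  assert (H1 := HN k ltac:(unfold k; lia)). assert (H2 := HN (k + n)%nat ltac:(unfold k; lia)).
  unfold R_dist in *. rewrite sum_f_R0_rsum in H1, H2.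
  change (S (k + n)) with (S k + n)%nat in H2. rewrite rsum_app in H2.
  apply Rabs_def2 in H1. apply Rabs_def2 in H2.
  rewrite (rsum_ext n _ (fun i => a (S k + i + Q)%nat)); [lra|].
  intros i _. f_equal. unfold k. lia.
Qed.

Lemma series_converges_bounded a Q C :
  (forall i, 0 <= a (Q + i)%nat) -> (forall n, rsum n (fun i => a (Q + i)%nat) <= C) ->
  series_converges a.
Proof.
  intros Hpos HC.
  destruct (growing_cv (sum_f_R0 (fun n => a (n + Q)%nat))) as [l Hl].
  - intros n. simpl. rewrite <- (Nat.add_succ_l n Q), Nat.add_comm. specialize (Hpos (S n)). lra.
  - exists C. intros x [n ->]. rewrite sum_f_R0_rsum.
    rewrite (rsum_ext _ _ (fun i => a (Q + i)%nat)); [apply HC|].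
    intros i _. f_equal. lia.
  - exists Q, l. exact Hl.
Qed.

Lemma rsum_blocks (N : nat -> nat) f n : (forall j, (N j <= N (S j))%nat) ->
  rsum n (fun j => rsum (N (S j) - N j) (fun i => f (N j + i)%nat)) =
  rsum (N n - N 0%nat) (fun i => f (N 0%nat + i)%nat) /\ (N 0%nat <= N n)%nat.
Proof.
  intros HN. induction n as [|n [IH Hle]].
  - rewrite Nat.sub_diag. split; [reflexivity|lia].
  - specialize (HN n). split; [|lia]. simpl. rewrite IH.
    replace (N (S n) - N 0%nat)%nat with ((N n - N 0%nat) + (N (S n) - N n))%nat by lia.
    rewrite rsum_app. f_equal. apply rsum_ext. intros i _. f_equal. lia.
Qed.

Lemma INR_pow2 k : INR (2 ^ k) = 2 ^ k.
Proof. rewrite pow_INR. reflexivity. Qed.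

Lemma ln_pow2 k : ln (2 ^ k) = INR k * ln 2.
Proof. apply ln_pow. lra. Qed.

Lemma pow2_S_sub k : (2 ^ S k - 2 ^ k = 2 ^ k)%nat.
Proof. simpl. lia. Qed.

(** Cauchy condensation on one dyadic block, each term being at least [k ln 2 P / 2 ^ S k]. The 12
    results from [ln 2 > 1/2], [k + 2 <= 3 k] and the factor 2 in [2 ^ S k]. *)
Lemma term1_block delta psi q0 k : 0 < delta -> (1 <= k)%nat -> q0 <= 2 ^ k ->
  (forall q, q0 <= q -> 0 < psi q) ->
  (forall x y, q0 <= x -> x <= y -> psi y <= psi x) ->
  INR (S (S k)) * Rpower (psi (2 ^ S k)) delta <=
  12 * rsum (2 ^ S k - 2 ^ k) (fun i => term1 delta psi (2 ^ k + i)).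
Proof.
  intros Hd Hk Hq0 Hpos Hdec. rewrite pow2_S_sub. pose proof ln_lt_2 as Hl2.
  assert (H2k : 0 < 2 ^ k) by (apply pow_lt; lra).
  assert (Hk1 : 1 <= INR k) by (change 1 with (INR 1); now apply le_INR).
  set (P := Rpower (psi (2 ^ S k)) delta). assert (HP : 0 < P) by apply Rpower_pos.
  apply Rle_trans with (12 * rsum (2 ^ k) (fun _ => INR k * ln 2 * P * / 2 ^ S k)).
  - rewrite rsum_const, INR_pow2. simpl pow.
    replace (12 * (2 ^ k * (INR k * ln 2 * P * / (2 * 2 ^ k)))) with (6 * INR k * ln 2 * P)
      by (field; lra).
    rewrite !S_INR. apply Rmult_le_compat_r; [lra|]. nra.
  - apply Rmult_le_compat_l; [lra|]. apply rsum_le. intros i Hi. unfold term1.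
    rewrite plus_INR, INR_pow2.
    assert (Hi' : 2 ^ k + INR i <= 2 ^ S k).
    { apply lt_INR in Hi. rewrite INR_pow2 in Hi. simpl. lra. }
    pose proof (pos_INR i). set (q := 2 ^ k + INR i) in *.
    assert (Hq : 2 ^ k <= q) by (unfold q; lra).
    unfold Rdiv. apply Rmult_le_compat.
    + apply Rmult_le_pos; [nra|lra].
    + left. apply Rinv_0_lt_compat. lra.
    + apply Rmult_le_compat; [nra|lra| |].
      * rewrite <- ln_pow2. apply ln_le_compat; lra.
      * apply Rpower_le_l; [lra|]. split; [apply Hpos; lra|apply Hdec; lra].
    + apply Rinv_le_contravar; lra.
Qed.

Lemma term1_condensed delta psi q0 : 0 < delta ->
  (forall q, q0 <= q -> 0 < psi q) ->
  (forall x y, q0 <= x -> x <= y -> psi y <= psi x) ->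
  series_converges (term1 delta psi) ->
  forall eps, 0 < eps -> exists K, q0 <= 2 ^ K /\
     forall n, rsum n (fun j => INR (S (K + j)) * Rpower (psi (2 ^ (K + j))) delta) <= eps.
Proof.
  intros Hd Hpos Hdec Hconv eps Heps.
  destruct (series_tail_small _ (eps / 12) Hconv) as [N0 HN0]; [lra|].
  destruct (INR_archimed 1 (Rabs q0) ltac:(lra)) as [k2 Hk2].
  set (K' := (S (N0 + k2))%nat).
  assert (HK' : forall k, (K' <= k)%nat -> q0 <= 2 ^ k).
  { intros k Hk. apply Rle_trans with (2 ^ k2); [|apply Rle_pow; [lra|unfold K' in Hk; lia]].
    pose proof (pow2_gt k2). pose proof (Rle_abs q0). lra. }
  exists (S K'). split; [apply HK'; lia|]. intros n.
  apply Rle_trans with (12 * rsum n (fun j => rsum (2 ^ (K' + S j) - 2 ^ (K' + j))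
     (fun i => term1 delta psi (2 ^ (K' + j) + i)))).
  - rewrite <- rsum_scal. apply rsum_le. intros j _.
    rewrite (Nat.add_succ_r K' j), (Nat.add_succ_l K' j).
    apply (term1_block delta psi q0); try assumption; [unfold K'; lia|apply HK'; lia].
  - destruct (rsum_blocks (fun j => (2 ^ (K' + j))%nat) (term1 delta psi) n) as [E _].
    { intros j. apply Nat.pow_le_mono_r; lia. }
    rewrite E. assert (rsum (2 ^ (K' + n) - 2 ^ (K' + 0))
      (fun i => term1 delta psi (2 ^ (K' + 0) + i)) <= eps / 12); [|lra].
    apply HN0. pose proof (Nat.pow_gt_lin_r 2 (K' + 0) ltac:(lia)). unfold K' in *. lia.
Qed.

(** Each dyadic block of the harmonic series contributes at most 1. *)
Lemma harmonic_dyadic a r :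
  rsum (2 ^ (a + r) - 2 ^ (a + 0)) (fun i => / INR (2 ^ (a + 0) + i)) <= INR r.
Proof.
  destruct (rsum_blocks (fun j => (2 ^ (a + j))%nat) (fun n => / INR n) r) as [E _].
  { intros j. apply Nat.pow_le_mono_r; lia. }
  rewrite <- E. rewrite <- (Rmult_1_r (INR r)), <- rsum_const. apply rsum_le. intros j _.
  rewrite Nat.add_succ_r, pow2_S_sub. set (m := (2 ^ (a + j))%nat).
  assert (Hm : 0 < INR m) by (apply lt_0_INR; unfold m; pose proof (Nat.pow_nonzero 2 (a + j)); lia).
  apply Rle_trans with (rsum m (fun _ => / INR m)).
  - apply rsum_le. intros i _. apply Rinv_le_contravar; [exact Hm|]. apply le_INR. lia.
  - rewrite rsum_const, Rinv_r; lra.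
Qed.

(** Condensation at the points [2 ^ 2 ^ j]. Between two of them the logarithm is at most
    [2 * 2 ^ j], the reciprocals sum to at most [2 ^ j], and [psi^delta / |ln psi|] is nonincreasing
    because psi is below 1 and nonincreasing; a block is thus at most twice the condensed term.
    Bounded condensed sums would make the series converge. *)
Lemma term2_condensed delta psi q0 : 0 < delta ->
  (forall q, q0 <= q -> 0 < psi q) ->
  (forall x y, q0 <= x -> x <= y -> psi y <= psi x) ->
  (forall q, q0 <= q -> psi q < 1) ->
  ~ series_converges (term2 delta psi) ->
  forall j0 M, exists n, M <= rsum n (fun i => 4 ^ (j0 + i) *
     (Rpower (psi (2 ^ (2 ^ (j0 + i))%nat)) delta / - ln (psi (2 ^ (2 ^ (j0 + i))%nat)))).
Proof.
  intros Hd Hpos Hdec Hlt1 Hnc j0 M. apply NNPP. intros Hno. apply Hnc.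
  set (g := fun q => Rpower (psi q) delta / - ln (psi q)).
  set (a := fun j : nat => 4 ^ j * g (2 ^ (2 ^ j)%nat)).
  assert (Hbd : forall n, rsum n (fun i => a (j0 + i)%nat) < M).
  { intros n. apply Rnot_le_lt. intros H. apply Hno. now exists n. }
  destruct (INR_archimed 1 (Rabs q0) ltac:(lra)) as [k2 Hk2].
  (* From [j1] on the condensation points lie beyond [q0]; the [d] condensed terms skipped only
     alter the bound. *)
  set (d := k2). set (j1 := (j0 + d)%nat).
  assert (Hge : forall j, (j1 <= j)%nat -> q0 <= 2 ^ (2 ^ j)%nat).
  { intros j Hj. pose proof (Nat.pow_gt_lin_r 2 j ltac:(lia)).
    apply Rle_trans with (2 ^ k2); [|apply Rle_pow; [lra|unfold j1, d in Hj; lia]].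
    pose proof (pow2_gt k2). pose proof (Rle_abs q0). lra. }
  assert (Hln : forall q, q0 <= q -> 0 < - ln (psi q)).
  { intros q Hq. pose proof (ln_increasing (psi q) 1 (Hpos q Hq) (Hlt1 q Hq)).
    rewrite ln_1 in H. lra. }
  assert (Hg : forall x y, q0 <= x -> x <= y -> 0 <= g y <= g x).
  { intros x y Hx Hxy. pose proof (Hln x Hx). pose proof (Hln y ltac:(lra)).
    pose proof (Hpos y ltac:(lra)). pose proof (Hdec x y Hx Hxy).
    pose proof (Rpower_pos (psi y) delta). unfold g, Rdiv. split.
    - apply Rmult_le_pos; [lra|left; now apply Rinv_0_lt_compat].
    - apply Rmult_le_compat; [lra|left; now apply Rinv_0_lt_compat| |].
      + apply Rpower_le_l; lra.
      + apply Rinv_le_contravar; [lra|]. apply Ropp_le_contravar.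
        apply ln_le_compat; lra. }
  assert (Hterm : forall k, q0 <= INR k -> term2 delta psi k = ln (INR k) * / INR k * g (INR k)).
  { intros k Hk. unfold term2, g. pose proof (Hln _ Hk).
    rewrite Rabs_left by lra. unfold Rdiv. rewrite Rinv_mult. ring. }
  set (Nj := fun i => (2 ^ 2 ^ (j1 + i))%nat).
  assert (HNj : forall i, INR (Nj i) = 2 ^ (2 ^ (j1 + i))%nat) by (intros; apply INR_pow2).
  assert (HNq : forall i k, q0 <= INR (Nj i + k)).
  { intros i k. rewrite plus_INR, HNj. pose proof (pos_INR k). specialize (Hge (j1 + i)%nat).
    assert (q0 <= 2 ^ (2 ^ (j1 + i))%nat) by (apply Hge; lia). lra. }
  assert (HN1 : forall i k, 1 <= INR (Nj i + k)).
  { intros i k. rewrite plus_INR, HNj. pose proof (pos_INR k).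
    assert (1 <= 2 ^ (2 ^ (j1 + i))%nat) by (apply pow_R1_Rle; lra). lra. }
  assert (Hnn : forall k, 0 <= term2 delta psi (Nj 0%nat + k)).
  { intros k. rewrite Hterm by apply HNq. pose proof (HN1 0%nat k).
    apply Rmult_le_pos; [apply Rmult_le_pos|].
    - rewrite <- ln_1. apply ln_le_compat; lra.
    - left. apply Rinv_0_lt_compat. lra.
    - apply (Hg _ _ (HNq 0%nat k) (Rle_refl _)). }
  assert (Hblock : forall i, rsum (Nj (S i) - Nj i) (fun k => term2 delta psi (Nj i + k))
     <= 2 * a (j1 + i)%nat).
  { intros i. set (j := (j1 + i)%nat). set (G := g (2 ^ (2 ^ j)%nat)).
    assert (HG : 0 <= G) by apply (Hg _ _ (Hge j ltac:(unfold j; lia)) (Rle_refl _)).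
    assert (H4 : 4 ^ j = 2 ^ j * 2 ^ j) by (rewrite <- Rpow_mult_distr; f_equal; lra).
    assert (HNS : Nj (S i) = (2 ^ (2 ^ j + 2 ^ j))%nat).
    { unfold Nj. f_equal. rewrite Nat.add_succ_r. simpl. unfold j. lia. }
    assert (HN0 : Nj i = (2 ^ (2 ^ j + 0))%nat) by (unfold Nj; now rewrite Nat.add_0_r).
    apply Rle_trans with (rsum (Nj (S i) - Nj i) (fun k => (2 * 2 ^ j * G) * / INR (Nj i + k))).
    - apply rsum_le. intros k Hk. rewrite Hterm by apply HNq. pose proof (HN1 i k) as H1.
      assert (Hi0 : 0 < / INR (Nj i + k)) by (apply Rinv_0_lt_compat; lra).
      assert (Hln2 : ln (INR (Nj i + k)) <= 2 * 2 ^ j).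
      { apply Rle_trans with (ln (2 ^ (2 ^ j + 2 ^ j)%nat)).
        - apply ln_le_compat; [lra|]. rewrite <- INR_pow2, <- HNS. apply le_INR. lia.
        - rewrite ln_pow2, plus_INR, INR_pow2. pose proof (ln_le_sub1 2 ltac:(lra)).
          assert (0 < 2 ^ j) by (apply pow_lt; lra). nra. }
      assert (HgG : 0 <= g (INR (Nj i + k)) <= G).
      { apply Hg; [apply Hge; unfold j; lia|]. rewrite plus_INR, HNj. pose proof (pos_INR k).
        fold j. lra. }
      assert (0 <= ln (INR (Nj i + k))) by (rewrite <- ln_1; apply ln_le_compat; lra).
      replace (ln (INR (Nj i + k)) * / INR (Nj i + k) * g (INR (Nj i + k))) with
        (ln (INR (Nj i + k)) * g (INR (Nj i + k)) * / INR (Nj i + k)) by ring.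
      apply Rmult_le_compat_r; [lra|]. apply Rmult_le_compat; lra.
    - rewrite rsum_scal, HNS, HN0. pose proof (harmonic_dyadic (2 ^ j) (2 ^ j)) as Hh.
      rewrite INR_pow2 in Hh. unfold a. fold G. rewrite H4.
      assert (0 < 2 ^ j) by (apply pow_lt; lra).
      apply Rle_trans with (2 * 2 ^ j * G * 2 ^ j); [|right; ring].
      apply Rmult_le_compat_l; [nra|exact Hh]. }
  apply (series_converges_bounded _ (Nj 0%nat)
    (2 * (M - rsum d (fun i => a (j0 + i)%nat)))); [exact Hnn|].
  intros n.
  assert (Hmono : forall i, (Nj i <= Nj (S i))%nat).
  { intros i. unfold Nj. apply Nat.pow_le_mono_r; [lia|]. apply Nat.pow_le_mono_r; lia. }
  assert (Hbig : forall i, (i <= Nj i - Nj 0%nat)%nat).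
  { assert (Hstrict : forall i, (Nj i < Nj (S i))%nat).
    { intros i. unfold Nj. apply Nat.pow_lt_mono_r; [lia|]. apply Nat.pow_lt_mono_r; lia. }
    assert (H : forall i, (i + Nj 0%nat <= Nj i)%nat).
    { induction i as [|i IH]; [lia|]. specialize (Hstrict i). lia. }
    intros i. specialize (H i). lia. }
  destruct (rsum_blocks Nj (term2 delta psi) n Hmono) as [E _].
  apply Rle_trans with (rsum (Nj n - Nj 0%nat) (fun i => term2 delta psi (Nj 0%nat + i))).
  - apply rsum_le_len; [apply Hbig|exact Hnn].
  - rewrite <- E. apply Rle_trans with (rsum n (fun i => 2 * a (j1 + i)%nat)).
    + apply rsum_le. intros i _. apply Hblock.
    + rewrite rsum_scal. specialize (Hbd (d + n)%nat). rewrite rsum_app in Hbd.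
      rewrite (rsum_ext n _ (fun i => a (j0 + (d + i))%nat)); [lra|].
      intros i _. f_equal. unfold j1. lia.
Qed.

(** From [exp (- 1/6) >= 5/6] and [(5/6)^6 > 1/3]. It allows the threshold 3 in the examples, where
    [ln q > 1] is required. *)
Lemma exp_1_lt_3 : exp 1 < 3.
Proof.
  pose proof (exp_ineq1_le (- (1 / 6))) as H.
  assert (H6 : exp 1 * exp (- (1/6)) ^ 6 = 1).
  { simpl. rewrite Rmult_1_r, <- !exp_plus. rewrite <- exp_0. f_equal. field. }
  assert (H5 : (5 / 6) ^ 6 <= exp (- (1/6)) ^ 6) by (apply pow_incr; lra).
  pose proof (exp_pos 1). assert ((5 / 6) ^ 6 > 1 / 3) by (simpl; lra). nra.
Qed.

Lemma ln_gt_1 q : 3 <= q -> 1 < ln q.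
Proof.
  intros H. rewrite <- (ln_exp 1). apply ln_increasing; [apply exp_pos|].
  pose proof exp_1_lt_3. lra.
Qed.

Lemma psi_log_lt1 t q : 0 < t -> 3 <= q -> psi_log t q < 1.
Proof.
  intros Ht Hq. pose proof (ln_gt_1 q Hq). unfold psi_log, Rpower. rewrite <- exp_0.
  apply exp_increasing. pose proof (ln_increasing 1 (ln q)). rewrite ln_1 in H0. nra.
Qed.

Lemma psi_log_admissible t : 0 < t -> admissible (psi_log t) 3.
Proof.
  intros Ht. split; [|split; [|split]].
  - intros. apply Rpower_pos.
  - intros x y Hx Hxy. pose proof (ln_gt_1 x Hx). apply Rpower_anti; [lra|].
    split; [lra|apply ln_le_compat; lra].
  - exists 1. intros q Hq. left. now apply psi_log_lt1.
  (* Beyond this threshold [|ln K| <= ln q / 2], so [ln (K q)] lies between [ln q / 2] and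
     [2 ln q]. *)
  - intros K HK. exists (Rpower 2 (- t)), (Rpower (/ 2) (- t)), (exp (2 * Rabs (ln K) + 2)).
    split; [apply Rpower_pos|split; [apply Rpower_pos|]]. intros q Hq.
    pose proof (exp_pos (2 * Rabs (ln K) + 2)).
    assert (Hl : 2 * Rabs (ln K) + 2 <= ln q).
    { rewrite <- (ln_exp (2 * Rabs (ln K) + 2)). apply ln_le_compat; lra. }
    pose proof (Rle_abs (ln K)). pose proof (Rabs_pos (ln K)).
    pose proof (Rle_abs (- ln K)). rewrite Rabs_Ropp in H2.
    unfold psi_log. rewrite ln_mult by lra.
    rewrite !Rpower_mult_distr by lra. split; apply Rpower_anti; lra.
Qed.

(** Integral comparison for the power [- (1 + e)] on one step, obtained from [1 + z <= exp z] in
    place of the mean value theorem. *)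
Lemma Rpower_telescope e x y : 0 < e -> 0 < x <= y ->
  e * Rpower y (- (1 + e)) * (y - x) <= Rpower x (- e) - Rpower y (- e).
Proof.
  intros He [Hx Hy].
  assert (E1 : Rpower x (- e) = Rpower y (- e) * exp (e * (ln y - ln x))).
  { unfold Rpower. rewrite <- exp_plus. f_equal. ring. }
  assert (E2 : Rpower y (- (1 + e)) = Rpower y (- e) * / y).
  { unfold Rpower. rewrite <- (exp_ln y) at 3 by lra. rewrite <- exp_Ropp, <- exp_plus.
    f_equal. ring. }
  rewrite E1, E2. pose proof (Rpower_pos y (- e)) as HP.
  pose proof (exp_ineq1_le (e * (ln y - ln x))) as H1.
  assert (H2 : / y * (y - x) <= ln y - ln x).
  { pose proof (ln_le_sub1 (x / y) ltac:(apply Rdiv_lt_0_compat; lra)) as H2.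
    unfold Rdiv in H2. rewrite ln_mult, ln_Rinv in H2 by (try apply Rinv_0_lt_compat; lra).
    replace (/ y * (y - x)) with (1 - x * / y) by (field; lra). lra. }
  apply Rle_trans with (Rpower y (- e) * (e * (ln y - ln x))); [|nra].
  replace (e * (Rpower y (- e) * / y) * (y - x)) with
    (Rpower y (- e) * (e * (/ y * (y - x)))) by ring.
  apply Rmult_le_compat_l; [lra|]. apply Rmult_le_compat_l; lra.
Qed.

Lemma ln_succ_ge k : 0 < k -> / (k + 1) <= ln (k + 1) - ln k.
Proof.
  intros Hk. pose proof (ln_le_sub1 (k / (k + 1)) ltac:(apply Rdiv_lt_0_compat; lra)) as H.
  unfold Rdiv in H. rewrite ln_mult, ln_Rinv in H by (try apply Rinv_0_lt_compat; lra).
  replace (k * / (k + 1)) with (1 - / (k + 1)) in H by (field; lra). lra.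
Qed.

Lemma term1_psi_log_converges delta eps : 0 < delta -> 0 < eps ->
  series_converges (term1 delta (psi_log (2 / delta + eps))).
Proof.
  (* The power [delta] of psi is [(ln q)^(- (2 + e))], and the factor [ln q] leaves
     [(ln q)^(- (1 + e)) / q], which telescopes against [(ln q)^(- e)]. *)
  intros Hd He. set (e := eps * delta). assert (He' : 0 < e) by (unfold e; nra).
  assert (Hterm : forall k, (3 <= k)%nat -> term1 delta (psi_log (2 / delta + eps)) k =
    Rpower (ln (INR k)) (- (1 + e)) * / INR k).
  { intros k Hk. assert (Hk3 : 3 <= INR k) by (replace 3 with (INR 3) by (simpl; lra); now apply le_INR).
    pose proof (ln_gt_1 _ Hk3). unfold term1, psi_log. rewrite Rpower_mult.
    unfold Rdiv at 1. f_equal. rewrite <- (Rpower_1 (ln (INR k))) at 1 by lra.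
    rewrite <- Rpower_plus. f_equal. unfold e. field. lra. }
  apply (series_converges_bounded _ 3 (/ e * Rpower (ln 2) (- e))).
  - intros i. rewrite Hterm by lia. left. apply Rmult_lt_0_compat; [apply Rpower_pos|].
    apply Rinv_0_lt_compat. apply lt_0_INR. lia.
  - assert (Hind : forall n, e * rsum n (fun i => term1 delta (psi_log (2 / delta + eps)) (3 + i))
      <= Rpower (ln 2) (- e) - Rpower (ln (INR (2 + n))) (- e)).
    { induction n as [|n IH]; [simpl; right; rewrite Rmult_0_r; replace (1 + 1) with 2 by lra; ring|].
      cbn [rsum]. rewrite Rmult_plus_distr_l, Hterm by lia.
      replace (3 + n)%nat with (S (2 + n)) by lia. replace (2 + S n)%nat with (S (2 + n)) by lia.
      set (k := INR (2 + n)) in *. rewrite S_INR. fold k.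
      assert (Hk : 2 <= k).
      { unfold k. replace 2 with (INR 2) by (simpl; lra). apply le_INR. lia. }
      assert (Hlk : 0 < ln k). { pose proof ln_lt_2. pose proof (ln_le_compat 2 k). lra. }
      pose proof (ln_succ_ge k ltac:(lra)) as Hs.
      assert (Hi : 0 < / (k + 1)) by (apply Rinv_0_lt_compat; lra).
      pose proof (Rpower_telescope e (ln k) (ln (k + 1)) He' ltac:(lra)) as HT.
      pose proof (Rpower_pos (ln (k + 1)) (- (1 + e))) as HP.
      assert (e * (Rpower (ln (k + 1)) (- (1 + e)) * / (k + 1)) <=
        e * Rpower (ln (k + 1)) (- (1 + e)) * (ln (k + 1) - ln k)).
      { rewrite <- Rmult_assoc. apply Rmult_le_compat_l; [nra|exact Hs]. }
      lra. }
    intros n. specialize (Hind n). pose proof (Rpower_pos (ln (INR (2 + n))) (- e)).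
    apply Rmult_le_reg_l with e; [exact He'|]. rewrite <- Rmult_assoc, Rinv_r by lra. lra.
Qed.

Lemma ln_increment x h : 0 < x -> 0 <= h -> ln (x + h) - ln x <= h / x.
Proof.
  intros Hx Hh. replace (x + h) with (x * (1 + h / x)) by (field; lra).
  assert (0 <= h / x) by (apply Rmult_le_pos; [lra|left; now apply Rinv_0_lt_compat]).
  rewrite ln_mult by lra. pose proof (ln_le_sub1 (1 + h / x)). lra.
Qed.

(** The term equals [(delta / 2) / (q ln q ln (ln q))], which dominates [delta / 2] times the
    increment of the unbounded function [ln (ln (ln q))]; applying [ln_increment] to the three
    logarithms in turn gives the comparison. *)
Lemma term2_psi_log_diverges delta : 0 < delta ->
  ~ series_converges (term2 delta (psi_log (2 / delta))).
Proof.
  intros Hd Hconv. destruct (series_tail_small _ 1 Hconv ltac:(lra)) as [N0 HN0].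
  set (M := (3 + N0)%nat). specialize (HN0 M).
  set (L3 := fun k : nat => ln (ln (ln (INR k)))).
  assert (Hstep : forall k, (3 <= k)%nat ->
    delta / 2 * (L3 (S k) - L3 k) <= term2 delta (psi_log (2 / delta)) k).
  { intros k Hk. assert (Hk3 : 3 <= INR k) by (replace 3 with (INR 3) by (simpl; lra); now apply le_INR).
    pose proof (ln_gt_1 _ Hk3) as Hl. set (x := INR k) in *.
    assert (Hll : 0 < ln (ln x)). { rewrite <- ln_1. apply ln_increasing; lra. }
    assert (H1 : ln (x + 1) - ln x <= / x).
    { pose proof (ln_increment x 1). unfold Rdiv in H. rewrite Rmult_1_l in H. apply H; lra. }
    assert (H1' : ln x <= ln (x + 1)) by (apply ln_le_compat; lra).
    assert (Hx : 0 < / x) by (apply Rinv_0_lt_compat; lra).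
    assert (H2' : ln (ln x) <= ln (ln (x + 1))) by (apply ln_le_compat; lra).
    assert (H2 : ln (ln (x + 1)) - ln (ln x) <= / x / ln x).
    { replace (ln (x + 1)) with (ln x + (ln (x + 1) - ln x)) by ring.
      eapply Rle_trans; [apply ln_increment; lra|]. unfold Rdiv.
      apply Rmult_le_compat_r; [left; apply Rinv_0_lt_compat; lra|lra]. }
    assert (H3 : L3 (S k) - L3 k <= / x / ln x / ln (ln x)).
    { unfold L3. rewrite S_INR. fold x.
      replace (ln (ln (x + 1))) with (ln (ln x) + (ln (ln (x + 1)) - ln (ln x))) by ring.
      eapply Rle_trans; [apply ln_increment; lra|]. unfold Rdiv.
      apply Rmult_le_compat_r; [left; apply Rinv_0_lt_compat; lra|exact H2]. }
    apply Rle_trans with (delta / 2 * (/ x / ln x / ln (ln x)));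
      [apply Rmult_le_compat_l; lra|].
    right. unfold term2, psi_log. fold x. rewrite Rpower_mult.
    replace (- (2 / delta) * delta) with (- (2)) by (field; lra).
    rewrite Rpower_Ropp. replace (Rpower (ln x) 2) with (ln x * ln x).
    2:{ replace 2 with (1 + 1) by lra. rewrite Rpower_plus, Rpower_1; lra. }
    unfold Rpower. rewrite ln_exp.
    assert (H2d : 0 < 2 / delta) by (apply Rdiv_lt_0_compat; lra).
    rewrite Rabs_left by nra. field. repeat split; lra. }
  assert (Hsum : forall n, delta / 2 * (L3 (M + n)%nat - L3 M) <= 1).
  { intros n. eapply Rle_trans; [|apply (HN0 n); unfold M; lia].
    induction n as [|n IH].
    - rewrite Nat.add_0_r. simpl. right. ring.
    - cbn [rsum]. rewrite Nat.add_succ_r. specialize (Hstep (M + n)%nat ltac:(unfold M; lia)). lra. }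
  set (b := L3 M + 2 / delta + 1).
  destruct (INR_archimed 1 (exp (exp (exp b))) ltac:(lra)) as [n Hn].
  specialize (Hsum n).
  assert (Hb : b < L3 (M + n)%nat).
  { unfold L3. pose proof (exp_pos b). pose proof (exp_pos (exp b)).
    pose proof (exp_pos (exp (exp b))). pose proof (pos_INR M).
    assert (Hn' : exp (exp (exp b)) < INR (M + n)) by (rewrite plus_INR; lra).
    rewrite <- (ln_exp b). apply ln_increasing; [lra|].
    rewrite <- (ln_exp (exp b)). apply ln_increasing; [lra|].
    rewrite <- (ln_exp (exp (exp b))). apply ln_increasing; lra. }
  unfold b in Hb.
  assert (delta / 2 * (2 / delta + 1) < delta / 2 * (L3 (M + n)%nat - L3 M))
    by (apply Rmult_lt_compat_l; lra).
  replace (delta / 2 * (2 / delta + 1)) with (1 + delta / 2) in H by (field; lra). lra.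
Qed.

(** * The Moran sum at the Hausdorff dimension *)

Section Dimension.
Context (F : IFS) (lo hi : R).
Context (HN : (2 <= ifsN F)%nat).
Context (Hp : forall a, (a < ifsN F)%nat -> ifsp F a = 1%Z \/ ifsp F a = (-1)%Z).
Context (Hq : forall a, (a < ifsN F)%nat -> (2 <= ifsq F a)%nat).
Context (Hlh : lo <= hi).
Context (Hin : forall a x, (a < ifsN F)%nat -> in_I lo hi x -> in_I lo hi (u F a x)).
Context (Hsep : forall a b x y, (a < ifsN F)%nat -> (b < ifsN F)%nat -> a <> b ->
        in_I lo hi x -> in_I lo hi y -> u F a x <> u F b y).

(** A Moran sum above 1 at [delta] would still be at least 1 at some [delta + eta], where the limit
    set is not null. Nullity passes to larger exponents, so [delta + eta] would be a lower bound
    exceeding the infimum. *)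
Lemma moran_dim_le1 delta : hausdorff_dim (limit_set F) delta ->
  0 <= delta /\ moran F delta <= 1.
Proof.
  intros [Hlb Hglb].
  assert (Hd0 : 0 <= delta) by (apply Hglb; intros s [H _]; exact H).
  split; [exact Hd0|]. apply Rnot_lt_le. intros HW.
  destruct (nat_bounded (ifsq F) (ifsN F)) as [M HM].
  set (W := moran F delta) in *. set (Q := INR M + 2). pose proof (pos_INR M).
  assert (HlW : 0 < ln W) by (rewrite <- ln_1; apply ln_increasing; lra).
  assert (HlQ : 0 < ln Q) by (rewrite <- ln_1; apply ln_increasing; unfold Q; lra).
  (* Raising the exponent by [eta] costs at most the factor [Q^(- eta) = W^(- 1/2)], which leaves at
     least the square root of [W]. *)
  set (eta := ln W / (2 * ln Q)).
  assert (Heta : 0 < eta) by (apply Rdiv_lt_0_compat; lra).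
  assert (Hm : 1 <= moran F (delta + eta)).
  { apply Rle_trans with (Rpower Q (- eta) * W).
    - unfold Rpower. rewrite <- (exp_ln W) at 1 by lra. rewrite <- exp_plus, <- exp_0.
      apply exp_le_compat. unfold eta.
      replace (- (ln W / (2 * ln Q)) * ln Q + ln W) with (ln W / 2) by (field; lra). lra.
    - unfold W, moran. rewrite <- rsum_scal. apply rsum_le. intros a Ha. unfold pw.
      pose proof (q_ge2 F Hq a Ha). specialize (HM a Ha). apply le_INR in HM.
      replace (- (delta + eta)) with (- eta + - delta) by ring. rewrite Rpower_plus.
      apply Rmult_le_compat_r; [left; apply Rpower_pos|].
      apply Rpower_anti; [lra|]. unfold Q. lra. }
  apply (limit_set_not_null F lo hi HN Hp Hq Hlh Hin Hsep (delta + eta)); [lra|exact Hm|].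
  apply NNPP. intros Hno.
  assert (delta + eta <= delta); [|lra].
  apply Hglb. intros s [_ Hs]. apply Rnot_lt_le. intros Hlt. apply Hno.
  apply (H_null_mono s); [lra|exact Hs].
Qed.

(** At exponent 0 the Moran sum is the number of letters, at least 2. *)
Lemma dim_pos delta : hausdorff_dim (limit_set F) delta -> 0 < delta.
Proof.
  intros H. destruct (moran_dim_le1 delta H) as [H0 H1].
  destruct H0 as [H0|E]; [exact H0|exfalso]. subst delta. unfold moran in H1.
  rewrite (rsum_ext _ _ (fun _ => 1)) in H1.
  - rewrite rsum_const in H1. apply le_INR in HN. simpl in HN. lra.
  - intros a Ha. unfold pw. rewrite Ropp_0. apply Rpower_O. pose proof (q_ge2 F Hq a Ha). lra.
Qed.

(** The cylinders of generation [n] cost [D ^ s] times the [n]-th power of the Moran sum, which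
    tends to 0. *)
Lemma limit_set_null s : 0 < s -> moran F s < 1 -> H_null s (limit_set F).
Proof.
  intros Hs HW. apply H_null_lists; [exact Hs|]. intros eps Heps.
  set (D := hi - lo + 1). assert (HD : 0 < D) by (unfold D; lra).
  pose proof (Rpower_pos D s) as HDs.
  assert (HW0 : 0 <= moran F s) by (apply rsum_nonneg; intros; left; apply pw_pos).
  destruct (pow_lt_1_zero (moran F s) ltac:(rewrite Rabs_pos_eq; lra) (eps / Rpower D s))
    as [n Hn]; [apply Rdiv_lt_0_compat; lra|].
  specialize (Hn n (le_n _)). rewrite Rabs_pos_eq in Hn by now apply pow_le.
  exists (fun i => match i with O =>
     map (fun v => ((fun x => exists w, valid_word F w /\ pre w n = v /\ x = pt F w), D / qw F v))
       (words (ifsN F) n) | _ => [] end). split; [|split].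
  - intros x [w [Hw Hcod]]. exists 0%nat. eexists. split.
    + apply in_map_iff. exists (pre w n). split; [reflexivity|].
      apply in_words. split; [apply pre_length|now apply pre_valid].
    + simpl. exists w. split; [exact Hw|split; [reflexivity|]].
      now apply (coding_pt F lo hi).
  - intros [|i] e He; [|destruct He]. apply in_map_iff in He. destruct He as [v [<- Hv]].
    apply in_words in Hv. destruct Hv as [_ Hv]. simpl.
    split; [left; apply Rdiv_lt_0_compat; [lra|now apply qw_pos]|].
    intros x y [w [Hw [Ew Hx]]] [w' [Hw' [Ew' Hy]]]. rewrite Hx, Hy.
    eapply Rle_trans; [apply (pt_close F lo hi HN Hp Hq Hlh Hin w w' n Hw Hw')|].
    + apply pre_eq. congruence.
    + rewrite <- Ew, qw_pre. unfold Rdiv. apply Rmult_le_compat_r; [|unfold D; lra].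
      left. apply Rinv_0_lt_compat. now apply Qp_pos.
  - intros m. apply Rle_trans with (lsum (fun v => Rpower D s * wt F s v) (words (ifsN F) n)).
    + destruct m as [|m]; [simpl; apply lsum_nonneg; intros v _|].
      { apply Rmult_le_pos; [lra|left; apply wt_pos]. }
      rewrite rsum_S_l. rewrite (rsum_ext m _ (fun _ => 0)) by reflexivity.
      rewrite rsum_const, lsum_map, Rmult_0_r, Rplus_0_r. apply lsum_le. intros v Hv.
      apply in_words in Hv. destruct Hv as [_ Hv]. simpl.
      assert (Hqv : 0 < qw F v) by now apply qw_pos.
      rewrite rpow_pos_eq by (now apply Rdiv_lt_0_compat).
      rewrite (wt_qw F s Hq) by exact Hv. right. unfold Rpower.
      rewrite <- exp_plus. f_equal. unfold Rdiv.
      rewrite ln_mult, ln_Rinv by (try apply Rinv_0_lt_compat; assumption). ring.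
    + rewrite lsum_scal, lsum_words_wt. apply Rmult_le_reg_l with (/ Rpower D s);
        [now apply Rinv_0_lt_compat|].
      rewrite <- Rmult_assoc, Rinv_l, Rmult_1_l by lra. unfold Rdiv in Hn. lra.
Qed.

End Dimension.

Theorem theorem4p5 (F : IFS) (delta : R) :
  rational_IFS F -> hausdorff_dim (limit_set F) delta ->
  (forall (psi : R -> R) (q0 : R), admissible psi q0 ->
     (series_converges (term1 delta psi) ->
        mu_ae F delta (badly_symb_approx F psi)) /\
     ((forall q, q0 <= q -> psi q < 1) ->
        ~ series_converges (term2 delta psi) ->
        mu_ae F delta (symb_well_approx F psi))) /\
  (forall eps, 0 < eps ->
     let psi := psi_log (2 / delta + eps) in
     admissible psi 3 /\ series_converges (term1 delta psi) /\
     mu_ae F delta (badly_symb_approx F psi)) /\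
  (let psi := psi_log (2 / delta) in
     admissible psi 3 /\ (forall q, 3 <= q -> psi q < 1) /\
     ~ series_converges (term2 delta psi) /\
     mu_ae F delta (symb_well_approx F psi)).
Proof.
  intros [HN [Hp [Hq [lo [hi [Hlh [Hin Hsep]]]]]]] Hdim.
  pose proof (dim_pos F lo hi HN Hp Hq Hlh Hin Hsep delta Hdim) as Hd.
  destruct (moran_dim_le1 F lo hi HN Hp Hq Hlh Hin Hsep delta Hdim) as [_ HW].
  assert (Main : forall (psi : R -> R) (q0 : R), admissible psi q0 ->
     (series_converges (term1 delta psi) ->
        mu_ae F delta (badly_symb_approx F psi)) /\
     ((forall q, q0 <= q -> psi q < 1) ->
        ~ series_converges (term2 delta psi) ->
        mu_ae F delta (symb_well_approx F psi))).
  { intros psi q0 [Hpos [Hdec _]]. split.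
    - intros Hconv. apply (badly_ae F lo hi HN Hp Hq Hlh Hin delta psi q0); try assumption.
      now apply term1_condensed.
    (* A strict inequality makes the whole limit set null, so the conclusion is immediate; equality
       supplies the probability weights needed by [well_ae]. *)
    - intros Hlt1 Hdiv. destruct HW as [HW|HW].
      + apply (H_null_subset delta _ (limit_set F)); [tauto|].
        now apply (limit_set_null F lo hi).
      + apply (well_ae F lo hi HN Hp Hq Hlh Hin delta psi q0); try assumption.
        now apply (term2_condensed delta psi q0). }
  assert (H2d : 0 < 2 / delta) by (apply Rdiv_lt_0_compat; lra).
  split; [exact Main|split].
  - intros eps Heps psi. assert (Ha : admissible psi 3) by (apply psi_log_admissible; lra).
    assert (Hc : series_converges (term1 delta psi)) by now apply term1_psi_log_converges.
    split; [exact Ha|split; [exact Hc|]]. now apply (Main psi 3).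
  - intros psi. assert (Ha : admissible psi 3) by (apply psi_log_admissible; lra).
    assert (Hlt : forall q, 3 <= q -> psi q < 1) by (intros; apply psi_log_lt1; lra).
    assert (Hc : ~ series_converges (term2 delta psi)) by now apply term2_psi_log_diverges.
    split; [exact Ha|split; [exact Hlt|split; [exact Hc|]]]. now apply (Main psi 3).
Qed.
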